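(* Let $\rho$ be the Weibull$(2)$ distribution and let $C_{n,n}^\rho$ be the total cost of the stable matching in $K_{n,n}^\rho$. Then, as $n\to\infty$, $$\frac{\mathrm{Var}(C_{n,n}^\rho)}{\log n}\longrightarrow\frac19$$ and $$\frac{C_{n,n}^\rho-\mathbb{E}\,C_{n,n}^\rho}{\sqrt{\mathrm{Var}(C_{n,n}^\rho)}}\longrightarrow\mathcal{N}(0,1)\quad\text{in distribution}.$$
   Context: The Weibull$(2)$ distribution has density $2xe^{-x^2}$, $x\ge0$. $K_{n,n}^\rho$ is the complete bipartite graph with vertex sets $V_n,V_n'$, each of size $n$, whose edges $e=(v,v')$, $v\in V_n$, $v'\in V_n'$, carry i.i.d. non-negative costs $\omega(e)$ with distribution $\rho$. A matching is a set of pairwise non-adjacent edges. The matching cost of a vertex is the cost of the edge of the matching incident to it (and $\infty$ if it is unmatched). A matching is stable if for every pair $v\in V_n$, $v'\in V_n'$, either $v$ and $v'$ are matched to each other or at least one of them has matching cost smaller than $\omega(v,v')$. Almost surely there is a unique stable matching; it is perfect and is obtained by the greedy algorithm which repeatedly adds the cheapest edge among those with both endpoints still unmatched. Its total cost $C_{n,n}^\rho$ is the sum of the costs of its $n$ edges. *)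

(* Defs.v *)
From HB Require Import structures.
From mathcomp Require Import all_boot all_order all_algebra.
From mathcomp Require Import all_classical all_reals all_analysis.
From mathcomp Require Import measurable_realfun.

Set Implicit Arguments.
Unset Strict Implicit.
Unset Printing Implicit Defensive.

Import Order.TTheory GRing.Theory Num.Theory.
Import numFieldNormedType.Exports.

Local Open Scope classical_set_scope.
Local Open Scope ring_scope.

Section bipartite.
Variables (R : realType) (n : nat).

(* Vertices of K_{n,n}: [inl] for V_n, [inr] for V_n'. The edge joining
   [inl i] to [inr j] is the pair (i, j). *)
Definition vertex : finType := ('I_n + 'I_n)%type.
Definition edge : finType := ('I_n * 'I_n)%type.

Definition incident (v : vertex) (e : edge) : bool :=
  match v with inl i => e.1 == i | inr j => e.2 == j end.

Definition adjacent (e f : edge) : bool :=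
  [exists v : vertex, incident v e && incident v f].

Definition is_matching (M : {set edge}) : bool :=
  [forall e in M, forall f in M, (e != f) ==> ~~ adjacent e f].

Definition matching_cost (w : edge -> R) (M : {set edge}) (v : vertex)
  : \bar R :=
  if [pick e in M | incident v e] is Some e then (w e)%:E else +oo%E.

Definition stable (w : edge -> R) (M : {set edge}) : bool :=
  is_matching M &&
  [forall i : 'I_n, forall j : 'I_n,
    [|| (i, j) \in M,
        (matching_cost w M (inl i) < (w (i, j))%:E)%E
      | (matching_cost w M (inr j) < (w (i, j))%:E)%E]].

(* For i.i.d. costs with a density there is almost surely exactly one stable
   matching; the choice, and the default empty set when there is none, only
   matter on a null event (ties between costs). *)
Definition stable_matching (w : edge -> R) : {set edge} :=
  odflt finset.set0 [pick M : {set edge} | stable w M].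

Definition total_cost (w : edge -> R) (M : {set edge}) : R :=
  \sum_(e in M) w e.

End bipartite.

Section stable_cost.
Context {d : measure_display} {T : measurableType d} {R : realType}.
Variables (P : probability T R) (n : nat).
Variable w : edge n -> {RV P >-> R}.

Definition stable_cost (x : T) : R :=
  total_cost (fun e => w e x) (stable_matching (fun e => w e x)).

Let measurable_matching_cost_lt (M : {set edge n}) v e :
  measurable_fun setT
    (fun x => (matching_cost (fun f => w f x) M v < (w e x)%:E)%E).
Proof.
rewrite /matching_cost; case: pickP => [f _|_].
  under eq_fun do rewrite lte_fin.
  exact: measurable_fun_ltr.
by under eq_fun do rewrite ltNge leey; exact: measurable_cst.
Qed.

Let measurable_forallb (I : finType) (f : I -> T -> bool) :
  (forall i, measurable_fun setT (f i)) ->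
  measurable_fun setT (fun x => [forall i, f i x]).
Proof.
move=> mf; have -> : (fun x => [forall i, f i x]) =
    fun x => all (fun i => f i x) (enum I).
  apply/funext => x; apply/forallP/allP => [fx i _|fx i]; first exact: fx.
  by rewrite fx ?mem_enum.
by elim: (enum I) => [|i s IH] /=; [exact: measurable_cst|exact: measurable_and].
Qed.

Let measurable_stable (M : {set edge n}) :
  measurable_fun setT (fun x => stable (fun e => w e x) M).
Proof.
rewrite /stable; apply: measurable_and; first exact: measurable_cst.
apply: measurable_forallb => i; apply: measurable_forallb => j.
apply: measurable_or; first exact: measurable_cst.
by apply: measurable_or; exact: measurable_matching_cost_lt.
Qed.

Lemma measurable_stable_cost : measurable_fun setT stable_cost.
Proof.
pose g (phi : {ffun {set edge n} -> bool}) : {set edge n} :=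
  odflt finset.set0 [pick M | phi M].
have -> : stable_cost = fun x => \sum_(phi : {ffun {set edge n} -> bool})
    (if [forall M, stable (fun e => w e x) M == phi M]
     then total_cost (fun e => w e x) (g phi) else 0).
  apply/funext => x; pose psi := [ffun M => stable (fun e => w e x) M].
  rewrite (bigD1 psi)//= big1 ?addr0 => [|phi phiN].
    rewrite ifT; last by apply/forallP => M; rewrite ffunE.
    rewrite /stable_cost /stable_matching /g; congr (total_cost _ (odflt _ _)).
    by apply: eq_pick => M; rewrite ffunE.
  case: ifPn => // /forallP E; case/eqP: phiN; apply/ffunP => M.
  by rewrite ffunE (eqP (E M)).
apply: measurable_sum => phi; apply: measurable_fun_ifT => /=.
- apply: measurable_forallb => M; case: (phi M).
    by under eq_fun do rewrite eqb_id; exact: measurable_stable.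
  by under eq_fun do rewrite eqbF_neg; exact: measurable_neg.
- rewrite (_ : (fun x => _) = fun x =>
      \sum_(e : edge n) if e \in g phi then w e x else 0).
    by apply: measurable_sum => e; case: (e \in g phi).
  by apply/funext => x; exact: big_mkcond.
- exact: measurable_cst.
Qed.

HB.instance Definition _ :=
  isMeasurableFun.Build _ _ _ _ stable_cost measurable_stable_cost.

End stable_cost.

Section standardize.
Context {d : measure_display} {T : measurableType d} {R : realType}.
Variables (P : probability T R) (X : {RV P >-> R}).
Local Open Scope ereal_scope.

Definition standardize (x : T) : R :=
  ((X x - fine 'E_P[X]) / Num.sqrt (fine 'V_P[X]))%R.

Lemma measurable_standardize : measurable_fun setT standardize.
Proof. 
apply: measurable_funM; last exact: measurable_cst.
by apply: measurable_funB.
Qed.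

HB.instance Definition _ :=
  isMeasurableFun.Build _ _ _ _ standardize measurable_standardize.

End standardize.

Definition mutually_independent {d : measure_display} {T : measurableType d}
    {R : realType} (P : probability T R) (I : finType)
    (X : I -> {RV P >-> R}) : Prop :=
  forall (J : {set I}) (A : I -> set R),
    (forall i, measurable (A i)) ->
    P (\bigcap_(i in [set` J]) (X i @^-1` A i)) =
    (\prod_(i in J) P (X i @^-1` A i))%E.

Section weibull.
Variable R : realType.

Definition weibull2_pdf : R -> R :=
  (fun x : R => 2 * x * expR (- x ^+ 2)) \_ `[0, +oo[.

Definition weibull2_prob (A : set R) : \bar R :=
  (\int[lebesgue_measure]_(x in A) (weibull2_pdf x)%:E)%E.

End weibull.

Definition iid_weibull2 {d : measure_display} {T : measurableType d}
    {R : realType} (P : probability T R) (I : finType)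
    (X : I -> {RV P >-> R}) : Prop :=
  mutually_independent X /\
  forall (i : I) (A : set R), measurable A ->
    distribution P (X i) A = weibull2_prob A.

(* Pointwise convergence of the distribution functions at the continuity points
   of the limit; the random variables may live on different spaces. *)
Definition cvg_in_distribution {R : realType} (d : nat -> measure_display)
    (T : forall n, measurableType (d n)) (P : forall n, probability (T n) R)
    (X : forall n, {RV (P n) >-> R})
    (mu : probability (measurableTypeR R) R) : Prop :=
  forall t : R, mu [set t] = 0%E ->
    cdf (X n) t @[n --> \oo] --> mu [set` `]-oo, t]].

(* Main.v *)
Require Import Defs.
From mathcomp Require Import all_boot all_order all_algebra fingroup perm.
From mathcomp Require Import all_classical all_reals all_analysis.
From mathcomp Require Import measurable_realfun.
From mathcomp Require Import ring lra.
Set Implicit Arguments.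
Unset Strict Implicit.
Unset Printing Implicit Defensive.

Import Order.TTheory GRing.Theory Num.Theory.
Import numFieldNormedType.Exports.

Local Open Scope classical_set_scope.
Local Open Scope ring_scope.

(** The squares of Weibull(2) costs are standard exponential variables, and
    squaring does not change the order of the costs, hence not the matching.
    Run the greedy algorithm on the squared costs.  When k edges have been
    chosen, the (n-k)^2 edges of the remaining complete bipartite graph are, by
    the lack of memory, again independent exponentials above the level reached,
    so the level rises by an exponential variable of rate (n-k)^2 independent of
    the past.  Hence there are i.i.d. standard exponentials eps_0, ...,
    eps_(n-1) such that almost surely ([exponential_increments])

      C = \sum_k sqrt(S_k),   S_k = \sum_(l <= k) eps_l / (n-l)^2.

    Independence is obtained without conditional laws: [diagonal_greedy_law]
    computes the probability of each product event on which the algorithm picks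
    the diagonal edges in order, and a sum over pairs of permutations covers all
    the orders in which the vertices can be matched.

    Next, linearize each square root at the mean a_k of S_k.  With j = n-l this
    gives C = m + L + E with L = \sum_l beta_l (eps_l - 1) and

      beta_l = j^-2 \sum_(1 <= i <= j) 1 / (2 sqrt(a_(n-i))),   a_(n-i) ~ 1/i,

    so that beta_l is close to 1/(3 sqrt j).  The remainder of the k-th square
    root has quadratic mean of order Var(S_k) / a_k^(3/2), that is
    (n-k)^(-3/2) away from the ends, which is summable: E is bounded in L2
    uniformly in n ([cost_decomposition]).  On the other hand
    Var(L) = \sum_l beta_l^2 = (1/9) H_n + O(1) ([sum_sensitivity_sqr]), and a
    perturbation bounded in L2 changes the standard deviation by a bounded
    amount ([variance_perturbation]); so Var(C) ~ (1/9) log n.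

    For the central limit theorem, L divided by its standard deviation sigma is
    a normalized linear statistic with coefficients at most 2/sigma.  A standard
    exponential variable satisfies E (eps - 1) h(eps) = E eps h'(eps)
    ([expo_integration_by_parts]).  Applied to the solution of Stein's equation
    this bounds the distance of L/sigma to the standard normal law, for every
    continuous test function with values in [0,1], by twice the square root of
    the sum of the fourth powers of the coefficients ([stein_bound]).
    Piecewise linear ramps then carry the estimate from L/sigma to the
    standardized cost and to its distribution function
    ([normal_approximation]). *)

(** * Integrating out one of several independent variables *)

Section subfamily.
Context {d : measure_display} {T : measurableType d} {R : realType}.
Context {P : probability T R} {I : finType} (X : I -> {RV P >-> R}).

Definition cylinders (J : {set I}) : set (set T) :=
  [set A | exists2 B : I -> set R, (forall i, measurable (B i)) &
    A = \bigcap_(i in [set` J]) X i @^-1` B i].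

(** The same points as T, with the sigma-algebra generated by the X i, i in J:
    measurability in the variables of index in J becomes measurability of a
    function on this space. *)
Definition generated_by (J : {set I}) : measurableType (cylinders J).-sigma :=
  g_sigma_algebraType (cylinders J).

Lemma cylinders_setI_closed J : setI_closed (cylinders J).
Proof.
move=> _ _ [B mB ->] [C mC ->]; exists (fun i => B i `&` C i).
  by move=> i; exact: measurableI.
by rewrite -bigcapI; apply: eq_bigcapr => i _; rewrite preimage_setI.
Qed.

Lemma generated_by_measurable J (A : set T) :
  measurable (A : set (generated_by J)) -> measurable A.
Proof.
apply: smallest_sub; first by split; [exact: measurable0 |
  move=> B; rewrite setTD; exact: measurableC|
  move=> F mF; exact: bigcupT_measurable].
move=> _ [B mB ->]; apply: fin_bigcap_measurable.
  exact: finite_finset.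
by move=> i _; rewrite -[X in measurable X]setTI; exact: measurable_funP.
Qed.

Lemma measurable_to_generated_by J :
  measurable_fun [set: T] (id : T -> generated_by J).
Proof. by move=> _ A mA; rewrite setTI; exact: generated_by_measurable mA. Qed.

Lemma measurable_member (J : {set I}) i : i \in J ->
  measurable_fun [set: generated_by J] (X i : generated_by J -> R).
Proof.
move=> iJ _ A mA; rewrite setTI; apply: sub_sigma_algebra.
exists (fun j => if j == i then A else setT).
  by move=> j; case: eqP.
apply/seteqP; split => x /=.
  by move=> Ax j _ /=; case: eqP => [->|].
by move=> /(_ i iJ) /=; rewrite eqxx.
Qed.

Lemma measurable_from_generated_by d' (U : measurableType d') J
    (f : generated_by J -> U) :
  measurable_fun [set: generated_by J] f -> measurable_fun [set: T] f.
Proof.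
move=> mf _ A mA; have := mf measurableT A mA.
by rewrite !setTI; exact: generated_by_measurable.
Qed.

Hypothesis indX : mutually_independent X.

(** Both sides are finite measures in A that agree on the cylinders over J, a
    pi-system generating the sigma-algebra. *)
Lemma indep_generated_by (J : {set I}) i (A : set T) (B : set R) :
  i \notin J -> measurable (A : set (generated_by J)) -> measurable B ->
  (P (A `&` X i @^-1` B) = P A * P (X i @^-1` B))%E.
Proof.
move=> iJ mA mB.
have mXB : measurable (X i @^-1` B).
  by rewrite -[X in measurable X]setTI; exact: measurable_funP.
pose q := fine (P (X i @^-1` B)).
have q0 : 0 <= q by exact: fine_ge0.
have qE : P (X i @^-1` B) = q%:E by rewrite fineK// fin_num_measure.
rewrite qE muleC.
suff : mrestr P mXB A = mscale (NngNum q0) P A by [].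
apply: (g_sigma_algebra_measure_unique (cylinders J) _ (fun=> setT)) => //.
- by move=> C CJ; apply: (@generated_by_measurable J); exact: sub_sigma_algebra.
- move=> _; exists (fun=> setT) => //.
  by apply/seteqP; split => x //= _ j _.
- by rewrite bigcup_const.
- exact: cylinders_setI_closed.
- move=> _ [C mC ->]; rewrite /mrestr/= /mscale /= -qE.
  pose C' j := if j == i then B else C j.
  have mC' j : measurable (C' j) by rewrite /C'; case: eqP.
  have C'i : C' i = B by rewrite /C' eqxx.
  have := indX (i |: J)%SET mC'.
  rewrite big_setU1//= C'i (eq_bigr (fun j => P (X j @^-1` C j))); last first.
    by move=> j jJ; rewrite /C'; case: eqP => // ji; rewrite -ji jJ in iJ.
  rewrite -(indX J mC) => <-; congr (P _).
  apply/seteqP; split => x /=.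
    move=> [CJ Bx] j /=; rewrite in_setU1 /C'; case: eqP => [->//|_ /= jJ].
    exact: CJ.
  move=> CJ; split => [j jJ|].
    have /= := CJ j; rewrite in_setU1 jJ orbT => /(_ erefl).
    by rewrite /C'; case: eqP => // ji; rewrite -ji jJ in iJ.
  by have /= := CJ i; rewrite setU11 C'i => /(_ erefl).
- by move=> k; rewrite /= /mrestr/= setTI qE ltry.
Qed.

Section freeze.
Variables (J : {set I}) (i : I).
Hypothesis iJ : i \notin J.

Let pairX (x : T) : generated_by J * R := (x, X i x).

Let mpairX : measurable_fun [set: T] pairX.
Proof.
by apply: measurable_fun_pair; [exact: measurable_to_generated_by|].
Qed.

Let idT : {mfun T >-> generated_by J} :=
  mfun_Sub (mem_set (@measurable_to_generated_by J)).

Let pairE (A : set (generated_by J * R)) : measurable A ->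
  (distribution P idT \x distribution P (X i))%E A = pushforward P pairX A.
Proof.
apply: (@product_measure_unique _ _ _ _ _ (distribution P idT)
  (distribution P (X i)) (pushforward P pairX)) => B C mB mC.
rewrite /= /distribution /pushforward.
rewrite -(indep_generated_by iJ mB mC); congr (P _).
Qed.

(** Fubini: by independence, the law of the pair formed by the point seen
    through the variables of J and by X i is a product measure.  This stands
    for conditioning on the variables of index in J. *)
Lemma ge0_integral_freeze (F : generated_by J * R -> \bar R) :
  measurable_fun [set: generated_by J * R] F -> (forall z, 0 <= F z)%E ->
  (\int[P]_x F (x, X i x) =
   \int[P]_x \int[distribution P (X i)]_z F (x, z))%E.
Proof.
move=> mF F0.
transitivity (\int[pushforward P pairX]_y F y)%E.
  by rewrite ge0_integral_pushforward.
transitivity (\int[distribution P idT \x distribution P (X i)]_y F y)%E.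
  by apply: eq_measure_integral => A mA _; exact/esym/pairE.
rewrite fubini_tonelli1// ge0_integral_pushforward//.
- exact: measurable_fun_fubini_tonelli_F.
- by move=> x _; exact: integral_ge0.
Qed.

Lemma integral_freeze (F : generated_by J * R -> \bar R) :
  measurable_fun [set: generated_by J * R] F ->
  P.-integrable [set: T] (fun x => F (x, X i x)) ->
  (\int[P]_x F (x, X i x) =
   \int[P]_x \int[distribution P (X i)]_z F (x, z))%E.
Proof.
move=> mF iF.
have iF' : (distribution P idT \x distribution P (X i))%E.-integrable setT F.
  apply/integrableP; split => //.
  have -> : (\int[distribution P idT \x distribution P (X i)]_y `|F y| =
             \int[pushforward P pairX]_y `|F y|)%E.
    by apply: eq_measure_integral => A mA _; exact: pairE.
  rewrite ge0_integral_pushforward//; last exact: measurableT_comp.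
  by have /integrableP[] := iF.
transitivity (\int[pushforward P pairX]_y F y)%E.
  by rewrite integral_pushforward.
transitivity (\int[distribution P idT \x distribution P (X i)]_y F y)%E.
  by apply: eq_measure_integral => A mA _; exact/esym/pairE.
rewrite -integral12_prod_meas1// integral_pushforward//.
- by have /integrableP[] := integrable_fubini_F iF'.
- have := integrable_fubini_F iF' => /integrableP[mG].
  rewrite ge0_integral_pushforward//; last exact: measurableT_comp.
  move=> h; apply/integrableP; split => //.
  exact: (measurable_from_generated_by mG).
Qed.

End freeze.
End subfamily.

(** * The standard exponential law *)

Section density.
Context {d : measure_display} {T : measurableType d} {R : realType}.
Import HBNNSimple.

Lemma ge0_integral_density (mu nu : {measure set T -> \bar R}) (g : T -> R)
    (f : T -> \bar R) :
  measurable_fun [set: T] g -> (forall x, 0 <= g x) ->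
  (forall A, measurable A -> nu A = \int[mu]_(x in A) (g x)%:E)%E ->
  measurable_fun [set: T] f -> (forall x, 0 <= f x)%E ->
  (\int[nu]_x f x = \int[mu]_x (f x * (g x)%:E))%E.
Proof.
move=> mg g0 nuE mf f0.
pose f_ := nnsfun_approx measurableT mf.
have mgE : measurable_fun [set: T] (EFin \o g) by exact/measurable_EFinP.
have fE x : f x = limn (fun n => (f_ n x)%:E).
  by apply/esym/cvg_lim => //; exact: cvg_nnsfun_approx.
have f_E n x : (f_ n x)%:E =
    (\sum_(k \in range (f_ n)) (k * \1_(f_ n @^-1` [set k]) x)%:E)%E.
  by rewrite fimfunE -fsumEFin.
transitivity (limn (fun n => \int[nu]_x (f_ n x)%:E))%E.
  under eq_integral do rewrite fE.
  rewrite monotone_convergence//.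
  - by move=> n; exact/measurable_EFinP.
  - by move=> n x _; rewrite lee_fin.
  - by move=> x _ a b ab; rewrite lee_fin; exact/lefP/nd_nnsfun_approx.
transitivity (limn (fun n => \int[mu]_x ((f_ n x)%:E * (g x)%:E)))%E; last first.
  rewrite -monotone_convergence//.
  - apply: eq_integral => x _; apply/cvg_lim => //.
    rewrite fE; apply: cvgeZr => //.
    rewrite -fE; exact: cvg_nnsfun_approx.
  - by move=> n; apply: emeasurable_funM => //; exact/measurable_EFinP.
  - by move=> n x _; rewrite mule_ge0// lee_fin.
  - move=> x _ a b ab; apply: lee_wpmul2r; first by rewrite lee_fin.
    by rewrite lee_fin; exact/lefP/nd_nnsfun_approx.
apply/congr_lim/funext => n.
have f_ge0 k x : k \in range (f_ n) -> 0 <= k * \1_(f_ n @^-1` [set k]) x.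
  by move=> /set_mem[y _ <-]; rewrite mulr_ge0.
transitivity (\sum_(k \in range (f_ n)) \int[nu]_x (k * \1_(f_ n @^-1` [set k]) x)%:E)%E.
  under eq_integral do rewrite f_E.
  rewrite ge0_integral_fsum//.
  - by move=> k; apply/measurable_EFinP/measurable_funM.
  - by move=> k x _; exact: nnfun_muleindic_ge0.
transitivity (\sum_(k \in range (f_ n)) \int[mu]_x ((k * \1_(f_ n @^-1` [set k]) x)%:E * (g x)%:E))%E; last first.
  rewrite -ge0_integral_fsum//.
  - apply: eq_integral => x _; rewrite f_E ge0_mule_fsuml//.
    by move=> k; exact: nnfun_muleindic_ge0.
  - by move=> k; apply/emeasurable_funM => //; apply/measurable_EFinP/measurable_funM.
  - move=> k x _; rewrite mule_ge0// ?lee_fin//; exact: nnfun_muleindic_ge0.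
apply: eq_fsbigr => k kf.
have k0 : 0 <= k by move: kf => /set_mem[y _ <-].
under eq_integral do rewrite EFinM.
under [RHS]eq_integral do rewrite EFinM -muleA.
rewrite !ge0_integralZl//.
- congr (_ * _)%E; rewrite integral_indic// setIT nuE//.
  rewrite [LHS]integral_mkcond/=; apply: eq_integral => x _.
  by rewrite patchE indicE; case: ifPn => h; rewrite ?mul1e ?mul0e.
- by apply: emeasurable_funM => //; exact/measurable_EFinP.
- by move=> x _; rewrite mule_ge0// lee_fin.
- by apply/measurable_EFinP.
Qed.

End density.

(** The open right half-lines, together with the whole line, form a pi-system
    that generates the Borel sets. *)
Lemma measure_eq_rays {R : realType} (m1 m2 : {measure set R -> \bar R}) :
  (m1 setT < +oo)%E -> m1 setT = m2 setT ->
  (forall t : R, m1 `]t, +oo[%classic = m2 `]t, +oo[%classic) ->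
  forall A : set R, measurable A -> m1 A = m2 A.
Proof.
move=> m1oo mT mray A mA.
pose G : set (set R) := [set B | B = setT \/ exists t : R, B = `]t, +oo[%classic].
apply: (measure_unique G (fun=> setT)) => //.
- transitivity ((@RGenOInfty.G R).-sigma.-measurable : set (set R)).
    exact: RGenOInfty.measurableE.
  apply/seteqP; split.
    apply: sub_smallest2r; first exact: smallest_sigma_algebra.
    by move=> _ [t ->]; right; exists t.
  apply: smallest_sub; first exact: smallest_sigma_algebra.
  move=> B [->|[t ->]]; first exact: measurableT.
  by apply: sub_sigma_algebra; exists t.
- move=> B C [->|[t ->]] [->|[s ->]]; rewrite ?setTI ?setIT.
  + by left.
  + by right; exists s.
  + by right; exists t.
  + right; exists (Num.max t s); apply/seteqP; split => x /=;
    by rewrite !in_itv/= !andbT gt_max => /andP.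
- by left.
- by rewrite bigcup_const.
- by move=> B [->//|[t ->]].
Qed.

Section exponential_law.
Context {R : realType}.

Let to_R (x : measurableTypeR R) : R := x.

Let measurable_to_R : measurable_fun [set: measurableTypeR R] to_R.
Proof. by move=> _ A mA; rewrite setTI. Qed.

Let id_R : {mfun measurableTypeR R >-> R} := mfun_Sub (mem_set measurable_to_R).

Let exponential_law (r : R) (r0 : 0 < r) : probability (measurableTypeR R) R :=
  ltac:(unshelve refine (exponential_prob r : probability _ _); exact: r0).

(** The exponential probability lives on a copy of R whose sigma-algebra is
    that of the half-open intervals; the identity transports it to the space in
    which random variables take their values. *)
Definition expo_law (r : R) (r0 : 0 < r) : probability R R :=
  distribution (exponential_law r0) id_R.

Definition expo : probability R R := expo_law ltr01.

Lemma expoE (r : R) (r0 : 0 < r) (t : R) : 0 <= t ->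
  exponential_prob r `]t, +oo[%classic = (expR (- r * t))%:E.
Proof.
move=> t0; rewrite /exponential_prob integral_itv_obnd_cbnd; last first.
  by apply/measurable_EFinP; apply: measurable_funTS; exact: measurable_exponential_pdf.
rewrite (@ge0_continuous_FTC2y _ _ (fun x => - (expR (- r * x))) _ 0)//.
- by rewrite EFinN oppeK add0e.
- by move=> x _; apply: exponential_pdf_ge0; exact: ltW.
- apply: (@continuous_subspaceW R^o _ _ [set` `[0, +oo[%R]).
    by apply: subset_itvr; rewrite bnd_simp.
  exact: within_continuous_exponential_pdf.
- rewrite -oppr0; apply: cvgN.
  rewrite (_ : (fun x => expR (- r * x)) =
               (fun z => expR (- z)) \o (fun z => r * z)); last first.
    by apply: eq_fun => x; rewrite mulNr.
  apply: (@cvg_comp _ _ _ _ _ _ (pinfty_nbhs R)); last exact: cvgr_expR.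
  exact: gt0_cvgMry.
- apply: cvgN; apply/cvg_at_right_filter.
  apply: continuous_comp; last exact: continuous_expR.
  exact: mulrl_continuous.
- move=> x; rewrite in_itv/= andbT => tx; apply: derive1_exponential_pdf.
  by rewrite in_itv/= andbT (le_lt_trans t0).
Qed.

Lemma expo_ray (t : R) : expo `]t, +oo[%classic = (expR (- Num.max t 0))%:E.
Proof.
have [t0|t0] := leP 0 t; first by rewrite [LHS](expoE ltr01)// mulN1r.
rewrite oppr0 expR0; apply/eqP; rewrite eq_le probability_le1//=.
have <- : expo `]0, +oo[%classic = 1%E.
  by rewrite [LHS](expoE ltr01)// mulr0 expR0.
apply: le_measure; rewrite ?inE//.
by move=> x /=; rewrite !in_itv/= !andbT; exact: lt_trans.
Qed.

Lemma ge0_integral_expo (f : R -> \bar R) :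
  measurable_fun [set: R] f -> (forall x, 0 <= f x)%E ->
  (\int[expo]_x f x =
   \int[lebesgue_measure]_(x in `[0%R, +oo[) (f x * (expR (- x))%:E))%E.
Proof.
move=> mf f0.
rewrite ge0_integral_distribution//.
rewrite (@ge0_integral_density _ _ _ lebesgue_measure _ (exponential_pdf 1))//.
- rewrite [RHS]integral_mkcond; apply: eq_integral => x _.
  rewrite /exponential_pdf !patchE; case: ifPn => _; last by rewrite mule0.
  by rewrite mul1r mulN1r.
- exact: measurable_exponential_pdf.
- exact: exponential_pdf_ge0.
Qed.

(** Every explicit integral against expo below comes from a primitive of
    f(x) e^(-x) of the form F(x) e^(-x). *)
Lemma expo_FTC (f F : R -> R) :
  continuous f -> (forall x, 0 <= f x) ->
  (forall x : R, is_derive x 1 (fun z : R => F z * expR (- z))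
    (f x * expR (- x))) ->
  F x * expR (- x) @[x --> +oo] --> 0 ->
  (\int[expo]_x (f x)%:E = (- F 0)%:E)%E.
Proof.
move=> cf f0 dF F0; rewrite ge0_integral_expo//; last first.
  by apply/measurable_EFinP; exact: continuous_measurable_fun.
under eq_integral do rewrite -EFinM.
have cE : continuous (fun x : R => expR (- x)).
  move=> x; apply: continuous_comp; last exact: continuous_expR.
  exact: opp_continuous.
have cfE : continuous (fun x : R => f x * expR (- x)).
  by move=> x; apply: cvgM; [exact: cf|exact: cE].
rewrite (@ge0_continuous_FTC2y _ _ (fun z => F z * expR (- z)) _ 0)//.
- by rewrite oppr0 expR0 mulr1 sub0e.
- by move=> x _; rewrite mulr_ge0// expR_ge0.
- by apply: continuous_subspaceT => x; exact: cfE.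
- apply/cvg_at_right_filter.
  have /derivable1_diffP/differentiable_continuous := @ex_derive _ _ _ _ _ _ _ (dF 0).
  exact.
- by move=> x _; rewrite derive1E; exact: derive_val.
Qed.

(** From e^x >= (1 + x/5)^5 >= (x/5)^5; the constant 6250 is 2 * 5^5. *)
Lemma expR_dominates_quartic (F : R -> R) (K : R) :
  (forall x, 0 <= x -> `|F x| <= K * (1 + x ^+ 4)) ->
  F x * expR (- x) @[x --> +oo] --> 0.
Proof.
move=> FK.
have K0 : 0 <= K.
  by have := le_trans (normr_ge0 _) (FK 0 (lexx _)); rewrite expr0n addr0 mulr1.
apply/cvgr0Pnorm_le => e e0; near=> x.
have x1 : 1 <= x by near: x; exact: nbhs_pinfty_ge.
have xe : K * 6250 / e <= x by near: x; apply: nbhs_pinfty_ge; exact: num_real.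
have x0 : 0 < x by exact: lt_le_trans x1.
rewrite normrM (ger0_norm (expR_ge0 _)) expRN ler_pdivrMr ?expR_gt0//.
apply: (le_trans (FK _ (ltW x0))).
have h : (x / 5) ^+ 5 <= expR x.
  have -> : expR x = expR (x / 5) ^+ 5.
    by rewrite -expRM_natl; congr expR; field.
  rewrite lerXn2r ?nnegrE ?expR_ge0 ?divr_ge0 ?ltW//.
  by apply: lt_le_trans (expR_ge1Dx _); rewrite ltrDr.
apply: le_trans (ler_wpM2l (ltW e0) h).
move: xe; rewrite ler_pdivrMr// => xe.
have : K * (1 + x ^+ 4) <= K * (2 * x ^+ 4).
  by rewrite ler_wpM2l// mulr_natl mulr2n lerD2r exprn_ege1.
move=> /le_trans; apply.
rewrite (_ : K * _ = (K * 6250) * (x ^+ 4 / 3125)); last by field.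
rewrite (_ : e * _ = (x * e) * (x ^+ 4 / 3125)); last by field.
apply: ler_wpM2r; last exact: xe.
by apply: divr_ge0; [apply: exprn_ge0; exact: ltW|exact: ler0n].
Unshelve. all: by end_near. Qed.

End exponential_law.
Opaque expo.

(** * Moments and integration by parts for the exponential law *)

Section exponential_calculus.
Context {R : realType}.
Notation expo := (@expo R).

Lemma derivable_continuous (f : R -> R) :
  (forall x : R, derivable f x 1) -> continuous f.
Proof. by move=> df x; apply/differentiable_continuous/derivable1_diffP. Qed.

Lemma expR_dominates_square (F : R -> R) (K : R) :
  (forall x, 0 <= x -> `|F x| <= K * (1 + x ^+ 2)) ->
  F x * expR (- x) @[x --> +oo] --> 0.
Proof.
move=> FK; have K0 : 0 <= K.
  by have := le_trans (normr_ge0 _) (FK 0 (lexx _)); rewrite expr0n addr0 mulr1.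
apply: (@expR_dominates_quartic _ _ (2 * K)) => x /FK/le_trans; apply.
rewrite (mulrC 2) -mulrA ler_wpM2l//.
by have := sqr_ge0 (x ^+ 2 - 1); have := sqr_ge0 (x ^+ 2); rewrite sqrrB -exprM; lra.
Qed.

Let affine_bound (s c : R) (x : R) : 0 <= x ->
  `|s + c * (x - 1)| <= (`|s| + `|c|) * (1 + x).
Proof.
move=> x0; apply: (le_trans (ler_normD _ _)); rewrite normrM mulrDl.
rewrite lerD ?ler_wpM2l ?ler_peMr ?lerDl//.
by apply: (le_trans (ler_normB _ _)); rewrite normr1 ger0_norm// addrC.
Qed.

(** Repeated integration by parts gives the primitive: F is minus the sum of
    the integrand and of its successive derivatives. *)
Lemma expo_affine_sqr (s c : R) :
  (\int[expo]_x ((s + c * (x - 1)) ^+ 2)%:E = (s ^+ 2 + c ^+ 2)%:E)%E.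
Proof.
pose u (x : R) := s + c * (x - 1).
pose F (x : R) := - (u x ^+ 2 + 2 * c * u x + 2 * c ^+ 2).
transitivity (- F 0)%:E; last by congr EFin; rewrite /F /u; ring.
apply: expo_FTC.
- by apply: derivable_continuous => x; exact: ex_derive.
- by move=> x; exact: sqr_ge0.
- move=> x; rewrite /F /u; apply: is_derive_eq; rewrite /GRing.scale/=; ring.
- set m := `|s| + `|c|; have m0 : 0 <= m by rewrite addr_ge0.
  apply: (@expR_dominates_square _ (10 * m ^+ 2)) => x x0.
  have um := affine_bound s c x0; rewrite -/(u x) -/m in um.
  have cm : `|c| <= m by rewrite lerDr.
  have cm' : `|c| <= m * (1 + x) by rewrite (le_trans cm)// ler_peMr// lerDl.
  rewrite normrN (le_trans (ler_normD _ _))// (le_trans (lerD (ler_normD _ _) (lexx _)))//.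
  rewrite !(normrX, normrM) !(ger0_norm (ler0n _ _)).
  have m1 : 0 <= m * (1 + x) by rewrite mulr_ge0// addr_ge0.
  have h1 : `|u x| ^+ 2 <= (m * (1 + x)) ^+ 2 by rewrite lerXn2r ?nnegrE.
  have h2 : `|c| * `|u x| <= (m * (1 + x)) ^+ 2 by rewrite expr2 ler_pM.
  have h3 : `|c| ^+ 2 <= (m * (1 + x)) ^+ 2 by rewrite lerXn2r ?nnegrE.
  have h4 : (m * (1 + x)) ^+ 2 <= m ^+ 2 * (2 * (1 + x ^+ 2)).
    by rewrite exprMn ler_wpM2l ?sqr_ge0//; have := sqr_ge0 (x - 1); rewrite sqrrB sqrrD; lra.
  lra.
Qed.

Lemma expo_affine_pow4 (s c : R) :
  (\int[expo]_x ((s + c * (x - 1)) ^+ 4)%:E =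
    (s ^+ 4 + 6 * s ^+ 2 * c ^+ 2 + 8 * s * c ^+ 3 + 9 * c ^+ 4)%:E)%E.
Proof.
pose u (x : R) := s + c * (x - 1).
pose F (x : R) := - (u x ^+ 4 + 4 * c * u x ^+ 3 + 12 * c ^+ 2 * u x ^+ 2 +
  24 * c ^+ 3 * u x + 24 * c ^+ 4).
transitivity (- F 0)%:E; last by congr EFin; rewrite /F /u; ring.
apply: expo_FTC.
- by apply: derivable_continuous => x; exact: ex_derive.
- by move=> x; rewrite exprn_even_ge0.
- move=> x; rewrite /F /u; apply: is_derive_eq; rewrite /GRing.scale/=; ring.
- set m := `|s| + `|c|; have m0 : 0 <= m by rewrite addr_ge0.
  apply: (@expR_dominates_quartic _ _ (65 * (8 * m ^+ 4))) => x x0.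
  have um := affine_bound s c x0; rewrite -/(u x) -/m in um.
  have cm : `|c| <= m by rewrite lerDr.
  have cm' : `|c| <= m * (1 + x) by rewrite (le_trans cm)// ler_peMr// lerDl.
  set M := m * (1 + x) in um cm'.
  have M0 : 0 <= M by rewrite mulr_ge0// addr_ge0.
  have pw i j : (i + j)%N = 4%N -> `|c| ^+ i * `|u x| ^+ j <= M ^+ 4.
    by move=> <-; rewrite exprD ler_pM ?exprn_ge0// lerXn2r ?nnegrE.
  have h1 := pw 0%N 4%N erefl; have h2 := pw 1%N 3%N erefl; have h3 := pw 2%N 2%N erefl.
  have h4 := pw 3%N 1%N erefl; have h5 := pw 4%N 0%N erefl.
  rewrite !expr0 ?expr1 ?mul1r ?mulr1 in h1 h2 h3 h4 h5.
  have h6 : M ^+ 4 <= 8 * m ^+ 4 * (1 + x ^+ 4).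
    rewrite /M exprMn mulrC -mulrA (mulrCA 8) mulrC ler_wpM2l ?exprn_ge0//.
    have -> : (1 + x) ^+ 4 = ((1 + x) ^+ 2) ^+ 2 by rewrite -exprM.
    have h7 : (1 + x) ^+ 2 <= 2 * (1 + x ^+ 2).
      by have := sqr_ge0 (x - 1); rewrite sqrrB sqrrD; lra.
    have h8 : ((1 + x) ^+ 2) ^+ 2 <= (2 * (1 + x ^+ 2)) ^+ 2.
      by rewrite lerXn2r ?nnegrE ?sqr_ge0// mulr_ge0// addr_ge0// sqr_ge0.
    apply: (le_trans h8); have := sqr_ge0 (x ^+ 2 - 1).
    by rewrite exprMn sqrrB sqrrD -!exprM; lra.
  rewrite normrN; do 4 rewrite (le_trans (ler_normD _ _))// -lerBrDr.
  rewrite !lerBrDr !(normrX, normrM) !(ger0_norm (ler0n _ _)).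
  have := h6; lra.
Qed.

(** The Stein identity of the exponential law: the integrand times e^(-x) is
    the derivative of -x h(x) e^(-x), which vanishes at 0 and at infinity.  As the integrand has no sign, the quadratic majorant D is added
    before and subtracted after applying the nonnegative case. *)
Lemma expo_integration_by_parts (h h' : R -> R) (B : R) :
  (forall x : R, is_derive x 1 h (h' x)) -> continuous h' ->
  (forall x, `|h x| <= B * (1 + `|x|)) -> (forall x, `|h' x| <= B) ->
  (\int[expo]_x ((x - 1) * h x - x * h' x)%:E = 0)%E.
Proof.
move=> dh ch' hB h'B.
have B0 : 0 <= B by exact: le_trans (normr_ge0 _) (h'B 0).
have ch : continuous h.
  by apply: derivable_continuous => x; exact: ex_derive.
pose f x := (x - 1) * h x - x * h' x.
(* |f x| <= B ((1 + |x|)^2 + |x|), and 2 |x| <= 1 + x^2. *)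
pose D x : R := 3 * B * (1 + x ^+ 2).
have fD x : `|f x| <= D x.
  have x2 : 2 * `|x| <= 1 + x ^+ 2.
    by rewrite -real_normK ?num_real// -subr_ge0; have := sqr_ge0 (1 - `|x|); lra.
  have ab (a b c e : R) : 0 <= a -> 0 <= b -> a <= c -> b <= e -> a * b <= c * e.
    by move=> *; exact: ler_pM.
  apply: (le_trans (ler_normB _ _)); rewrite !normrM.
  have h1 : `|x - 1| * `|h x| <= (`|x| + 1) * (B * (1 + `|x|)).
    apply: ab => //; rewrite -[X in _ <= _ + X]normr1; exact: ler_normB.
  have h2 : `|x| * `|h' x| <= `|x| * B by exact: ab.
  apply: (le_trans (lerD h1 h2)); rewrite /D.
  have -> : (`|x| + 1) * (B * (1 + `|x|)) + `|x| * B =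
            B * (1 + x ^+ 2 + 3 * `|x|) by rewrite -[x ^+ 2]real_normK ?num_real//; ring.
  rewrite (_ : 3 * B * _ = B * (3 * (1 + x ^+ 2))); last by ring.
  by apply: ler_wpM2l => //; have := sqr_ge0 x; lra.
have D0 x : 0 <= D x by exact: le_trans (fD x).
have cD : continuous D.
  by apply: derivable_continuous => x; exact: ex_derive.
have cf : continuous f.
  move=> x; apply: cvgB; apply: cvgM; [|exact: ch|exact: cvg_id|exact: ch'].
  by apply: cvgB; [exact: cvg_id|exact: cvg_cst].
have fD0 x : 0 <= f x + D x by have := fD x; rewrite ler_norml => /andP[]; lra.
pose DD x : R := - (3 * B * (x ^+ 2 + 2 * x + 3)).
have DDb x : 0 <= x -> `|DD x| <= (12 * B) * (1 + x ^+ 2).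
  move=> x0; rewrite normrN ger0_norm; last first.
    by rewrite mulr_ge0 ?mulr_ge0// !addr_ge0// ?sqr_ge0// mulr_ge0.
  rewrite (_ : 12 * B * _ = 3 * B * (4 * (1 + x ^+ 2))); last by ring.
  apply: ler_wpM2l; first by rewrite mulr_ge0.
  by have := sqr_ge0 (x - 1); have := sqr_ge0 x; rewrite sqrrB; lra.
have ID : (\int[expo]_x (D x)%:E = (9 * B)%:E)%E.
  transitivity (- DD 0)%:E; last by congr EFin; rewrite /DD; ring.
  apply: expo_FTC => //.
  - move=> x; rewrite /DD; apply: is_derive_eq; rewrite /GRing.scale/= /D; ring.
  - exact: expR_dominates_square DDb.
have IfD : (\int[expo]_x (f x + D x)%:E = (9 * B)%:E)%E.
  pose F x := - (x * h x) + DD x.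
  transitivity (- F 0)%:E; last by congr EFin; rewrite /F /DD; ring.
  apply: expo_FTC => //.
  - by move=> x; apply: cvgD; [exact: cf|exact: cD].
  - move=> x; rewrite /F /DD; apply: is_derive_eq; rewrite /GRing.scale/= /D /f; ring.
  - apply: (@expR_dominates_square _ (14 * B)) => x x0.
    apply: (le_trans (ler_normD _ _)); rewrite normrN normrM.
    have := DDb x x0; have := hB x; rewrite (ger0_norm x0) => h1 h2.
    have h3 : x * `|h x| <= x * (B * (1 + x)) by exact: ler_wpM2l.
    have h4 : x * (B * (1 + x)) <= B * (2 * (1 + x ^+ 2)).
      rewrite mulrCA ler_wpM2l//.
      by have := sqr_ge0 (x - 1); have := sqr_ge0 x; rewrite sqrrB; lra.
    by lra.
have mcont (g : R -> R) : continuous g -> measurable_fun [set: R] (EFin \o g).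
  by move=> cg; apply/measurable_EFinP; exact: continuous_measurable_fun.
have int0 (g : R -> R) r : continuous g -> (forall x, 0 <= g x) ->
    (\int[expo]_x (g x)%:E = r%:E)%E -> expo.-integrable setT (EFin \o g).
  move=> cg g0 gr; apply/integrableP; split; first exact: mcont.
  under eq_integral do rewrite /= ger0_norm//.
  by rewrite gr ltry.
have -> : (fun x => ((x - 1) * h x - x * h' x)%:E) =
          (fun x => (f x + D x)%:E - (D x)%:E)%E.
  by apply/funext => x; rewrite -EFinB addrK.
rewrite integralB_EFin//.
- by rewrite ID IfD subee.
- apply: (int0 (fun x => f x + D x) _ _ _ IfD) => //.
  by move=> x; apply: cvgD; [exact: cf|exact: cD].
- exact: int0 ID.
Qed.

End exponential_calculus.

(** * Lack of memory and exponential races *)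

Section exponential_memory.
Context {R : realType}.
Notation expo := (@expo R).

(** The lack of memory in the form used for one step of the greedy algorithm.
    If z is the cost of an edge and p the level reached, the weight
    e^(-(c-1) z) is the chance that c - 1 other exponentials exceed z.  Under
    z > p the rescaled excess c (z - p) is then again standard exponential, and
    1/c is the chance that z is the smallest of the c costs. *)
Lemma expo_shift (c p : R) (A : set R) : 0 < c -> 0 <= p -> measurable A ->
  (\int[expo]_z (\1_(`]p, +oo[%classic `&` (fun z => c * (z - p)) @^-1` A) z *
                  expR (- (c - 1) * z))%:E =
   (expR (- c * p) / c)%:E * expo A)%E.
Proof.
move=> c0 p0 mA.
pose h (z : R) := c * (z - p).
have mh : measurable_fun [set: R] h.
  by apply: measurable_funM => //; exact: measurable_funB.
have mp : measurable (`]p, +oo[%classic : set R) by [].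
have mD : measurable (`]p, +oo[%classic `&` h @^-1` A : set R).
  by apply: measurableI => //; rewrite -[X in measurable X]setTI; exact: mh.
have [expc expcE] : {e : probability R R | forall B, e B = exponential_prob c B}.
  by exists (expo_law c0).
transitivity ((c^-1)%:E * expc (`]p, +oo[%classic `&` h @^-1` A))%E.
  rewrite ge0_integral_expo; last 2 first.
  - apply/measurable_EFinP/measurable_funM => //.
    by apply: measurableT_comp => //; exact: measurable_funM.
  - by move=> x; rewrite lee_fin mulr_ge0 ?expR_ge0.
  rewrite expcE /exponential_prob -ge0_integralZl//; last 3 first.
  - by apply/measurable_EFinP; apply: measurable_funTS; exact: measurable_exponential_pdf.
  - by move=> x _; rewrite lee_fin exponential_pdf_ge0// ltW.
  - by rewrite lee_fin invr_ge0 ltW.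
  rewrite [LHS]integral_mkcond [RHS]integral_mkcond; apply: eq_integral => x _.
  rewrite !patchE indicE /exponential_pdf patchE.
  case: (boolP (x \in `[0%R, +oo[%classic)) => x0; last first.
    case: ifPn => //; rewrite !inE => -[xp _].
    move: x0; rewrite notin_setE/= in_itv/= andbT => /negP; rewrite -ltNge.
    by move: xp; rewrite /= in_itv/= andbT => /(le_lt_trans p0) x0 /(lt_trans x0); rewrite ltxx.
  rewrite -/h; case: ifPn => xD; last by rewrite mul0r mul0e.
  rewrite mul1r -!EFinM mulKf ?gt_eqF// -expRD; congr (expR _)%:E; ring.
rewrite EFinM [(_%:E * (c^-1)%:E)%E]muleC -muleA; congr (_ * _)%E.
pose nu := pushforward (mrestr expc mp) h.
have q0 : 0 <= expR (- c * p) by exact: expR_ge0.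
have -> : expc (`]p, +oo[%classic `&` h @^-1` A) = nu A.
  by rewrite /nu /pushforward /mrestr/= setIC.
have -> : ((expR (- c * p))%:E * expo A)%E = mscale (NngNum q0) expo A by [].
have nuE B : nu B = expc (h @^-1` B `&` `]p, +oo[%classic) by [].
have muE B : mscale (NngNum q0) expo B = ((expR (- c * p))%:E * expo B)%E by [].
apply: (@measure_eq_rays _ (pushforward (mrestr expc mp) h) (mscale (NngNum q0) expo)) => //.
- by rewrite [ltLHS]nuE preimage_setT setTI expcE expoE// ltry.
- rewrite [LHS]nuE preimage_setT setTI expcE expoE//.
  by rewrite [RHS]muE probability_setT mule1.
- move=> t; rewrite [LHS]nuE [RHS]muE expo_ray.
  have -> : h @^-1` `]t, +oo[ `&` `]p, +oo[%classic =
            `](p + Num.max t 0 / c), +oo[%classic.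
    apply/seteqP; split => x /=; rewrite !in_itv/= !andbT /h.
      move=> [tx px]; rewrite -ltrBrDl ltr_pdivrMr// gt_max mulrC tx.
      by rewrite mulr_gt0// subr_gt0.
    rewrite -ltrBrDl ltr_pdivrMr// gt_max mulrC => /andP[-> ].
    by rewrite pmulr_rgt0// subr_gt0.
  rewrite expcE expoE//; last by rewrite addr_ge0// divr_ge0// ?le_max ?lexx ?orbT// ltW.
  rewrite -EFinM -expRD; congr (expR _)%:E; field; by rewrite gt_eqF.
Qed.

End exponential_memory.

Section generated_by_monotone.
Context {d : measure_display} {T : measurableType d} {R : realType}.
Context {P : probability T R} {I : finType} (X : I -> {RV P >-> R}).

Lemma generated_by_mono (J J' : {set I}) (A : set T) : J \subset J' ->
  measurable (A : set (generated_by X J)) ->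
  measurable (A : set (generated_by X J')).
Proof.
move=> JJ'; apply: smallest_sub; first by split; [exact: measurable0 |
  move=> B; rewrite setTD; exact: measurableC|
  move=> F mF; exact: bigcupT_measurable].
move=> _ [B mB ->]; apply: fin_bigcap_measurable; first exact: finite_finset.
move=> i /= iJ; rewrite -[X in measurable X]setTI.
have mX := @measurable_member _ _ _ _ _ X _ i (fintype.subsetP JJ' i iJ).
exact: mX.
Qed.

Lemma measurable_generated_by_mono d' (U : measurableType d') (J J' : {set I})
    (f : T -> U) : J \subset J' ->
  measurable_fun [set: generated_by X J] f ->
  measurable_fun [set: generated_by X J'] f.
Proof.
move=> JJ' mf _ A mA; have := mf measurableT A mA.
by rewrite !setTI; exact: generated_by_mono.
Qed.

End generated_by_monotone.

Lemma measurable_natr_bool {d : measure_display} {T : measurableType d}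
    {R : realType} (b : T -> bool) : measurable_fun [set: T] b ->
  measurable_fun [set: T] (fun x => (b x)%:R : R).
Proof.
have mR : measurable_fun [set: bool] (fun c : bool => c%:R : R) by [].
by move=> mb; exact: (measurableT_comp mR mb).
Qed.

Section exponential_races.
Context {d : measure_display} {T : measurableType d} {R : realType}.
Context {P : probability T R} {I : finType} (X : I -> {RV P >-> R}).
Hypothesis indX : mutually_independent X.
Hypothesis lawX : forall i A, measurable A -> distribution P (X i) A = expo A.

Lemma integral_lawX i (f : R -> \bar R) :
  (\int[distribution P (X i)]_z f z = \int[expo]_z f z)%E.
Proof. by apply: eq_measure_integral => A mA _; exact: lawX. Qed.

(** Given variables of index in J, those of index in K exceed the level Y
    independently, each with probability e^(-max(Y,0)); the weight h may be any
    nonnegative function of the former.  Induction on K, moving one index at a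
    time from K into J. *)
Lemma integral_race (K J : {set I}) (h Y : T -> R) :
  {in J, forall i, i \notin K} ->
  measurable_fun [set: generated_by X J] h ->
  measurable_fun [set: generated_by X J] Y -> (forall x, 0 <= h x) ->
  (\int[P]_x (h x * (\prod_(f in K) (Y x < X f x)%R%:R))%:E =
   \int[P]_x (h x * expR (- #|K|%:R * Num.max (Y x) 0))%:E)%E.
Proof.
have [m] := ubnP #|K|; elim: m => // m IH in K J h *; rewrite ltnS => Km.
have [->|[f fK]] := set_0Vmem K => JK mh mY h0.
  by under eq_integral do rewrite big_set0; under [RHS]eq_integral do
    rewrite cards0 oppr0 mul0r expR0.
have fJ : f \notin J.
  by apply/negP => /JK; rewrite fK.
rewrite -(finset.setD1K fK); set K' := (K :\ f)%SET.
have fK' : f \notin K' by rewrite !inE eqxx.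
have K'm : (#|K'| < m)%N by move: Km; rewrite (cardsD1 f K) fK.
pose h' x := h x * (Y x < X f x)%R%:R.
have h'0 x : 0 <= h' x by rewrite mulr_ge0.
have Jf : J \subset (f |: J)%SET by exact: finset.subsetUr.
have mYf : measurable_fun [set: generated_by X (f |: J)%SET] Y.
  exact: measurable_generated_by_mono mY.
have mh' : measurable_fun [set: generated_by X (f |: J)%SET] h'.
  apply: measurable_funM; first exact: measurable_generated_by_mono mh.
  apply: measurable_natr_bool; apply: measurable_fun_ltr => //.
  by apply: measurable_member; rewrite setU11.
have JK' : {in (f |: J)%SET, forall i, i \notin K'}.
  move=> g; rewrite !inE => /orP[->//|/JK]; by rewrite negb_and => ->; rewrite orbT.
transitivity (\int[P]_x (h' x * \prod_(g in K') (Y x < X g x)%R%:R)%:E)%E.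
  by apply: eq_integral => x _; rewrite big_setU1//= mulrA.
rewrite (IH K' _ h' K'm JK' mh' mYf h'0).
pose F (z : generated_by X J * R) : \bar R :=
  (h z.1 * (Y z.1 < z.2)%R%:R * expR (- #|K'|%:R * Num.max (Y z.1) 0))%:E.
have mY1 : measurable_fun [set: generated_by X J * R] (fun z => Y z.1).
  exact: (measurableT_comp mY).
have mE (J' : {set I}) q : measurable_fun [set: generated_by X J'] Y ->
    measurable_fun [set: generated_by X J'] (fun x => expR (- q * Num.max (Y x) 0)).
  move=> mY'; apply: measurableT_comp => //; apply: measurable_funM => //.
  exact: measurable_maxr.
transitivity (\int[P]_x F (x, X f x))%E; first by [].
rewrite (ge0_integral_freeze indX fJ); last 2 first.
- apply/measurable_EFinP; apply: measurable_funM.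
    apply: measurable_funM; first exact: (measurableT_comp mh).
    by apply: measurable_natr_bool; exact: measurable_fun_ltr.
  exact: (measurableT_comp (mE J _ mY)).
- by move=> z; rewrite lee_fin mulr_ge0 ?expR_ge0// mulr_ge0.
apply: eq_integral => x _; rewrite integral_lawX /F/=.
under eq_integral do rewrite mulrAC EFinM.
rewrite ge0_integralZl//; last 2 first.
- apply/measurable_EFinP/measurable_natr_bool.
  exact: measurable_fun_ltr.
- by rewrite lee_fin mulr_ge0 ?expR_ge0.
have -> : (\int[expo]_z ((Y x < z)%R%:R)%:E)%E = (expR (- Num.max (Y x) 0))%:E.
  rewrite -expo_ray -[X in expo X]setIT -integral_indic//; apply: eq_integral => z _.
  by rewrite indicE mem_setE in_itv/= andbT.
rewrite -EFinM -mulrA -expRD; congr (_ * expR _)%:E.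
by rewrite cardsU1 fK' /= natrD; ring.
Qed.

End exponential_races.

(** * The law of a greedy run along the diagonal *)

Lemma measurable_forallb {d : measure_display} {T : measurableType d}
    (I : finType) (f : I -> T -> bool) :
  (forall i, measurable_fun [set: T] (f i)) ->
  measurable_fun [set: T] (fun x => [forall i, f i x]).
Proof.
move=> mf; have -> : (fun x => [forall i, f i x]) =
    fun x => all (fun i => f i x) (enum I).
  apply/funext => x; apply/forallP/allP => [fx i _|fx i]; first exact: fx.
  by rewrite fx ?mem_enum.
by elim: (enum I) => [|i s IH] /=; [exact: measurable_cst|exact: measurable_and].
Qed.

Lemma measurable_implyb {d : measure_display} {T : measurableType d}
    (b : bool) (f : T -> bool) :
  measurable_fun [set: T] f -> measurable_fun [set: T] (fun x => b ==> f x).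
Proof. by case: b => //= _; exact: measurable_cst. Qed.

Lemma measurable_inb {d d' : measure_display} {T : measurableType d}
    {U : measurableType d'} (A : set U) (f : T -> U) : measurable A ->
  measurable_fun [set: T] f -> measurable_fun [set: T] (fun x => f x \in A).
Proof.
move=> mA mf; apply: (measurable_fun_bool true).
rewrite setTI (_ : _ @^-1` _ = f @^-1` A).
  by rewrite -[X in measurable X]setTI; exact: mf.
by apply/seteqP; split => x /=; [move=> /set_mem|move=> /mem_set].
Qed.

Section greedy_order.
Context {d : measure_display} {T : measurableType d} {R : realType}.
Context {P : probability T R} {n : nat} (X : edge n -> {RV P >-> R}).

(** The cost X (k-1, k-1), and 0 for k = 0; a sum with at most one term avoids
    a partial definition. *)
Definition prev_cost (k : nat) (x : T) : R :=
  \sum_(i < n | i.+1 == k) X (i, i) x.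

Definition increment (i : 'I_n) (x : T) : R :=
  ((n - i) ^ 2)%:R * (X (i, i) x - prev_cost i x).

(** The edges that are still available when the diagonal edges
    (0,0), ..., (k-1,k-1) have been chosen. *)
Definition in_grid (k : nat) (e : edge n) : bool := (k <= minn e.1 e.2)%N.

(** The event that the greedy algorithm picks the diagonal edges in the order
    of their indices.  The condition that (i,i) costs more than its predecessor
    follows from the other one except at i = 0, where it says that the first
    cost is positive. *)
Definition diagonal_greedy (x : T) : bool :=
  [forall i : 'I_n, (prev_cost i x < X (i, i) x) &&
    [forall e : edge n, in_grid i e && (e != (i, i)) ==> (X (i, i) x < X e x)]].

Section law.
Hypothesis indX : mutually_independent X.
Hypothesis lawX : forall e A, measurable A -> distribution P (X e) A = expo A.
Variable A : 'I_n -> set R.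
Hypothesis mA : forall i, measurable (A i).

(** The first k steps go along the diagonal with increments in the A i, as far
    as can be decided from the costs outside the grid k: a chosen edge (i,i) is
    compared with those edges only that have become unavailable by step k.  The
    comparison with the edges left over is postponed, and amounts to saying
    that all of them exceed the last chosen cost, as in Q below. *)
Let B (k : nat) (x : T) : bool :=
  [forall i : 'I_n, (i < k)%N ==>
    [&& prev_cost i x < X (i, i) x, increment i x \in A i &
      [forall e : edge n, [&& in_grid i e, e != (i, i) & ~~ in_grid k e] ==>
        (X (i, i) x < X e x)]]].

Let grid k : {set edge n} := [set e | in_grid k e]%SET.

Let card_grid k : (k <= n)%N -> #|grid k| = ((n - k) ^ 2)%N.
Proof.
move=> kn; pose S := [set i : 'I_n | (k <= i)%N]%SET.
have -> : grid k = finset.setX S S.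
  by apply/setP => -[i j]; rewrite !inE /in_grid leq_min.
rewrite cardsX mulnn; congr (_ ^ 2)%N.
transitivity (\sum_(k <= i < n) 1)%N; last by rewrite sum_nat_const_nat muln1.
by rewrite big_geq_mkord -sum1_card; apply: eq_bigl => i; rewrite inE.
Qed.

Let prev_costS (i : 'I_n) x : prev_cost i.+1 x = X (i, i) x.
Proof.
rewrite /prev_cost (bigD1 i)//= big1 ?addr0// => j /andP[/eqP[ji] /eqP[]].
exact: val_inj.
Qed.

Let prev_cost0 x : prev_cost 0 x = 0.
Proof. by rewrite /prev_cost big1. Qed.

Let B_le k (i j : 'I_n) x : B k x -> (i <= j < k)%N -> X (i, i) x <= X (j, j) x.
Proof.
move=> Bk /andP[]; rewrite leq_eqVlt => /orP[/eqP/val_inj ->//|ij jk].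
have /forallP/(_ i) := Bk; rewrite (ltn_trans ij jk)/= => /and3P[_ _].
move=> /forallP/(_ (j, j)); rewrite /in_grid/= minnn -ltnNge jk (ltnW ij) andbT/=.
case: eqP => [[ji]|_ /ltW//]; by rewrite ji ltnn in ij.
Qed.

Let B_prev_ge0 k x : (k <= n)%N -> B k x -> 0 <= prev_cost k x.
Proof.
case: k => [|k] kn Bk; first by rewrite prev_cost0.
have n0 : (0 < n)%N by exact: leq_trans kn.
rewrite (prev_costS (Ordinal kn)).
apply: (@le_trans _ _ (X (Ordinal n0, Ordinal n0) x)); last first.
  by apply: (B_le Bk) => /=; rewrite ltnSn.
have /forallP/(_ (Ordinal n0)) := Bk => /= /and3P[+ _ _].
by rewrite prev_cost0 => /ltW.
Qed.

Let B_step (i : 'I_n) x : B i.+1 x && [forall e, (e \in grid i.+1) ==> (X (i, i) x < X e x)] =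
  [&& B i x, prev_cost i x < X (i, i) x, increment i x \in A i &
    [forall e, (e \in (grid i :\ (i, i))%SET) ==> (X (i, i) x < X e x)]].
Proof.
apply/andP/and4P => [[Bi Ni]|[Bi pi Ai Ni]].
  have /forallP/(_ i) := Bi; rewrite ltnSn/= => /and3P[pi Ai /forallP Gi].
  split => //.
  - apply/forallP => j; apply/implyP => ji.
    have /forallP/(_ j) := Bi; rewrite (ltn_trans ji)//= => /and3P[-> -> /forallP Gj].
    apply/forallP => e; apply/implyP => /and3P[je ej ei].
    apply: (implyP (Gj e)); rewrite je ej/=; apply: contra ei.
    by rewrite /in_grid => /ltnW.
  - apply/forallP => e; apply/implyP; rewrite !inE => /andP[ei ie].
    have [ie'|ie'] := boolP (in_grid i.+1 e).
      by apply: (implyP (forallP Ni e)); rewrite inE.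
    by apply: (implyP (Gi e)); rewrite ie ei ie'.
split.
  apply/forallP => j; apply/implyP; rewrite ltnS => ji.
  have [jE|ji'] := eqVneq j i.
    rewrite jE pi Ai/=; apply/forallP => e; apply/implyP => /and3P[ie ei _].
    by apply: (implyP (forallP Ni e)); rewrite !inE ei.
  have {}ji : (j < i)%N by rewrite ltn_neqAle ji ji'.
  have /forallP/(_ j) := Bi; rewrite ji/= => /and3P[-> -> /forallP Gj]/=.
  apply/forallP => e; apply/implyP => /and3P[je ej ei].
  have [ie|ie] := boolP (in_grid i e); last by apply: (implyP (Gj e)); rewrite je ej.
  have ji1 : X (j, j) x < X (i, i) x.
    apply: le_lt_trans pi; case: i ji {ji' Ni Ai ei ie Gj} Bi => -[//|m] mn /= ji Bi.
    rewrite (prev_costS (Ordinal (ltnW mn))).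
    by apply: (B_le Bi) => /=; rewrite -ltnS ji ltnSn.
  have [->//|ei'] := eqVneq e (i, i).
  by apply: (lt_trans ji1); apply: (implyP (forallP Ni e)); rewrite !inE ei' ie.
apply/forallP => e; apply/implyP; rewrite inE => ie.
apply: (implyP (forallP Ni e)); rewrite !inE andbC; apply/andP; split.
  by move: ie; rewrite /in_grid => /ltnW.
by apply/eqP => E; move: ie; rewrite E /in_grid/= minnn ltnn.
Qed.

Let prod_bool (K : {set edge n}) (b : edge n -> bool) :
  \prod_(e in K) (b e)%:R = ([forall e, (e \in K) ==> b e])%:R :> R.
Proof.
have [/forallP bK|] := boolP [forall e, (e \in K) ==> b e].
  by rewrite big1// => e eK; rewrite (implyP (bK e) eK).
rewrite negb_forall => /existsP[e]; rewrite negb_imply => /andP[eK /negbTE be].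
by rewrite (bigD1 e)//= be mul0r.
Qed.

Let measurable_outside k e : ~~ in_grid k e ->
  measurable_fun [set: generated_by X (~: grid k)%SET] (X e).
Proof. by move=> ek; apply: measurable_member; rewrite !inE. Qed.

Let measurable_prev_cost k j : (k <= j)%N -> (k <= n)%N ->
  measurable_fun [set: generated_by X (~: grid j)%SET] (prev_cost k).
Proof.
case: k => [|k] kj kn.
  by rewrite (_ : prev_cost 0 = cst 0)//; apply/funext => x; rewrite prev_cost0.
rewrite (_ : prev_cost _ = X (Ordinal kn, Ordinal kn)).
  by apply: measurable_outside; rewrite /in_grid/= minnn -ltnNge.
by apply/funext => x; rewrite (prev_costS (Ordinal kn)).
Qed.

Let measurable_B k : measurable_fun [set: generated_by X (~: grid k)%SET] (B k).
Proof.
apply: measurable_forallb => i.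
have [ik|ik] := ltnP i k; last by rewrite /=; exact: measurable_cst.
have mX : measurable_fun [set: generated_by X (~: grid k)%SET] (X (i, i)).
  by apply: measurable_outside; rewrite /in_grid/= minnn -ltnNge.
have mp : measurable_fun [set: generated_by X (~: grid k)%SET] (prev_cost i).
  by apply: measurable_prev_cost; exact: ltnW.
rewrite /=; apply: measurable_and; first exact: measurable_fun_ltr.
apply: measurable_and.
  by apply: measurable_inb => //; apply: measurable_funM => //; exact: measurable_funB.
apply: measurable_forallb => e.
have [ek|ek] := boolP (in_grid k e); first by rewrite !andbF; exact: measurable_cst.
by apply/measurable_implyb/measurable_fun_ltr => //; exact: measurable_outside.
Qed.

Let Q k : \bar R := (\int[P]_x
  ((B k x)%:R * \prod_(e in grid k) (prev_cost k x < X e x)%R%:R)%:E)%E.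

Let Q_race k : (k <= n)%N -> (Q k = \int[P]_x
  ((B k x)%:R * expR (- ((n - k) ^ 2)%:R * Num.max (prev_cost k x) 0))%:E)%E.
Proof.
move=> kn; rewrite -card_grid//.
apply: (@integral_race _ _ _ _ _ X indX lawX _ (~: grid k)%SET (fun x => (B k x)%:R)).
- by move=> e; rewrite inE.
- by apply: measurable_natr_bool; exact: measurable_B.
- exact: measurable_prev_cost.
- by move=> x.
Qed.

(** One step of the algorithm.  Integrating out the other edges of the grid
    leaves the weight e^(-(c-1) z) for the cost z of (i,i), with c = (n-i)^2,
    and then [expo_shift] integrates out z. *)
Let Q_step (i : 'I_n) :
  (Q i.+1 = Q i * (expo (A i) * ((((n - i) ^ 2)%:R)^-1)%:E))%E.
Proof.
pose c : R := ((n - i) ^ 2)%:R.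
have c1 : 1 <= c by rewrite ler1n expn_gt0 subn_gt0 ltn_ord.
have c0 : 0 < c by exact: lt_le_trans c1.
pose b x := [&& B i x, prev_cost i x < X (i, i) x & increment i x \in A i].
pose K := (grid i :\ (i, i))%SET.
have iK : (i, i) \in grid i by rewrite inE /in_grid/= minnn.
have cardK : #|K|%:R = c - 1.
  have := cardsD1 (i, i) (grid i); rewrite iK card_grid ?(ltnW (ltn_ord i))// => /eqP.
  by rewrite /c => /eqP ->; rewrite natrD addrC addKr.
transitivity (\int[P]_x ((b x)%:R * \prod_(e in K) (X (i, i) x < X e x)%R%:R)%:E)%E.
  apply: eq_integral => x _; rewrite !prod_bool -!natrM !mulnb; congr (nat_of_bool _)%:R%:E.
  by under eq_forallb do rewrite prev_costS; rewrite B_step /b !andbA.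
have mB' : measurable_fun [set: generated_by X (~: grid i)%SET] (B i) by exact: measurable_B.
have mp : measurable_fun [set: generated_by X (~: grid i)%SET] (prev_cost i).
  by apply: measurable_prev_cost => //; exact: ltnW.
rewrite (@integral_race _ _ _ _ _ X indX lawX K ((i, i) |: ~: grid i)%SET
  (fun x => (b x)%:R) (X (i, i))); last 4 first.
- by move=> e; rewrite !inE => /orP[->//|/negbTE ->]; rewrite andbF.
- have sub : (~: grid i)%SET \subset ((i, i) |: ~: grid i)%SET by exact: finset.subsetUr.
  have mX : measurable_fun [set: generated_by X ((i, i) |: ~: grid i)%SET] (X (i, i)).
    by apply: measurable_member; rewrite setU11.
  have mp' := measurable_generated_by_mono sub mp.
  apply: measurable_natr_bool; apply: measurable_and.
    exact: measurable_generated_by_mono mB'.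
  apply: measurable_and; first exact: measurable_fun_ltr.
  by apply: measurable_inb => //; apply: measurable_funM => //; exact: measurable_funB.
- by apply: measurable_member; rewrite setU11.
- by move=> x.
pose F (z : generated_by X (~: grid i)%SET * R) : \bar R :=
  ((B i z.1)%:R * (((prev_cost i z.1 < z.2) && (c * (z.2 - prev_cost i z.1) \in A i))%:R *
   expR (- (c - 1) * Num.max z.2 0)))%:E.
transitivity (\int[P]_x F (x, X (i, i) x))%E.
  by apply: eq_integral => x _; rewrite /F cardK /b -mulnb natrM -mulrA.
have iJ : (i, i) \notin (~: grid i)%SET by rewrite finset.in_setC iK.
have mp1 : measurable_fun [set: generated_by X (~: grid i)%SET * R]
    (fun z => prev_cost i z.1) by exact: (measurableT_comp mp).
rewrite (ge0_integral_freeze indX iJ); last 2 first.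
- apply/measurable_EFinP; apply: measurable_funM.
    by apply: measurable_natr_bool; exact: (measurableT_comp mB').
  apply: measurable_funM.
    apply/measurable_natr_bool/measurable_and; first exact: measurable_fun_ltr.
    by apply: measurable_inb => //; apply: measurable_funM => //; exact: measurable_funB.
  apply: measurableT_comp => //; apply: measurable_funM => //.
  exact: measurable_maxr.
- by move=> z; rewrite lee_fin mulr_ge0// mulr_ge0// expR_ge0.
rewrite Q_race ?(ltnW (ltn_ord i))// -ge0_integralZr//; last 2 first.
- apply/measurable_EFinP; apply: (@measurable_from_generated_by _ _ _ _ _ X _ _ (~: grid i)%SET).
  apply: measurable_funM; first exact: measurable_natr_bool.
  apply: measurableT_comp => //; apply: measurable_funM => //.
  exact: measurable_maxr.
- by rewrite mule_ge0// lee_fin invr_ge0.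
apply: eq_integral => x _; rewrite integral_lawX// /F.
have [Bx|Bx] := boolP (B i x); last first.
  by rewrite !mul0r mul0e; apply: integral0_eq => z _; rewrite mul0r.
have p0 : 0 <= prev_cost i x by apply: (B_prev_ge0 _ Bx); exact: ltnW.
rewrite [in RHS]mul1r (max_idPl p0) (muleC (expo _)) muleA -EFinM -/c.
rewrite -(expo_shift c0 p0 (mA i)); apply: eq_integral => z _.
rewrite mul1r indicE in_setI !mem_setE in_itv/= andbT.
have [pz|] := ltP (prev_cost i x) z; last by rewrite !mul0r.
by rewrite (max_idPl _)//; exact: le_trans (ltW pz).
Qed.

Let Q_closed k : (k <= n)%N ->
  (Q k = \prod_(i < n | (i < k)%N) (expo (A i) * ((((n - i) ^ 2)%:R)^-1)%:E))%E.
Proof.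
elim: k => [_|k IH kn].
  rewrite Q_race// big1//; under eq_integral.
    move=> x _; rewrite prev_cost0 maxxx mulr0 expR0 mulr1.
    rewrite (_ : B 0 x = true); last by apply/forallP.
    over.
  by rewrite -[RHS](probability_setT P) -[RHS]mul1e -integral_cst.
rewrite (Q_step (Ordinal kn)) IH ?(ltnW kn)//.
rewrite [RHS](bigD1 (Ordinal kn))//= muleC; congr (_ * _)%E.
apply: eq_bigl => i; rewrite ltnS -val_eqE/= (leq_eqVlt i).
by case: eqVneq => [->|]; rewrite ?ltnn// andbT.
Qed.

(** The increments are independent standard exponentials, independent of the
    event that the run goes along the diagonal, whose probability is the
    product of the chances 1/(n-i)^2 that (i,i) is the cheapest of the available
    edges. *)
Lemma diagonal_greedy_law :
  P [set x | diagonal_greedy x /\ forall i, A i (increment i x)] =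
  (\prod_(i < n) (expo (A i) * ((((n - i) ^ 2)%:R)^-1)%:E))%E.
Proof.
have Bn x : B n x = diagonal_greedy x && [forall i, increment i x \in A i].
  apply/forallP/andP => [h|[/forallP g /forallP a] i].
    split; apply/forallP => i; have := h i; rewrite ltn_ord/= => /and3P[pi Ai ei] //.
    rewrite pi/=; apply/forallP => e; apply/implyP => /andP[ie ee].
    apply: (implyP (forallP ei e)); rewrite ie ee /in_grid -ltnNge.
    by rewrite gtn_min ltn_ord.
  rewrite ltn_ord/= a andTb; have /andP[-> /forallP ei]/= := g i.
  by apply/forallP => e; apply/implyP => /and3P[ie ee _]; apply: (implyP (ei e)); rewrite ie.
have mBn : measurable [set x | B n x].
  have := @measurable_from_generated_by _ _ _ _ _ X _ _ _ _ (@measurable_B n).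
  by move=> /(_ measurableT [set true]); rewrite setTI; apply.
transitivity (P [set x | B n x]).
  congr (P _); apply/seteqP; split => x /=; rewrite Bn.
    by move=> [-> h]; apply/forallP => i; exact/mem_set.
  by move=> /andP[-> /forallP h]; split => // i; exact/set_mem.
transitivity (Q n).
  rewrite -[X in P X]setIT -integral_indic//; apply: eq_integral => x _.
  rewrite indicE big1 ?mulr1 => [|e]; last first.
    by rewrite inE /in_grid leqNgt gtn_min ltn_ord.
  by congr (nat_of_bool _)%:R%:E; apply/idP/idP; rewrite inE.
by rewrite Q_closed//; apply: eq_bigl => i; rewrite ltn_ord.
Qed.

End law.

Let measurable_prev_costT k : measurable_fun [set: T] (prev_cost k).
Proof.
rewrite (_ : prev_cost k = fun x =>
    \sum_(i < n) if i.+1 == k then X (i, i) x else 0).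
  by apply: measurable_sum => i; case: (i.+1 == k).
by apply/funext => x; exact: big_mkcond.
Qed.

Lemma measurable_diagonal_greedy : measurable_fun [set: T] diagonal_greedy.
Proof.
apply: measurable_forallb => i; apply: measurable_and; first exact: measurable_fun_ltr.
by apply: measurable_forallb => e; apply: measurable_implyb; exact: measurable_fun_ltr.
Qed.

Lemma measurable_increment i : measurable_fun [set: T] (increment i).
Proof. by apply: measurable_funM => //; exact: measurable_funB. Qed.

End greedy_order.

(** * The greedy matching is the unique stable one *)

Section greedy_is_stable.
Context {R : realType} {n : nat} (w : edge n -> R).

Lemma matching_costE (M : {set edge n}) (v : vertex n) (e : edge n) :
  is_matching M -> e \in M -> incident v e -> matching_cost w M v = (w e)%:E.
Proof.
move=> /forall_inP mM eM ve; rewrite /matching_cost; case: pickP => [f|/(_ e)].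
  move=> /andP[fM vf]; have := forall_inP (mM e eM) f fM.
  by have [->//|_ /=] := eqVneq e f; move=> /existsPn/(_ v); rewrite ve vf.
by rewrite eM ve.
Qed.

Lemma matching_cost_lt (M : {set edge n}) (v : vertex n) (r : R) :
  (matching_cost w M v < r%:E)%E ->
  exists2 e : edge n, e \in M & incident v e && (w e < r).
Proof.
rewrite /matching_cost; case: pickP => [e /andP[eM ve]|_]; last by rewrite ltNge leey.
by rewrite lte_fin => er; exists e => //; rewrite ve er.
Qed.

Variables s t : 'S_n.
Hypothesis greedy : forall k a b : 'I_n, (k <= a)%N -> (k <= b)%N ->
  (a, b) != (k, k) -> w (s k, t k) < w (s a, t b).

Let D : {set edge n} := [set (s k, t k) | k in 'I_n]%SET.

Let D_matching : is_matching D.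
Proof.
apply/forall_inP => _ /imsetP[k _ ->]; apply/forall_inP => _ /imsetP[l _ ->].
apply/implyP => kl; apply/existsPn => -[i|i] /=; apply/negP => /andP[/eqP <-];
  by move=> /eqP/perm_inj lk; rewrite lk eqxx in kl.
Qed.

Let memD k : (s k, t k) \in D. Proof. exact: imset_f. Qed.

Let D_stable : stable w D.
Proof.
apply/andP; split; first exact: D_matching.
apply/forallP => i; apply/forallP => j; apply/or3P.
rewrite -(permKV s i) -(permKV t j); set a := (s^-1)%g i; set b := (t^-1)%g j.
rewrite (matching_costE D_matching (memD a)) ?eqxx//=.
rewrite (matching_costE D_matching (memD b)) ?eqxx//= !lte_fin.
have [ab|ba|/val_inj ->] := ltngtP a b; last exact: Or31.
- apply: Or32; apply: greedy => //; first exact: ltnW.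
  by apply/eqP => -[ba]; rewrite ba ltnn in ab.
- apply: Or33; apply: greedy => //; first exact: ltnW.
  by apply/eqP => -[ab]; rewrite ab ltnn in ba.
Qed.

(** By induction on k, a stable matching contains the k-th greedy edge:
    otherwise one of its endpoints is matched at a lower cost, hence to a vertex
    consumed at an earlier step, which is already matched elsewhere. *)
Let stable_unique (M : {set edge n}) : stable w M -> M = D.
Proof.
move=> /andP[mM /forallP sM].
have adj e f v : e \in M -> f \in M -> incident v e -> incident v f -> e = f.
  move=> eM fM ve vf; have := forall_inP (forall_inP mM e eM) f fM.
  by have [//|_ /=] := eqVneq e f; move=> /existsPn/(_ v); rewrite ve vf.
have DM k : (s k, t k) \in M.
  have [m] := ubnP k; elim: m k => // m IH k; rewrite ltnS => km.
  have below (c : 'I_n) : (c < k)%N -> (s c, t c) \in M.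
    by move=> ck; apply: IH; exact: leq_trans km.
  have /forallP/(_ (t k))/or3P[//|/matching_cost_lt[]|/matching_cost_lt[]] := sM (s k).
  - move=> -[i j] eM /andP[/= /eqP ik]; rewrite ik in eM *.
    rewrite -(permKV t j); set b := (t^-1)%g j => lt.
    have jE : j = t b by rewrite permKV.
    rewrite jE in eM; exfalso; case: (ltngtP b k) => [bk|kb|/val_inj bk].
    + have [] := adj _ _ (inr (t b)) eM (below b bk) (eqxx _) (eqxx _).
      by move=> /perm_inj kb; rewrite kb ltnn in bk.
    + have : w (s k, t k) < w (s k, t b).
        apply: greedy => //; first exact: ltnW.
        by apply/eqP => -[bk]; rewrite bk ltnn in kb.
      by move=> /lt_trans /(_ lt); rewrite ltxx.
    + by rewrite bk ltxx in lt.
  - move=> -[i j] eM /andP[/= /eqP jk]; rewrite jk in eM *.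
    rewrite -(permKV s i); set a := (s^-1)%g i => lt.
    have iE : i = s a by rewrite permKV.
    rewrite iE in eM; exfalso; case: (ltngtP a k) => [ak|ka|/val_inj ak].
    + have [] := adj _ _ (inl (s a)) eM (below a ak) (eqxx _) (eqxx _).
      by move=> /perm_inj ka; rewrite ka ltnn in ak.
    + have : w (s k, t k) < w (s a, t k).
        apply: greedy => //; first exact: ltnW.
        by apply/eqP => -[ak]; rewrite ak ltnn in ka.
      by move=> /lt_trans /(_ lt); rewrite ltxx.
    + by rewrite ak ltxx in lt.
apply/setP => -[i j]; apply/idP/imsetP => [eM|[k _ ->]//].
exists ((s^-1)%g i) => //; rewrite permKV.
have := adj _ _ (inl i) eM (DM ((s^-1)%g i)); rewrite /= permKV => ->//; exact: eqxx.
Qed.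

Lemma greedy_total_cost :
  total_cost w (stable_matching w) = \sum_(k < n) w (s k, t k).
Proof.
have -> : stable_matching w = D.
  rewrite /stable_matching; case: pickP => [M /stable_unique//|/(_ D)].
  by rewrite D_stable.
rewrite /total_cost big_imset// => k l _ _ []; by move=> /perm_inj.
Qed.

End greedy_is_stable.

(** The cheapest available edge at a given step is unique, so two greedy
    enumerations of the vertices agree step by step. *)
Lemma greedy_order_unique {R : realType} {n : nat} (w : edge n -> R)
    (s t s' t' : 'S_n) :
  (forall k a b : 'I_n, (k <= a)%N -> (k <= b)%N -> (a, b) != (k, k) ->
    w (s k, t k) < w (s a, t b)) ->
  (forall k a b : 'I_n, (k <= a)%N -> (k <= b)%N -> (a, b) != (k, k) ->
    w (s' k, t' k) < w (s' a, t' b)) ->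
  s = s' /\ t = t'.
Proof.
move=> g g'.
suff st k : s k = s' k /\ t k = t' k by split; apply/permP => k; case: (st k).
have [m] := ubnP k; elim: m k => // m IH k; rewrite ltnS => km.
have below (c : 'I_n) : (c < k)%N -> s c = s' c /\ t c = t' c.
  by move=> ck; apply: IH; exact: leq_trans km.
have later (u u' : 'S_n) : (forall c : 'I_n, (c < k)%N -> u c = u' c) ->
    exists2 a : 'I_n, (k <= a)%N & u a = u' k.
  move=> uu; exists ((u^-1)%g (u' k)); last by rewrite permKV.
  rewrite leqNgt; apply/negP => ck; have := uu _ ck; rewrite permKV => /perm_inj.
  by move=> E; rewrite -E ltnn in ck.
have [a ka sa] := later s s' (fun c ck => (below c ck).1).
have [b kb tb] := later t t' (fun c ck => (below c ck).2).
have [a' ka' sa'] := later s' s (fun c ck => esym (below c ck).1).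
have [b' kb' tb'] := later t' t (fun c ck => esym (below c ck).2).
have [[ak bk]|ab] := eqVneq (a, b) (k, k); first by rewrite -sa -tb ak bk.
have := g _ _ _ ka kb ab; rewrite sa tb => lt.
have [[ak bk]|ab'] := eqVneq (a', b') (k, k).
  by rewrite -sa' -tb' ak bk ltxx in lt.
by have := g' _ _ _ ka' kb' ab'; rewrite sa' tb' => /(lt_trans lt); rewrite ltxx.
Qed.

(** * Squared Weibull costs are exponential *)

Section squared_weibull.
Context {d : measure_display} {T : measurableType d} {R : realType}.
Context {P : probability T R} (w : {RV P >-> R}).
Hypothesis w_law : forall A, measurable A -> distribution P w A = weibull2_prob A.

Let squared (x : T) : R := w x ^+ 2.

Let measurable_squared : measurable_fun [set: T] squared.
Proof. exact: measurable_funX. Qed.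

Definition square_RV : {RV P >-> R} := mfun_Sub (mem_set measurable_squared).

Let weibull2_ray (t : R) : 0 <= t ->
  weibull2_prob [set y : R | t < y ^+ 2] = (expR (- t))%:E.
Proof.
move=> t0; set s := Num.sqrt t; have s0 : 0 <= s by exact: sqrtr_ge0.
have sE : s ^+ 2 = t by rewrite sqr_sqrtr.
pose f (y : R) := 2 * y * expR (- y ^+ 2).
transitivity (\int[lebesgue_measure]_(y in `]s, +oo[) (f y)%:E)%E.
  rewrite /weibull2_prob [LHS]integral_mkcond [RHS]integral_mkcond.
  apply: eq_integral => y _; rewrite !patchE.
  rewrite (_ : (y \in [set z : R | t < z ^+ 2]) = (t < y ^+ 2)); last first.
    by apply/idP/idP => [/set_mem|h]//; exact: mem_set.
  rewrite mem_setE in_itv/= andbT /weibull2_pdf patchE mem_setE in_itv/= andbT -sE.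
  have [y0|y0] := leP 0 y.
    rewrite [in RHS](_ : (s < y) = (s ^+ 2 < y ^+ 2)); last by rewrite ltr_pXn2r.
    by [].
  rewrite [in RHS]ifF; first by case: ifP.
  by apply/negbTE; rewrite -leNgt; exact: le_trans (ltW y0) s0.
have df (x : R) : is_derive x 1 (fun y : R => - expR (- y ^+ 2)) (f x).
  apply: is_derive_eq; rewrite /GRing.scale/= /f; ring.
have cf : continuous f.
  move=> x; apply/differentiable_continuous/derivable1_diffP; exact: ex_derive.
rewrite integral_itv_obnd_cbnd; last first.
  by apply/measurable_EFinP/measurable_funTS; exact: continuous_measurable_fun.
rewrite (@ge0_continuous_FTC2y _ _ (fun y => - expR (- y ^+ 2)) _ 0).
- by rewrite sE EFinN oppeK add0e.
- by move=> x sx; rewrite /f !mulr_ge0 ?expR_ge0//; exact: le_trans sx.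
- exact: continuous_subspaceT.
- rewrite -oppr0; apply: cvgN.
  apply: (@cvg_comp _ _ _ (fun y : R => y ^+ 2) (fun z => expR (- z))
    _ (pinfty_nbhs R)); last exact: cvgr_expR.
  apply/cvgryPge => A; near=> y.
  have y1 : 1 <= y by near: y; exact: nbhs_pinfty_ge.
  have yA : A <= y by near: y; apply: nbhs_pinfty_ge; exact: num_real.
  by apply: (le_trans yA); rewrite expr2 ler_peMr// (le_trans ler01).
- by move=> x _; exact: ex_derive.
- apply/cvg_at_right_filter.
  have /derivable1_diffP/differentiable_continuous := @ex_derive _ _ _ _ _ _ _ (df s).
  exact.
- by move=> x _; rewrite derive1E; exact: derive_val.
Unshelve. all: by end_near. Qed.

Lemma square_RV_law (A : set R) : measurable A ->
  distribution P square_RV A = expo A.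
Proof.
apply: measure_eq_rays => [||t].
- by rewrite [ltLHS](probability_setT (distribution P square_RV)) ltry.
- transitivity (1%E : \bar R); first exact: probability_setT.
  exact/esym/probability_setT.
have [t0|t0] := leP 0 t.
  rewrite [RHS]expo_ray (max_idPl t0) -weibull2_ray//.
  have mt : measurable [set y : R | t < y ^+ 2].
    rewrite (_ : mkset _ = (fun y : R => y ^+ 2) @^-1` `]t, +oo[); last first.
      by apply/seteqP; split => y /=; rewrite in_itv/= andbT.
    rewrite -[X in measurable X]setTI.
    by apply: (_ : measurable_fun _ (fun y : R => y ^+ 2)) => //; exact: measurable_funX.
  rewrite -w_law//; congr (P _).
  by apply/seteqP; split => x /=; rewrite in_itv/= andbT.
rewrite [RHS]expo_ray (max_idPr (ltW t0)) oppr0 expR0 -(probability_setT P).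
congr (P _); apply/seteqP; split => x //= _; rewrite in_itv/= andbT.
by apply: (lt_le_trans t0); exact: sqr_ge0.
Qed.

Lemma weibull2_ge0_ae : P [set x | w x < 0] = 0%E.
Proof.
rewrite (_ : [set x | _] = w @^-1` `]-oo, 0[%classic); last first.
  by apply/seteqP; split => x /=; rewrite in_itv.
transitivity (distribution P w `]-oo, 0[%classic) => //.
rewrite w_law// /weibull2_prob; apply: integral0_eq => x /=; rewrite in_itv/= => x0.
rewrite /weibull2_pdf patchE ifF//; apply/negbTE.
by rewrite mem_setE in_itv/= andbT -ltNge.
Qed.

End squared_weibull.

(** * The stable cost as a function of i.i.d. exponentials *)

Lemma mutually_independent_reindex {d : measure_display} {T : measurableType d}
    {R : realType} {P : probability T R} (I I' : finType) (f : I -> I')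
    (X : I' -> {RV P >-> R}) : injective f ->
  mutually_independent X -> mutually_independent (fun i => X (f i)).
Proof.
move=> f_inj indX J A mA.
pose A' j := if [pick i | f i == j] is Some i then A i else setT.
have A'f i : A' (f i) = A i.
  by rewrite /A'; case: pickP => [k /eqP/f_inj ->//|/(_ i)]; rewrite eqxx.
have mA' j : measurable (A' j) by rewrite /A'; case: pickP.
have := indX (f @: J)%SET A' mA'; rewrite big_imset/=; last by move=> ? ? _ _ /f_inj.
under [X in _ = X -> _]eq_bigr do rewrite A'f; move=> <-; congr (P _).
apply/seteqP; split => x /= h j /= jJ.
  by move: jJ => /imsetP[i iJ ->]; rewrite A'f; exact: h.
by rewrite -(A'f j); apply: h => /=; exact: imset_f.
Qed.

Section exponential_increments.
Context {d : measure_display} {T : measurableType d} {R : realType}.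
Context {P : probability T R} {n : nat} (w : edge n -> {RV P >-> R}).
Hypothesis iid_w : iid_weibull2 w.

Let X (st : 'S_n * 'S_n) (e : edge n) : {RV P >-> R} :=
  square_RV (w (st.1 e.1, st.2 e.2)).

Let indX st : mutually_independent (X st).
Proof.
pose f (e : edge n) : edge n := (st.1 e.1, st.2 e.2).
apply: (@mutually_independent_reindex _ _ _ _ _ _ f (fun e => square_RV (w e))).
  by move=> [a b] [a' b'] [/perm_inj -> /perm_inj ->].
move=> J A mA; have [indw _] := iid_w.
have mA' e : measurable [set y : R | A e (y ^+ 2)].
  rewrite -[X in measurable X]setTI.
  by apply: (_ : measurable_fun setT (fun y : R => y ^+ 2)) => //; exact: measurable_funX.
exact: (indw J _ mA').
Qed.

Let lawX st e A : measurable A -> distribution P (X st e) A = expo A.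
Proof. by apply: square_RV_law => B; have [_] := iid_w; exact. Qed.

Let G (st : 'S_n * 'S_n) : set T := [set x | diagonal_greedy (X st) x].

Let mG st : measurable (G st).
Proof.
rewrite -[X in measurable X]setTI.
exact: (@measurable_diagonal_greedy _ _ _ _ _ (X st) measurableT [set true]).
Qed.

Let X_greedy st x : G st x -> forall k a b : 'I_n, (k <= a)%N -> (k <= b)%N ->
  (a, b) != (k, k) -> w (st.1 k, st.2 k) x ^+ 2 < w (st.1 a, st.2 b) x ^+ 2.
Proof.
move=> /forallP Gx k a b ka kb ab; have /andP[_ /forallP/(_ (a, b))] := Gx k.
by rewrite /in_grid/= leq_min ka kb ab.
Qed.

Let G_disjoint st st' x : G st x -> G st' x -> st = st'.
Proof.
move=> /X_greedy g /X_greedy g'; case: st st' g g' => [s t] [s' t'] /= g g'.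
by have [-> ->] := @greedy_order_unique _ _ (fun e => w e x ^+ 2) _ _ _ _ g g'.
Qed.

(** The pair of permutations st lists the vertices of both sides in the order
    in which they are matched; on G st the increments are read off the costs
    relabelled by st.  The events G st are disjoint, so that at most one term
    of the sum is nonzero. *)
Let eps (k : 'I_n) (x : T) : R := \sum_st \1_(G st) x * increment (X st) k x.

Let measurable_eps k : measurable_fun [set: T] (eps k).
Proof.
apply: measurable_sum => st; apply: measurable_funM; first exact: measurable_indic.
exact: measurable_increment.
Qed.

Let epsE st k x : G st x -> eps k x = increment (X st) k x.
Proof.
move=> Gx; rewrite /eps (bigD1 st)//= indicE mem_set// mul1r big1 ?addr0// => st' ne.
rewrite indicE memNset ?mul0r// => Gx'; move/eqP: ne; apply; exact: G_disjoint Gx' Gx.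
Qed.

Let increments : 'I_n -> {RV P >-> R} := fun k => mfun_Sub (mem_set (measurable_eps k)).

Let E : set T := [set x | exists st, G st x].

Let mE : measurable E.
Proof.
rewrite (_ : E = \bigcup_(st in [set: 'S_n * 'S_n]) G st).
  by apply: fin_bigcup_measurable => //; exact: finite_finset.
by apply/seteqP; split => x /=; [move=> [st]; exists st|move=> [st _]; exists st].
Qed.

Let P_split (S : set T) : measurable S ->
  (P (S `&` E) = \sum_st P (S `&` G st))%E.
Proof.
move=> mS.
transitivity (\int[P]_x (\sum_st (\1_(S `&` G st) x)%:E))%E.
  rewrite -[X in P X]setIT -integral_indic//; last exact: measurableI.
  apply: eq_integral => x _; rewrite sumEFin indicE; congr (_%:E).
  have [|] := boolP (x \in S `&` E).
    move=> /set_mem[Sx [st Gx]].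
    rewrite (bigD1 st)//= indicE mem_set// big1 ?addr0// => st' ne.
    rewrite indicE memNset// => -[_ Gx']; move/eqP: ne; apply; exact: G_disjoint Gx' Gx.
  move=> /negP h; rewrite big1// => st _; rewrite indicE memNset// => -[Sx Gx].
  by apply: h; apply: mem_set; split => //; exists st.
rewrite ge0_integral_sum//.
- apply: eq_bigr => st _; rewrite integral_indic ?setIT//; exact: measurableI.
- by move=> st; apply/measurable_EFinP/measurable_indic; exact: measurableI.
Qed.

(** All pairs of permutations contribute equally by symmetry, and there are
    n! * n! = \prod_i (n-i)^2 of them: this cancels the probabilities of the
    individual runs. *)
Let P_event (A : 'I_n -> set R) : (forall k, measurable (A k)) ->
  P ([set x | forall k, A k (eps k x)] `&` E) = (\prod_(k < n) expo (A k))%E.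
Proof.
move=> mA; rewrite P_split; last first.
  rewrite (_ : mkset _ = \bigcap_(k in [set: 'I_n]) eps k @^-1` A k).
    apply: fin_bigcap_measurable => [|k _]; first exact: finite_finset.
    by rewrite -[X in measurable X]setTI; exact: measurable_eps.
  by apply/seteqP; split => x /= h k; [move=> _; exact: h|exact: (h k)].
pose q : \bar R := (\prod_(k < n) (expo (A k) * ((((n - k) ^ 2)%:R)^-1)%:E))%E.
transitivity (\sum_(st : 'S_n * 'S_n) q)%E.
  apply: eq_bigr => st _.
  rewrite /q -(diagonal_greedy_law (@indX st) (@lawX st) mA); congr (P _).
  apply/seteqP; split => x /= [].
    by move=> h Gx; split => // k; rewrite -(epsE _ Gx).
  by move=> Gx h; split => // k; rewrite (epsE _ Gx).
have expo_fin B : measurable B -> expo B = (fine (expo B))%:E.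
  by move=> mB; rewrite fineK// fin_num_measure.
rewrite /q; under eq_bigr do under eq_bigr do rewrite expo_fin// -EFinM.
under [RHS]eq_bigr do rewrite expo_fin//.
rewrite !prodEFin sumEFin; congr EFin.
rewrite sumr_const card_prod !card_Sn big_split/= -mulr_natr -mulrA.
rewrite (_ : _ * _%:R = 1) ?mulr1//.
rewrite prodfV -natr_prod.
have -> : (\prod_(i < n) (n - i) ^ 2)%N = (n`! * n`!)%N.
  under eq_bigr do rewrite -mulnn; rewrite big_split/=.
  suff -> : (\prod_(i < n) (n - i))%N = n`! by [].
  rewrite (reindex_inj rev_ord_inj)/= fact_prod big_add1 big_mkord.
  by apply: eq_bigr => i _; rewrite subKn.
by rewrite mulVf// pnatr_eq0 muln_eq0 negb_or -lt0n fact_gt0.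
Qed.

Let PE : P E = 1%E.
Proof.
rewrite -[E]setTI -(_ : [set x | forall k, setT (eps k x)] = setT); last first.
  by apply/seteqP; split.
by rewrite (P_event (A := fun=> setT))// big1// => k _; exact: probability_setT.
Qed.

Let P_ae (S : set T) : measurable S -> P S = P (S `&` E).
Proof.
move=> mS; rewrite -[in LHS](setIT S) -(setUv E) setIUr measureU; first last.
- by rewrite setIACA setICr setI0.
- by apply: measurableI => //; exact: measurableC.
- exact: measurableI.
rewrite [X in (_ + X)%E](_ : _ = 0%E) ?adde0//; apply/eqP; rewrite eq_le measure_ge0 andbT.
have <- : P (~` E) = 0%E by rewrite probability_setC// PE subee.
by apply: le_measure; rewrite ?inE//; [apply: measurableI => //|]; exact: measurableC.
Qed.

Let mA_eps (A : 'I_n -> set R) (J : {set 'I_n}) : (forall k, measurable (A k)) ->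
  P (\bigcap_(k in [set` J]) eps k @^-1` A k) = (\prod_(k in J) expo (A k))%E.
Proof.
move=> mA; rewrite P_ae; last first.
  apply: fin_bigcap_measurable => [|k _]; first exact: finite_finset.
  by rewrite -[X in measurable X]setTI; exact: measurable_eps.
pose A' k := if k \in J then A k else setT.
rewrite (_ : \bigcap_(k in _) _ = [set x | forall k, A' k (eps k x)]); last first.
  apply/seteqP; split => x /= h k; first by rewrite /A'; case: ifPn => // kJ; exact: h.
  by move=> kJ; have := h k; rewrite /A' kJ.
rewrite P_event => [|k]; last by rewrite /A'; case: ifP.
rewrite [RHS]big_mkcond/=; apply: eq_bigr => k _; rewrite /A'; case: ifP => // _.
exact: probability_setT.
Qed.

Let law_eps k A : measurable A -> distribution P (increments k) A = expo A.
Proof.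
move=> mA; have := @mA_eps (fun=> A) [set k]%SET (fun=> mA).
rewrite big_set1 => <-; congr (P _); apply/seteqP; split => x /=.
  by move=> Ax j /=; rewrite inE => /eqP ->.
by move=> /(_ k); apply; rewrite /= inE.
Qed.

Let indep_eps : mutually_independent increments.
Proof.
move=> J A mA; rewrite (mA_eps J mA); apply: eq_bigr => k _.
by rewrite -(law_eps k (mA k)).
Qed.

Let cost_eps x : E x -> (forall e, 0 <= w e x) -> stable_cost w x =
  \sum_(k < n) Num.sqrt (\sum_(l < n | (l <= k)%N) eps l x / ((n - l) ^ 2)%:R).
Proof.
move=> [st Gx] w0.
rewrite /stable_cost (@greedy_total_cost _ _ (fun e => w e x) st.1 st.2); last first.
  move=> k a b ka kb ab; have := X_greedy Gx ka kb ab.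
  by rewrite ltr_pXn2r// nnegrE.
apply: eq_bigr => k _; suff -> : \sum_(l < n | (l <= k)%N) eps l x / ((n - l) ^ 2)%:R =
    X st (k, k) x by rewrite /X/= sqrtr_sqr ger0_norm.
have [m] := ubnP k; elim: m k => // m IH k; rewrite ltnS => km.
have nk : ((n - k) ^ 2)%:R != 0 :> R by rewrite pnatr_eq0 -lt0n expn_gt0 subn_gt0 ltn_ord.
rewrite (bigD1 k)//= (epsE _ Gx) /increment mulrC mulKf//.
suff -> : \sum_(l < n | (l <= k)%N && (l != k)) eps l x / ((n - l) ^ 2)%:R =
    prev_cost (X st) k x by rewrite subrK.
case: k km nk => -[|k] kn km nk.
  by rewrite /prev_cost !big1// => l; rewrite leqn0 -val_eqE => /andP[->].
have kn' : (k < n)%N by exact: ltnW.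
rewrite (eq_bigl (fun l : 'I_n => (l <= Ordinal kn')%N)); last first.
  by move=> l; rewrite -val_eqE/= -[in RHS]ltnS ltn_neqAle andbC.
by rewrite IH//= /prev_cost (big_pred1 (Ordinal kn')).
Qed.

Lemma exponential_increments : exists eps : 'I_n -> {RV P >-> R},
  [/\ mutually_independent eps,
      (forall k A, measurable A -> distribution P (eps k) A = expo A) &
      {ae P, forall x, stable_cost w x =
        \sum_(k < n) Num.sqrt (\sum_(l < n | (l <= k)%N) eps l x / ((n - l) ^ 2)%:R)}].
Proof.
exists increments; split; [exact: indep_eps|exact: law_eps|].
have mlt e : measurable [set x | w e x < 0].
  rewrite (_ : mkset _ = w e @^-1` `]-oo, 0[).
    by rewrite -[X in measurable X]setTI; exact: measurable_funP.
  by apply/seteqP; split => x /=; rewrite in_itv.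
have negE : P.-negligible (~` E).
  exists (~` E); split => //; first exact: measurableC.
  by rewrite probability_setC// PE subee.
have negw : P.-negligible (\big[setU/set0]_(e : edge n) [set x | w e x < 0]).
  apply: (big_ind (fun S => P.-negligible S)).
  - exact: negligible_set0.
  - exact: negligibleU.
  - move=> e _; exists [set x | w e x < 0]; split => //.
    by apply: weibull2_ge0_ae; have [_] := iid_w; exact.
apply: negligibleS (negligibleU negE negw) => x /=; apply: contra_notP => h.
apply: cost_eps; first by apply: contrapT => Ex; apply: h; left.
move=> e; rewrite leNgt; apply/negP => we; apply: h; right.
by rewrite (bigD1 e)//=; left.
Qed.

End exponential_increments.

(** * Linear statistics of exponential variables and quadratic means *)

Lemma probability_integral_cst {d : measure_display} {T : measurableType d}
    {R : realType} (P : probability T R) (r : R) : (\int[P]_x r%:E = r%:E)%E.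
Proof. by rewrite -[RHS]mule1 -(probability_setT P) -integral_cst. Qed.

Section linear_statistics.
Context {d : measure_display} {T : measurableType d} {R : realType}.
Context {P : probability T R} {I : finType} (X : I -> {RV P >-> R}).
Hypothesis indX : mutually_independent X.
Hypothesis lawX : forall i A, measurable A -> distribution P (X i) A = expo A.

Definition centered_sum (c : I -> R) (J : {set I}) (x : T) : R :=
  \sum_(i in J) c i * (X i x - 1).

Lemma measurable_centered_sum c (J : {set I}) :
  measurable_fun [set: generated_by X J] (centered_sum c J).
Proof.
rewrite (_ : centered_sum c J = fun x =>
    \sum_(i : I) if i \in J then c i * (X i x - 1) else 0); last first.
  by apply/funext => x; exact: big_mkcond.
apply: measurable_sum => i; case: (boolP (i \in J)) => iJ; last exact: measurable_cst.
by apply: measurable_funM => //; apply: measurable_funB => //; exact: measurable_member.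
Qed.

Lemma measurable_centered_sumT c (J : {set I}) : measurable_fun [set: T] (centered_sum c J).
Proof. exact: measurable_from_generated_by (@measurable_centered_sum c J). Qed.

Lemma centered_sumD1 c (J : {set I}) f x : f \in J ->
  centered_sum c J x = centered_sum c (J :\ f)%SET x + c f * (X f x - 1).
Proof.
by move=> fJ; rewrite /centered_sum (big_setD1 f)//= addrC.
Qed.

Let integral_centered_sumD1 c (J : {set I}) f (phi : R -> R) : f \in J ->
  continuous phi -> (forall r, 0 <= phi r) ->
  (\int[P]_x (phi (centered_sum c J x))%:E =
   \int[P]_x \int[expo]_z (phi (centered_sum c (J :\ f)%SET x + c f * (z - 1)))%:E)%E.
Proof.
move=> fJ cphi phi0.
have fJ' : f \notin (J :\ f)%SET by rewrite !inE eqxx.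
pose F (y : generated_by X (J :\ f)%SET * R) : \bar R :=
  (phi (centered_sum c (J :\ f)%SET y.1 + c f * (y.2 - 1)))%:E.
transitivity (\int[P]_x F (x, X f x))%E.
  by apply: eq_integral => x _; rewrite /F (centered_sumD1 c _ fJ).
rewrite (ge0_integral_freeze indX fJ').
- by apply: eq_integral => x _; rewrite integral_lawX.
- apply/measurable_EFinP; apply: measurableT_comp.
    exact: continuous_measurable_fun.
  apply: measurable_funD.
    exact: (measurableT_comp (@measurable_centered_sum c (J :\ f)%SET)).
  by apply: measurable_funM => //; exact: measurable_funB.
- by move=> z; rewrite lee_fin.
Qed.

Lemma centered_sum_sqr c (J : {set I}) :
  (\int[P]_x (centered_sum c J x ^+ 2)%:E = (\sum_(i in J) c i ^+ 2)%:E)%E.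
Proof.
have [m] := ubnP #|J|; elim: m => // m IH in J *; rewrite ltnS => Jm.
have [->|[f fJ]] := set_0Vmem J.
  rewrite big_set0; apply: integral0_eq => x _.
  by rewrite /centered_sum big_set0 expr0n.
have J'm : (#|(J :\ f)%SET| < m)%N by move: Jm; rewrite (cardsD1 f J) fJ.
rewrite (integral_centered_sumD1 c (phi := fun r => r ^+ 2) fJ); last 2 first.
- exact: (@exprn_continuous _ 2).
- exact: sqr_ge0.
under eq_integral do rewrite expo_affine_sqr EFinD.
rewrite ge0_integralD//; last 3 first.
- by move=> x _; rewrite lee_fin sqr_ge0.
- by apply/measurable_EFinP/measurable_funX/measurable_centered_sumT.
- by move=> x _; rewrite lee_fin sqr_ge0.
rewrite IH// probability_integral_cst (big_setD1 f fJ)/=.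
by rewrite -EFinD addrC.
Qed.

(** With V the sum of the c i ^ 2 before adding one term c (X - 1), the fourth
    moment grows by 6 V c^2 + 8 c^3 S + 9 c^4 in mean, and
    8 c^3 S <= 4 c^2 S^2 + 4 c^4 gives 10 V c^2 + 13 c^4; this is at most the
    increase of 13 V^2. *)
Lemma centered_sum_pow4 c (J : {set I}) :
  (\int[P]_x (centered_sum c J x ^+ 4)%:E <= (13 * (\sum_(i in J) c i ^+ 2) ^+ 2)%:E)%E.
Proof.
have [m] := ubnP #|J|; elim: m => // m IH in J *; rewrite ltnS => Jm.
have [->|[f fJ]] := set_0Vmem J.
  rewrite big_set0 integral0_eq => [|x _]; first by rewrite expr0n mulr0.
  by rewrite /centered_sum big_set0 expr0n.
have J'm : (#|(J :\ f)%SET| < m)%N by move: Jm; rewrite (cardsD1 f J) fJ.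
have p4 (r : R) : 0 <= r ^+ 4 by rewrite exprn_even_ge0.
rewrite (integral_centered_sumD1 c (phi := fun r => r ^+ 4) fJ)//; last first.
  exact: (@exprn_continuous _ 4).
set S := centered_sum c (J :\ f)%SET.
have mS : measurable_fun [set: T] S by exact: measurable_centered_sumT.
apply: (@le_trans _ _ (\int[P]_x ((S x ^+ 4)%:E + (10 * c f ^+ 2 * S x ^+ 2 + 13 * c f ^+ 4)%:E))%E).
  apply: ge0_le_integral => //.
  - by move=> x _; apply: integral_ge0 => z _; rewrite lee_fin.
  - under eq_fun do rewrite expo_affine_pow4.
    apply/measurable_EFinP; repeat (apply: measurable_funD || apply: measurable_funM => //
      || apply: measurable_funX => //).
  - apply: emeasurable_funD; apply/measurable_EFinP; first exact: measurable_funX.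
    by apply: measurable_funD => //; apply: measurable_funM => //; exact: measurable_funX.
  - move=> x _; rewrite expo_affine_pow4 -EFinD lee_fin.
    have := sqr_ge0 (c f * (S x - c f)).
    have -> : (c f * (S x - c f)) ^+ 2 =
      S x ^+ 2 * c f ^+ 2 - 2 * (S x * c f ^+ 3) + c f ^+ 4 by ring.
    by lra.
have q0 x : 0 <= 10 * c f ^+ 2 * S x ^+ 2 by rewrite mulr_ge0 ?sqr_ge0// mulr_ge0 ?sqr_ge0.
rewrite ge0_integralD//; last 4 first.
- by move=> x _; rewrite lee_fin.
- by apply/measurable_EFinP/measurable_funX.
- by move=> x _; rewrite lee_fin addr_ge0// mulr_ge0.
- apply/measurable_EFinP/measurable_funD => //; apply: measurable_funM => //.
  exact: measurable_funX.
under [X in (_ + X)%E]eq_integral do rewrite EFinD.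
rewrite ge0_integralD//; last 3 first.
- by move=> x _; rewrite lee_fin.
- by apply/measurable_EFinP/measurable_funM => //; exact: measurable_funX.
- by move=> x _; rewrite lee_fin mulr_ge0.
under [X in (_ + (X + _))%E]eq_integral do rewrite EFinM.
rewrite ge0_integralZl//; last 3 first.
- by apply/measurable_EFinP/measurable_funX.
- by move=> x _; rewrite lee_fin sqr_ge0.
- by rewrite lee_fin mulr_ge0 ?sqr_ge0.
rewrite centered_sum_sqr probability_integral_cst.
apply: (le_trans (leeD (IH _ J'm) (lexx _))).
rewrite (big_setD1 f fJ)/= -!(EFinM, EFinD) lee_fin.
set V := \sum_(i in _) _; set q := c f ^+ 2.
have V0 : 0 <= V by apply: sumr_ge0 => i _; exact: sqr_ge0.
have -> : c f ^+ 4 = q ^+ 2 by rewrite /q -exprM.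
have : 0 <= V * q by rewrite mulr_ge0// sqr_ge0.
by rewrite sqrrD; lra.
Qed.

End linear_statistics.

Section mean_square.
Context {d : measure_display} {T : measurableType d} {R : realType}.
Context (P : probability T R).
Implicit Types f g : T -> R.

(** The L2 norm with values in the extended reals, infinite when f is not square
    integrable, so that the triangle inequality holds for all measurable f. *)
Definition rms f : \bar R := 'N[P]_2%:E[EFin \o f]%E.

Lemma rms_ge0 f : (0 <= rms f)%E. Proof. exact: Lnorm_ge0. Qed.

Lemma rms_sqr f : (rms f * rms f = \int[P]_x (f x ^+ 2)%:E)%E.
Proof.
have n2 : (2 : R) != 0 by rewrite pnatr_eq0.
transitivity (rms f `^ 2)%E.
  have := rms_ge0 f; case: (rms f) => [a| |]//=; first rewrite lee_fin => a0.
    by rewrite -EFinM powR_mulrn.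
  by move=> _; rewrite (negbTE n2) mulyy.
rewrite poweR_Lnorm//; apply: eq_integral => x _ /=.
by rewrite powR_mulrn// real_normK ?num_real.
Qed.

Lemma rms_le f (r : R) : 0 <= r ->
  (\int[P]_x (f x ^+ 2)%:E <= (r ^+ 2)%:E)%E -> (rms f <= r%:E)%E.
Proof.
move=> r0; rewrite -rms_sqr; have := rms_ge0 f; case: (rms f) => [a| |]//.
by rewrite -EFinM !lee_fin -expr2 => a0; rewrite ler_pXn2r// nnegrE.
Qed.

Lemma rms_ge f (r : R) : 0 <= r ->
  ((r ^+ 2)%:E <= \int[P]_x (f x ^+ 2)%:E)%E -> (r%:E <= rms f)%E.
Proof.
move=> r0; rewrite -rms_sqr; have := rms_ge0 f; case: (rms f) => [a| |]//.
  by rewrite -EFinM !lee_fin -expr2 => a0; rewrite ler_pXn2r// nnegrE.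
by move=> _ _; exact: leey.
Qed.

Lemma rms_eq f (r : R) : 0 <= r ->
  (\int[P]_x (f x ^+ 2)%:E = (r ^+ 2)%:E)%E -> rms f = r%:E.
Proof. by move=> r0 fr; apply/eqP; rewrite eq_le rms_le ?rms_ge// fr. Qed.

Lemma rmsD f g : measurable_fun [set: T] f -> measurable_fun [set: T] g ->
  (rms (fun x => f x + g x)%R <= rms f + rms g)%E.
Proof. by move=> mf mg; apply: minkowski_EFin => //; rewrite ler1n. Qed.

Lemma rms_opp f : rms (fun x => - f x)%R = rms f.
Proof. exact: (oppe_Lnorm P (EFin \o f) 2%:E). Qed.

Lemma rms_cst (r : R) : rms (fun=> r) = `|r|%:E.
Proof. by apply: rms_eq => //; rewrite probability_integral_cst real_normK ?num_real. Qed.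

Lemma rms_ae f g : measurable_fun [set: T] f -> measurable_fun [set: T] g ->
  {ae P, forall x, f x = g x} -> rms f = rms g.
Proof.
move=> mf mg fg.
have E : (\int[P]_x (f x ^+ 2)%:E = \int[P]_x (g x ^+ 2)%:E)%E.
  apply: ae_eq_integral => //.
  - by apply/measurable_EFinP; exact: measurable_funX.
  - by apply/measurable_EFinP; exact: measurable_funX.
  - by apply: filterS fg => x -> _.
have := rms_sqr f; rewrite E -rms_sqr.
have := rms_ge0 f; have := rms_ge0 g; case: (rms f) => [a| |]; case: (rms g) => [b| |]//.
rewrite !lee_fin => b0 a0 /eqP; rewrite -!EFinM eqe -!expr2.
by rewrite eqrXn2// => /eqP ->.
Qed.

Lemma le_integral_rms f : measurable_fun [set: T] f ->
  (\int[P]_x `|f x|%:E <= rms f)%E.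
Proof.
move=> mf; have := @hoelder _ _ _ P f (fun=> 1) 2 2 mf.
rewrite Lnorm1 -/(rms f) -/(rms (fun=> 1)) rms_cst normr1 mule1.
have -> : (\int[P]_x `|(EFin \o (f \* (fun=> 1))%R) x|)%E = (\int[P]_x `|f x|%:E)%E.
  by apply: eq_integral => x _ /=; rewrite mulr1.
by apply => //; rewrite [RHS]splitr !div1r.
Qed.

Lemma rms_integrable f : measurable_fun [set: T] f -> (rms f < +oo)%E ->
  P.-integrable [set: T] (EFin \o f).
Proof.
move=> mf f2; apply/integrableP; split; first exact/measurable_EFinP.
exact: le_lt_trans (le_integral_rms mf) f2.
Qed.

Lemma variance_rms f :
  ('V_P[f] = rms (fun x => (f x - fine 'E_P[f])%R) * rms (fun x => (f x - fine 'E_P[f])%R))%E.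
Proof.
by rewrite rms_sqr /variance unlock [@expectation]unlock.
Qed.

Lemma expectation_ae f g : measurable_fun [set: T] f -> measurable_fun [set: T] g ->
  {ae P, forall x, f x = g x} -> ('E_P[f] = 'E_P[g])%E.
Proof.
move=> mf mg fg; rewrite unlock; apply: ae_eq_integral => //.
- exact/measurable_EFinP.
- exact/measurable_EFinP.
- by apply: filterS fg => x -> _.
Qed.

(** The centered C differs from L by the centered perturbation, whose L2 norm is
    at most twice that of the perturbation; the triangle inequality then bounds
    the difference of the standard deviations. *)
Lemma variance_perturbation (C L E : T -> R) (m s K : R) :
  measurable_fun [set: T] C -> measurable_fun [set: T] L ->
  measurable_fun [set: T] E ->
  {ae P, forall x, C x = m + L x + E x} ->
  ('E_P[L] = 0)%E -> rms L = s%:E -> (rms E <= K%:E)%E ->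
  exists s' : R, [/\ 0 <= s', ('V_P[C] = (s' ^+ 2)%:E)%E, `|s' - s| <= 2 * K &
    (rms (fun x => (C x - fine ('E_P[C])%E) - L x)%R <= (2 * K)%:E)%E].
Proof.
move=> mC mL mE CE L0 Ls EK.
have E2 : (rms E < +oo)%E by exact: le_lt_trans EK (ltry _).
have iE := rms_integrable mE E2.
have iL : P.-integrable [set: T] (EFin \o L).
  by apply: rms_integrable => //; rewrite Ls ltry.
pose e := fine ('E_P[E])%E.
have eE : ('E_P[E] = e%:E)%E by rewrite fineK// expectation_fin_num//; exact/Lfun1_integrable.
have eK : `|e| <= K.
  rewrite -lee_fin; apply: le_trans EK; apply: le_trans (le_integral_rms mE).
  rewrite -abse_EFin -eE unlock; apply: le_abse_integral => //; exact/measurable_EFinP.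
have ECE : ('E_P[C] = (m + e)%:E)%E.
  rewrite (expectation_ae mC _ CE); last first.
    by apply: measurable_funD => //; exact: measurable_funD.
  have Lf1 f : P.-integrable [set: T] (EFin \o f) -> f \in Lfun P 1 by move/Lfun1_integrable.
  have Lm : cst m \in Lfun P 1 by exact: Lfun_cst.
  rewrite (@expectationD _ _ _ P (fun x => m + L x) E)//; last 2 first.
  - apply: Lf1; apply: (@eq_integrable _ _ _ _ _ measurableT (EFin \o cst m \+ EFin \o L)%E) => //.
    by apply: integrableD => //; exact: finite_measure_integrable_cst.
  - exact: Lf1.
  by rewrite (@expectationD _ _ _ P (cst m) L)// ?expectation_cst ?L0 ?adde0 ?eE//; exact: Lf1.
pose D x := C x - fine ('E_P[C])%E - L x.
have mD : measurable_fun [set: T] D by apply: measurable_funB => //; exact: measurable_funB.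
have DK : (rms D <= (2 * K)%:E)%E.
  rewrite (@rms_ae _ (fun x => E x + - e))//; last 2 first.
  - exact: measurable_funD.
  - by apply: filterS CE => x Cx; rewrite /D Cx ECE/=; ring.
  apply: (le_trans (rmsD mE _)) => //.
  rewrite rms_cst normrN mulr_natl mulr2n EFinD; exact: leeD.
pose Y x := C x - fine ('E_P[C])%E.
have mY : measurable_fun [set: T] Y by exact: measurable_funB.
have Y1 : (rms Y <= s%:E + (2 * K)%:E)%E.
  have -> : rms Y = rms (fun x => L x + D x).
    by congr rms; apply/funext => x; rewrite /D /Y; ring.
  by apply: (le_trans (rmsD mL mD)); rewrite Ls; exact: leeD.
have Y2 : (s%:E <= rms Y + (2 * K)%:E)%E.
  rewrite -Ls.
  have -> : rms L = rms (fun x => Y x + - D x).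
    by congr rms; apply/funext => x; rewrite /D /Y; ring.
  apply: (le_trans (rmsD mY _)); first exact: measurableT_comp.
  by rewrite rms_opp; exact: leeD.
have Y0 := rms_ge0 Y.
have Yf : rms Y \is a fin_num by rewrite ge0_fin_numE// (le_lt_trans Y1)// ltry.
exists (fine (rms Y)); split => //.
- exact: fine_ge0.
- by rewrite variance_rms -/Y expr2 EFinM fineK.
- move: Y1 Y2; rewrite -(fineK Yf) !lee_fin /= => Y1 Y2.
  by rewrite ler_norml; apply/andP; split; lra.
Qed.

End mean_square.

Section rms_sum.
Context {d : measure_display} {T : measurableType d} {R : realType}.
Context (P : probability T R).

Lemma rms_sum (I : Type) (s : seq I) (f : I -> T -> R) :
  (forall i, measurable_fun [set: T] (f i)) ->
  (rms P (fun x => \sum_(i <- s) f i x)%R <= \sum_(i <- s) rms P (f i))%E.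
Proof.
move=> mf; elim: s => [|i s IH].
  rewrite big_nil (_ : (fun x => _) = fun=> 0); last by apply/funext => x; rewrite big_nil.
  by rewrite rms_cst normr0.
rewrite (_ : (fun x => _) = fun x => f i x + \sum_(j <- s) f j x); last first.
  by apply/funext => x; rewrite big_cons.
rewrite big_cons; apply: (le_trans (rmsD P (mf i) _)); first exact: measurable_sum.
exact: leeD.
Qed.

End rms_sum.

Lemma rms_scale_le {d : measure_display} {T : measurableType d} {R : realType}
    (P : probability T R) (f : T -> R) (r K : R) :
  measurable_fun [set: T] f -> 0 <= K -> (rms P f <= K%:E)%E ->
  (rms P (fun x => r * f x)%R <= (`|r| * K)%:E)%E.
Proof.
move=> mf K0 fK; apply: rms_le; first exact: mulr_ge0.
under eq_integral do rewrite exprMn EFinM.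
rewrite ge0_integralZl//; last 3 first.
- by apply/measurable_EFinP; exact: measurable_funX.
- by move=> x _; rewrite lee_fin sqr_ge0.
- by rewrite lee_fin sqr_ge0.
rewrite -rms_sqr exprMn real_normK ?num_real// [leRHS]EFinM; apply: lee_wpmul2l.
  by rewrite lee_fin sqr_ge0.
by rewrite expr2 EFinM lee_pmul ?rms_ge0.
Qed.

(** * Asymptotics of the coefficients *)

Lemma sum_rev_ord {R : realType} (n : nat) (F : nat -> R) :
  \sum_(l < n) F (n - l)%N = \sum_(1 <= j < n.+1) F j.
Proof.
rewrite (reindex_inj rev_ord_inj)/= big_add1 big_mkord.
by apply: eq_bigr => i _; rewrite subKn.
Qed.

Section harmonic_sums.
Context {R : realType}.

(** Comparison of a sum with a telescoping one; it replaces the comparison with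
    an integral, g being the primitive. *)
Lemma sum_le_telescope (f g : nat -> R) (m n : nat) : (m <= n)%N ->
  (forall k, (m <= k < n)%N -> f k <= g k.+1 - g k) ->
  \sum_(m <= k < n) f k <= g n - g m.
Proof.
by move=> mn fg; rewrite -telescope_sumr// big_nat_cond [leRHS]big_nat_cond;
  apply: ler_sum => k; rewrite andbT => /fg.
Qed.

Lemma sum_ge_telescope (f g : nat -> R) (m n : nat) : (m <= n)%N ->
  (forall k, (m <= k < n)%N -> g k.+1 - g k <= f k) ->
  g n - g m <= \sum_(m <= k < n) f k.
Proof.
by move=> mn fg; rewrite -telescope_sumr// big_nat_cond [leRHS]big_nat_cond;
  apply: ler_sum => k; rewrite andbT => /fg.
Qed.

(** The mean of S_(n-i), the squared cost of the edge chosen when i edges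
    remain to be chosen. *)
Definition tail_sqr (n i : nat) : R := \sum_(i <= m < n.+1) (m%:R ^+ 2)^-1.

(** The derivative of \sum_k sqrt(S_k), taken at the means, with respect to
    the exponential variable eps_(n-j): that variable enters S_k with weight
    j^-2 for the steps with i <= j edges left. *)
Definition sensitivity (n j : nat) : R :=
  (j%:R ^+ 2)^-1 * \sum_(1 <= i < j.+1) (2 * Num.sqrt (tail_sqr n i))^-1.

Let natr_gt0 (k : nat) : (0 < k)%N -> 0 < k%:R :> R. Proof. by rewrite ltr0n. Qed.

(** From 1/m^2 >= 1/m - 1/(m+1). *)
Lemma tail_sqr_ge n i : (0 < i)%N -> (i <= n)%N ->
  i%:R^-1 - n.+1%:R^-1 <= tail_sqr n i.
Proof.
move=> i0 ni; rewrite addrC -[i%:R^-1]opprK.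
apply: (sum_ge_telescope (g := fun k => - k%:R^-1)); first exact: leqW.
move=> k /andP[ik _]; have k0 : 0 < k%:R :> R by apply: natr_gt0; exact: leq_trans ik.
have k1 : 0 < k%:R + 1 :> R by rewrite addr_gt0.
rewrite -natr1 opprK -subr_ge0.
have -> : (k%:R ^+ 2)^-1 - (- (k%:R + 1)^-1 + k%:R^-1) = (k%:R ^+ 2 * (k%:R + 1))^-1 :> R.
  by field; rewrite !gt_eqF.
by rewrite invr_ge0 mulr_ge0 ?sqr_ge0// ltW.
Qed.

(** From 1/m^2 <= 1/(m - 1/2) - 1/(m + 1/2).  The shift by 1/2 makes this bound
    sharp to second order, which gives the constant 1/3 of [sensitivity_ge]
    without an error term. *)
Lemma tail_sqr_le n i : (0 < i)%N -> (i <= n)%N ->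
  tail_sqr n i <= (i%:R - 2^-1)^-1.
Proof.
move=> i0 ni.
apply: (@le_trans _ _ (- (n.+1%:R - 2^-1)^-1 - - (i%:R - 2^-1)^-1)); last first.
  rewrite opprK gerDr oppr_le0 invr_ge0 subr_ge0.
  have : 1 <= n.+1%:R :> R by rewrite ler1n.
  lra.
apply: (sum_le_telescope (g := fun k => - (k%:R - 2^-1)^-1)); first exact: leqW.
move=> k /andP[ik _]; have k0 : 1 <= k%:R :> R by rewrite ler1n; exact: leq_trans ik.
rewrite -natr1 opprK.
have a0 : 0 < k%:R - 2^-1 :> R by lra.
have b0 : 0 < k%:R + 1 - 2^-1 :> R by lra.
rewrite addrC -subr_ge0.
have -> : (k%:R - 2^-1)^-1 - (k%:R + 1 - 2^-1)^-1 - (k%:R ^+ 2)^-1 =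
    (4 * k%:R ^+ 2 * (k%:R - 2^-1) * (k%:R + 1 - 2^-1))^-1 :> R.
  field; rewrite !gt_eqF//; lra.
by rewrite invr_ge0; apply: mulr_ge0; [apply: mulr_ge0; [apply: mulr_ge0; [lra|exact: sqr_ge0]|exact: ltW]|exact: ltW].
Qed.

Lemma tail_sqr_gt0 n i : (0 < i)%N -> (i <= n)%N -> 0 < tail_sqr n i.
Proof.
move=> i0 ni; apply: lt_le_trans (tail_sqr_ge i0 ni).
by rewrite subr_gt0 ltf_pV2 ?posrE ?ltr0n// ltr_nat ltnS.
Qed.

(** Inverting [tail_sqr_ge] gives 1/a <= i + i^2 / (n+1-i); the second term
    matters only when i is comparable with n. *)
Lemma inv_sqrt_tail_le n i : (0 < i)%N -> (i <= n)%N ->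
  (Num.sqrt (tail_sqr n i))^-1 <= Num.sqrt i%:R + i%:R / Num.sqrt (n.+1 - i)%:R.
Proof.
move=> i0 ni; have A0 := tail_sqr_gt0 i0 ni.
set j := (n.+1 - i)%N; have j0 : (0 < j)%N by rewrite subn_gt0 ltnS.
have nE : n.+1%:R = i%:R + j%:R :> R by rewrite -natrD subnKC// leqW.
have i0R := natr_gt0 i0; have j0R := natr_gt0 j0.
have s0 : 0 <= Num.sqrt i%:R + i%:R / Num.sqrt j%:R :> R.
  by rewrite addr_ge0 ?sqrtr_ge0// divr_ge0// sqrtr_ge0.
rewrite -(@ler_pXn2r _ 2)// ?nnegrE ?invr_ge0 ?sqrtr_ge0//.
rewrite exprVn sqr_sqrtr ?(ltW A0)//.
apply: (@le_trans _ _ (i%:R + i%:R ^+ 2 / j%:R)).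
  have -> : i%:R + i%:R ^+ 2 / j%:R = (i%:R^-1 - n.+1%:R^-1)^-1 :> R.
    have ij0 : 0 < i%:R + j%:R :> R by rewrite addr_gt0.
    rewrite nE (_ : _ - _ = j%:R / (i%:R * (i%:R + j%:R))); last first.
      by field; rewrite !gt_eqF.
    by rewrite invf_div; field; rewrite gt_eqF.
  rewrite lef_pV2 ?posrE//; first exact: tail_sqr_ge.
  by rewrite subr_gt0 ltf_pV2 ?posrE ?ltr0n// ltr_nat ltnS.
rewrite sqrrD exprMn exprVn (sqr_sqrtr (ltW i0R)) (sqr_sqrtr (ltW j0R)) lerD2r lerDl.
by rewrite mulrn_wge0// mulr_ge0 ?sqrtr_ge0// divr_ge0// sqrtr_ge0.
Qed.

Lemma inv_sqrt_tail_ge n i : (0 < i)%N -> (i <= n)%N ->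
  Num.sqrt (i%:R - 2^-1) <= (Num.sqrt (tail_sqr n i))^-1.
Proof.
move=> i0 ni; have A0 := tail_sqr_gt0 i0 ni.
have i1 : 1 <= i%:R :> R by rewrite ler1n.
have h0 : 0 < i%:R - 2^-1 :> R by lra.
rewrite -sqrtrV ?(ltW A0)// ler_sqrt ?invr_ge0 ?(ltW A0)//.
by rewrite -[leLHS]invrK lef_pV2 ?posrE ?invr_gt0//; exact: tail_sqr_le.
Qed.

(** The midpoint rule overestimates the integral of a concave function: here
    the integral of the square root over [0,j]. *)
Lemma sum_sqrt_mid_ge (j : nat) :
  2 / 3 * (j%:R * Num.sqrt j%:R) <= \sum_(1 <= i < j.+1) Num.sqrt (i%:R - 2^-1) :> R.
Proof.
rewrite big_add1/= -[leLHS]subr0.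
rewrite [X in _ - X <= _](_ : 0 = 2 / 3 * (0%:R * Num.sqrt 0%:R)); last first.
  by rewrite mul0r mulr0.
apply: (sum_ge_telescope (g := fun k => 2 / 3 * (k%:R * Num.sqrt k%:R))) => // k _.
rewrite -(natr1 k).
have k0 : 0 <= k%:R :> R by [].
have k1 : 0 < k%:R + 1 :> R by rewrite ltr_wpDl.
set p := Num.sqrt (k%:R + 1); set q := Num.sqrt k%:R.
have p0 : 0 < p by rewrite sqrtr_gt0.
have q0 : 0 <= q by exact: sqrtr_ge0.
have pE : p ^+ 2 = k%:R + 1 by rewrite sqr_sqrtr// ltW.
have qE : q ^+ 2 = k%:R by rewrite sqr_sqrtr.
have pq0 : 0 < p + q by rewrite ltr_wpDr.
rewrite -pE -qE.
have -> : 2 / 3 * (p ^+ 2 * p) - 2 / 3 * (q ^+ 2 * q) =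
    2 / 3 * ((p ^+ 2 + p * q + q ^+ 2) / (p + q)).
  have pq1 : (p - q) * (p + q) = 1 by rewrite -subr_sqr pE qE; ring.
  have -> : (p ^+ 2 + p * q + q ^+ 2) / (p + q) =
      (p ^+ 2 + p * q + q ^+ 2) * ((p - q) * (p + q)) / (p + q) by rewrite pq1 mulr1.
  by field; rewrite gt_eqF.
rewrite -(@ler_pXn2r _ 2)// ?nnegrE ?sqrtr_ge0//; last first.
  by rewrite mulr_ge0// divr_ge0 ?(ltW pq0)// !addr_ge0 ?sqr_ge0// mulr_ge0// ltW.
rewrite [leRHS]sqr_sqrtr; last by rewrite pE; lra.
have -> : p ^+ 2 - 2^-1 = (p ^+ 2 + q ^+ 2) / 2 by rewrite pE qE; field.
rewrite mulrA exprMn exprVn ler_pdivrMr ?exprn_gt0// -subr_ge0.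
have -> : (p ^+ 2 + q ^+ 2) / 2 * (p + q) ^+ 2 - (2 / 3 * (p ^+ 2 + p * q + q ^+ 2)) ^+ 2 =
   (p - q) ^+ 2 * (p ^+ 2 + 4 * (p * q) + q ^+ 2) / 18 by field.
by rewrite divr_ge0// mulr_ge0 ?sqr_ge0// !addr_ge0 ?sqr_ge0// !mulr_ge0// ltW.
Qed.

Lemma sum_sqrt_le (j : nat) : \sum_(1 <= i < j.+1) Num.sqrt i%:R <=
  2 / 3 * (j%:R * Num.sqrt j%:R) + Num.sqrt j%:R :> R.
Proof.
case: j => [|j]; first by rewrite big_geq// mul0r mulr0 add0r sqrtr_ge0.
rewrite big_nat_recr//= lerD2r.
rewrite (_ : 2 / 3 * _ = 2 / 3 * (j.+1%:R * Num.sqrt j.+1%:R) - 2 / 3 * (1%:R * Num.sqrt 1%:R) + 2 / 3 * (1%:R * Num.sqrt 1%:R)); last by rewrite subrK.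
rewrite -[leLHS]addr0 lerD//.
apply: (sum_le_telescope (g := fun k => 2 / 3 * (k%:R * Num.sqrt k%:R))) => // k /andP[k1 _].
rewrite -(natr1 k).
have k0 : 0 < k%:R :> R by exact: natr_gt0.
set p := Num.sqrt (k%:R + 1); set q := Num.sqrt k%:R.
have q0 : 0 < q by rewrite sqrtr_gt0.
have qp : q <= p by rewrite ler_sqrt ?ltr_wpDr ?lerDl// addr_gt0.
have pE : p ^+ 2 = k%:R + 1 by rewrite sqr_sqrtr// addr_ge0// ltW.
have qE : q ^+ 2 = k%:R by rewrite sqr_sqrtr// ltW.
have pq0 : 0 < p + q by rewrite addr_gt0// (lt_le_trans q0).
rewrite -pE -qE.
have -> : 2 / 3 * (p ^+ 2 * p) - 2 / 3 * (q ^+ 2 * q) =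
    2 / 3 * ((p ^+ 2 + p * q + q ^+ 2) / (p + q)).
  have pq1 : (p - q) * (p + q) = 1 by rewrite -subr_sqr pE qE; ring.
  have -> : (p ^+ 2 + p * q + q ^+ 2) / (p + q) =
      (p ^+ 2 + p * q + q ^+ 2) * ((p - q) * (p + q)) / (p + q) by rewrite pq1 mulr1.
  by field; rewrite gt_eqF.
rewrite mulrA ler_pdivlMr// -subr_ge0.
have -> : 2 / 3 * (p ^+ 2 + p * q + q ^+ 2) - q * (p + q) = (p - q) * (2 * p + q) / 3 by field.
by rewrite divr_ge0// mulr_ge0 ?subr_ge0// addr_ge0 ?mulr_ge0 ?ltW// (lt_le_trans q0).
Qed.

Let sqrt_step (k : nat) : exists p q : R,
  [/\ p = Num.sqrt k.+1%:R, q = Num.sqrt k%:R, 0 < p, 0 <= q & p ^+ 2 = q ^+ 2 + 1].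
Proof.
exists (Num.sqrt k.+1%:R), (Num.sqrt k%:R); split => //.
by rewrite !sqr_sqrtr// natr1.
Qed.

Let inv_sqrt_step (k : nat) :
  (Num.sqrt k.+1%:R)^-1 <= 2 * (Num.sqrt k.+1%:R - Num.sqrt k%:R) :> R.
Proof.
have [p [q [<- <- p0 q0 pq]]] := sqrt_step k.
have pq0 : 0 < p + q by rewrite ltr_wpDr.
have -> : p - q = (p + q)^-1.
  apply: (mulIf (lt0r_neq0 pq0)); rewrite -subr_sqr pq mulVf ?gt_eqF//; ring.
rewrite ler_pdivlMr// mulrC ler_pdivrMr// mulr_natl mulr2n lerD2l.
by rewrite -(@ler_pXn2r _ 2)// ?nnegrE ?(ltW p0)// pq lerDl.
Qed.

Lemma sum_inv_sqrt_le (n : nat) :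
  \sum_(1 <= j < n.+1) (Num.sqrt j%:R)^-1 <= 2 * Num.sqrt n%:R :> R.
Proof.
rewrite big_add1/= -[leRHS]subr0.
rewrite [X in _ <= _ - X](_ : 0 = 2 * Num.sqrt 0%:R); last by rewrite sqrtr0 mulr0.
apply: (sum_le_telescope (g := fun k => 2 * Num.sqrt k%:R)) => // k _.
by rewrite -mulrBr; exact: inv_sqrt_step.
Qed.

Lemma sum_inv_sqrt_tail_le (n j : nat) : (j <= n)%N -> (0 < n)%N ->
  \sum_(1 <= i < j.+1) (Num.sqrt (n.+1 - i)%:R)^-1 <= 2 * j%:R / Num.sqrt n%:R :> R.
Proof.
move=> jn n0.
apply: (@le_trans _ _ (- (2 * Num.sqrt (n.+1 - j.+1)%:R) - - (2 * Num.sqrt (n.+1 - 1)%:R))).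
  apply: (sum_le_telescope (g := fun k => - (2 * Num.sqrt (n.+1 - k)%:R))) => // k /andP[k1 kj].
  rewrite opprK addrC -mulrBr (_ : n.+1 - k = (n - k).+1)%N; last by rewrite subSn// -ltnS (leq_trans kj).
  by rewrite subSS; exact: inv_sqrt_step.
rewrite opprK addrC -mulrBr subn1/= subSS -mulrA ler_wpM2l//.
have s0 : 0 < Num.sqrt n%:R :> R by rewrite sqrtr_gt0 ltr0n.
rewrite ler_pdivlMr// mulrBl.
have -> : j%:R = n%:R - (n - j)%:R :> R by rewrite natrB// opprB addrC subrK.
have nE : n%:R = Num.sqrt n%:R ^+ 2 :> R by rewrite sqr_sqrtr.
have mE : (n - j)%:R = Num.sqrt (n - j)%:R ^+ 2 :> R by rewrite sqr_sqrtr.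
rewrite [X in _ <= X - _]nE [X in _ <= _ - X]mE !expr2 lerD2l lerN2.
by rewrite ler_wpM2l ?sqrtr_ge0// ler_sqrt ?ler_nat ?leq_subr.
Qed.

Lemma sum_inv_sqr_le (n : nat) : \sum_(1 <= j < n.+1) (j%:R ^+ 2)^-1 <= 2 :> R.
Proof.
case: n => [|n]; first by rewrite big_geq.
apply: (le_trans (tail_sqr_le (isT : 0 < 1)%N (isT : 1 <= n.+1)%N)).
by rewrite (_ : 1%:R - 2^-1 = 2^-1) ?invrK//; field.
Qed.

(** The primitive -6 / sqrt k, and not -2 / sqrt k, because the increments are
    taken to the right of k: there sqrt (k+1) <= (3/2) sqrt k. *)
Lemma sum_inv_three_halves_le (n : nat) :
  \sum_(1 <= j < n.+1) (j%:R * Num.sqrt j%:R)^-1 <= 6 :> R.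
Proof.
apply: (@le_trans _ _ (- (6 / Num.sqrt n.+1%:R) - - (6 / Num.sqrt 1%:R))).
  apply: (sum_le_telescope (g := fun k => - (6 / Num.sqrt k%:R))) => // k /andP[k1 _].
  have q1 : 1 <= Num.sqrt k%:R :> R by rewrite -[leLHS]sqrtr1 ler_sqrt// ler1n.
  have kE : k%:R = Num.sqrt k%:R ^+ 2 :> R by rewrite sqr_sqrtr.
  rewrite {1}kE; have [p [q [<- qE p0 q0 pq]]] := sqrt_step k; rewrite -qE in q1 *.
  have q00 : 0 < q by exact: lt_le_trans q1.
  have pq2 : p <= 3 / 2 * q.
    rewrite -(@ler_pXn2r _ 2)// ?nnegrE ?(ltW p0) ?mulr_ge0// pq exprMn.
    have : 1 <= q ^+ 2 by rewrite exprn_ege1.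
    lra.
  have -> : - (6 / p) - - (6 / q) = 6 / (p * q * (p + q)).
    have h : (p - q) * (p + q) = 1 by rewrite -subr_sqr pq; ring.
    have pq0 : 0 < p + q by rewrite addr_gt0.
    have -> : 6 / (p * q * (p + q)) = 6 * ((p - q) * (p + q)) / (p * q * (p + q)).
      by rewrite h mulr1.
    by field; rewrite !gt_eqF.
  rewrite -[leLHS]mul1r ler_pdivrMr ?mulr_gt0 ?exprn_gt0//.
  rewrite mulrAC ler_pdivlMr ?mulr_gt0 ?addr_gt0// mul1r.
  have h1 : p * q <= 3 / 2 * q * q by rewrite ler_wpM2r.
  have h2 : p + q <= 5 / 2 * q by lra.
  have h3 : p * q * (p + q) <= 3 / 2 * q * q * (5 / 2 * q).
    by rewrite ler_pM// ?addr_ge0 ?mulr_ge0// ltW.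
  apply: (le_trans h3); rewrite -subr_ge0.
  have -> : 6 * (q ^+ 2 * q) - 3 / 2 * q * q * (5 / 2 * q) = 9 / 4 * q ^+ 3 by field.
  by rewrite mulr_ge0// exprn_ge0.
by rewrite opprK sqrtr1 divr1 gerDr oppr_le0 divr_ge0// sqrtr_ge0.
Qed.

(** The larger of i and j may be replaced by the smaller. *)
Let cross_le (j i : nat) : (0 < j)%N -> (0 < i)%N ->
  (j%:R * Num.sqrt i%:R)^-1 <= (j%:R * Num.sqrt j%:R)^-1 + (i%:R * Num.sqrt i%:R)^-1 :> R.
Proof.
move=> j0 i0.
have j0R : 0 < j%:R :> R by exact: natr_gt0.
have i0R : 0 < i%:R :> R by exact: natr_gt0.
have sj0 : 0 < Num.sqrt j%:R :> R by rewrite sqrtr_gt0.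
have si0 : 0 < Num.sqrt i%:R :> R by rewrite sqrtr_gt0.
have [ij|ji] := leP (i%:R : R) j%:R.
  apply: (@le_trans _ _ (i%:R * Num.sqrt i%:R)^-1).
    by rewrite lef_pV2 ?posrE ?mulr_gt0// ler_wpM2r// ltW.
  by rewrite lerDr invr_ge0 mulr_ge0// ltW.
apply: (@le_trans _ _ (j%:R * Num.sqrt j%:R)^-1).
  by rewrite lef_pV2 ?posrE ?mulr_gt0// ler_wpM2l ?(ltW j0R)// ler_sqrt ?ltW.
by rewrite lerDl invr_ge0 mulr_ge0// ltW.
Qed.

(** The sum of the bounds on the second-order terms of the cost: up to a mixed
    term handled by [cross_le], the j-th one is of order j^(-3/2). *)
Lemma sum_remainder_le (n : nat) :
  \sum_(1 <= j < n.+1) (j%:R ^+ 2)^-1 / Num.sqrt (tail_sqr n j) <= 18 :> R.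
Proof.
apply: (@le_trans _ _ (\sum_(1 <= j < n.+1)
    ((j%:R * Num.sqrt j%:R)^-1 + ((j%:R * Num.sqrt j%:R)^-1 +
     ((n.+1 - j)%:R * Num.sqrt (n.+1 - j)%:R)^-1)))).
  rewrite big_nat_cond [leRHS]big_nat_cond; apply: ler_sum => j.
  rewrite andbT ltnS => /andP[j0 jn].
  have i0 : (0 < n.+1 - j)%N by rewrite subn_gt0 ltnS.
  have j0R : 0 < j%:R :> R by exact: natr_gt0.
  have sj0 : 0 < Num.sqrt j%:R :> R by rewrite sqrtr_gt0.
  have si0 : 0 < Num.sqrt (n.+1 - j)%:R :> R by rewrite sqrtr_gt0 ltr0n.
  apply: le_trans (_ : (j%:R ^+ 2)^-1 * (Num.sqrt j%:R + j%:R / Num.sqrt (n.+1 - j)%:R) <= _).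
    by rewrite ler_wpM2l ?invr_ge0 ?sqr_ge0//; exact: inv_sqrt_tail_le.
  have -> : (j%:R ^+ 2)^-1 * (Num.sqrt j%:R + j%:R / Num.sqrt (n.+1 - j)%:R) =
      (j%:R * Num.sqrt j%:R)^-1 + (j%:R * Num.sqrt (n.+1 - j)%:R)^-1 :> R.
    have jE : j%:R = Num.sqrt j%:R ^+ 2 :> R by rewrite sqr_sqrtr// ltW.
    move: sj0 jE; set q := Num.sqrt j%:R => sj0 jE.
    by rewrite jE; field; rewrite !gt_eqF.
  by rewrite lerD2l; exact: cross_le.
rewrite !big_split/= [X in _ + (_ + X)]big_nat_rev/=.
rewrite (_ : 18 = 6 + (6 + 6)); last by ring.
rewrite lerD ?sum_inv_three_halves_le// lerD ?sum_inv_three_halves_le//.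
apply: le_trans (sum_inv_three_halves_le n).
rewrite big_nat_cond [leRHS]big_nat_cond; apply: ler_sum => j; rewrite andbT => /andP[j0 jn].
by rewrite add1n subSS subKn// ltnW.
Qed.

Lemma sensitivity_ge (n j : nat) : (0 < j)%N -> (j <= n)%N ->
  (3 * Num.sqrt j%:R)^-1 <= sensitivity n j.
Proof.
move=> j0 jn; have j0R : 0 < j%:R :> R by exact: natr_gt0.
have sj0 : 0 < Num.sqrt j%:R :> R by rewrite sqrtr_gt0.
have -> : (3 * Num.sqrt j%:R)^-1 = (j%:R ^+ 2)^-1 * (2^-1 * (2 / 3 * (j%:R * Num.sqrt j%:R))) :> R.
  have jE : j%:R = Num.sqrt j%:R ^+ 2 :> R by rewrite sqr_sqrtr// ltW.
  move: sj0 jE; set q := Num.sqrt j%:R => sj0 jE.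
  by rewrite jE; field; rewrite gt_eqF.
rewrite ler_wpM2l ?invr_ge0 ?sqr_ge0//.
apply: (le_trans (ler_wpM2l _ (sum_sqrt_mid_ge j))) => //.
rewrite mulr_sumr big_nat_cond [leRHS]big_nat_cond; apply: ler_sum => i.
rewrite andbT ltnS => /andP[i0 ij]; rewrite invfM ler_wpM2l//.
by apply: inv_sqrt_tail_ge => //; exact: leq_trans jn.
Qed.

(** Same leading term as in [sensitivity_ge]; the first error term is the
    discretization error of the sum of square roots, and the second is the
    effect of cutting the tail sums at n. *)
Lemma sensitivity_le (n j : nat) : (0 < j)%N -> (j <= n)%N ->
  sensitivity n j <= (3 * Num.sqrt j%:R)^-1 +
    ((2 * (j%:R * Num.sqrt j%:R))^-1 + (Num.sqrt n%:R)^-1).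
Proof.
move=> j0 jn; have n0 := leq_trans j0 jn.
have j0R : 0 < j%:R :> R by exact: natr_gt0.
have sj0 : 0 < Num.sqrt j%:R :> R by rewrite sqrtr_gt0.
have sn0 : 0 < Num.sqrt n%:R :> R by rewrite sqrtr_gt0 ltr0n.
have -> : (3 * Num.sqrt j%:R)^-1 + ((2 * (j%:R * Num.sqrt j%:R))^-1 + (Num.sqrt n%:R)^-1) =
   (j%:R ^+ 2)^-1 * (2^-1 * (2 / 3 * (j%:R * Num.sqrt j%:R) + Num.sqrt j%:R +
    j%:R * (2 * j%:R / Num.sqrt n%:R))) :> R.
  have jE : j%:R = Num.sqrt j%:R ^+ 2 :> R by rewrite sqr_sqrtr// ltW.
  move: sj0 jE; set q := Num.sqrt j%:R => sj0 jE.
  by rewrite jE; field; rewrite !gt_eqF.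
rewrite ler_wpM2l ?invr_ge0 ?sqr_ge0//.
have h := lerD (sum_sqrt_le j) (ler_wpM2l (ltW j0R) (sum_inv_sqrt_tail_le jn n0)).
apply: le_trans (ler_wpM2l _ h) => //.
rewrite mulr_sumr -big_split/= mulr_sumr big_nat_cond [leRHS]big_nat_cond; apply: ler_sum => i.
rewrite andbT ltnS => /andP[i0 ij]; rewrite invfM ler_wpM2l//.
apply: (le_trans (inv_sqrt_tail_le i0 (leq_trans ij jn))).
by rewrite lerD2l ler_wpM2r ?invr_ge0 ?sqrtr_ge0// ler_nat.
Qed.

Lemma sensitivity_ge0 (n j : nat) : 0 <= sensitivity n j.
Proof.
by rewrite mulr_ge0 ?invr_ge0 ?sqr_ge0// sumr_ge0.
Qed.

Lemma sensitivity_le2 (n j : nat) : (0 < j)%N -> (j <= n)%N -> sensitivity n j <= 2.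
Proof.
move=> j0 jn; apply: (le_trans (sensitivity_le j0 jn)).
have n0 := leq_trans j0 jn.
have j1 : 1 <= j%:R :> R by rewrite ler1n.
have sj1 : 1 <= Num.sqrt j%:R :> R by rewrite -[leLHS]sqrtr1 ler_sqrt.
have sn1 : 1 <= Num.sqrt n%:R :> R by rewrite -[leLHS]sqrtr1 ler_sqrt// ler1n.
have inv_le (c x : R) : 1 <= c -> 1 <= x -> (c * x)^-1 <= c^-1.
  move=> c1 x1; have c0 : 0 < c by exact: lt_le_trans c1.
  by rewrite lef_pV2 ?posrE ?mulr_gt0// ?ler_peMr ?(ltW c0)// (lt_le_trans _ x1).
have h1 := inv_le 3 _ (ler1n R 3) sj1.
have h2 : (2 * (j%:R * Num.sqrt j%:R))^-1 <= 2^-1 :> R.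
  by apply: inv_le; rewrite ?ler1n// mulr_ege1.
have h3 := inv_le 1 _ (lexx _) sn1; rewrite mul1r invr1 in h3.
apply: (le_trans (lerD h1 (lerD h2 h3))); lra.
Qed.

(** In the square of the bound [sensitivity_le] all terms but the first sum to
    O(1): they are at most of order j^-2, 1/(sqrt n sqrt j) and 1/n.  With
    a = 1/sqrt j and b = 1/sqrt n, the cross term a^3 b is absorbed by
    (b - a^3)^2 >= 0. *)
Lemma sum_sensitivity_sqr (n : nat) :
  9^-1 * \sum_(1 <= j < n.+1) j%:R^-1 <= \sum_(1 <= j < n.+1) sensitivity n j ^+ 2
    <= 9^-1 * \sum_(1 <= j < n.+1) j%:R^-1 + 5.
Proof.
have inv3 j : (0 < j)%N -> ((3 * Num.sqrt j%:R)^-1) ^+ 2 = 9^-1 * j%:R^-1 :> R.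
  by move=> j0; rewrite exprVn exprMn sqr_sqrtr// invfM; congr (_^-1 * _); ring.
apply/andP; split.
  rewrite mulr_sumr big_nat_cond [leRHS]big_nat_cond; apply: ler_sum => j.
  rewrite andbT ltnS => /andP[j0 jn]; rewrite -inv3//.
  apply: lerXn2r; rewrite ?nnegrE; [|exact: sensitivity_ge0|exact: sensitivity_ge].
  by rewrite invr_ge0 mulr_ge0 ?sqrtr_ge0.
have [->|n0] := posnP n; first by rewrite !big_geq// mulr0 add0r.
have sn0 : 0 < Num.sqrt n%:R :> R by rewrite sqrtr_gt0 ltr0n.
have nE : n%:R = Num.sqrt n%:R ^+ 2 :> R by rewrite sqr_sqrtr.
apply: (@le_trans _ _ (\sum_(1 <= j < n.+1) (9^-1 * j%:R^-1 + (13 / 12 * (j%:R ^+ 2)^-1 +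
    (2 / 3 / Num.sqrt n%:R * (Num.sqrt j%:R)^-1 + 3 / 2 / n%:R))))).
  rewrite big_nat_cond [leRHS]big_nat_cond; apply: ler_sum => j.
  rewrite andbT ltnS => /andP[j0 jn].
  have j0R : 0 < j%:R :> R by exact: natr_gt0.
  have j1 : 1 <= j%:R :> R by rewrite ler1n.
  have sj0 : 0 < Num.sqrt j%:R :> R by rewrite sqrtr_gt0.
  have b0 := sensitivity_ge0 n j.
  have b1 := sensitivity_le j0 jn.
  apply: (@le_trans _ _ (((3 * Num.sqrt j%:R)^-1 +
    ((2 * (j%:R * Num.sqrt j%:R))^-1 + (Num.sqrt n%:R)^-1)) ^+ 2)).
    by rewrite lerXn2r// nnegrE (le_trans b0).
  have jE : j%:R = Num.sqrt j%:R ^+ 2 :> R by rewrite sqr_sqrtr// ltW.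
  have q1 : 1 <= Num.sqrt j%:R :> R by rewrite -[leLHS]sqrtr1 ler_sqrt.
  move: sj0 q1 sn0 jE nE; set q := Num.sqrt j%:R; set r := Num.sqrt n%:R => sj0 q1 sn0 jE nE.
  rewrite jE nE.
  set a := q^-1; set b := r^-1.
  have a0 : 0 < a by rewrite invr_gt0.
  have b00 : 0 < b by rewrite invr_gt0.
  have a1 : a <= 1 by rewrite invf_le1.
  rewrite -subr_ge0 [leRHS](_ : _ =
      3 / 4 * (a ^+ 4 * (1 - a ^+ 2)) + 2^-1 * (b - a ^+ 3) ^+ 2); last first.
    by rewrite /a /b; field; rewrite !gt_eqF.
  have a2 : a ^+ 2 <= 1 by rewrite exprn_ile1// ltW.
  by rewrite addr_ge0// mulr_ge0 ?sqr_ge0// mulr_ge0 ?subr_ge0// exprn_ge0// ltW.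
rewrite !big_split/= -!mulr_sumr lerD2l sumr_const_nat subn1/=.
have h1 := ler_wpM2l (_ : 0 <= 13 / 12) (sum_inv_sqr_le n).
have h2 : 2 / 3 / Num.sqrt n%:R * \sum_(1 <= i < n.+1) (Num.sqrt i%:R)^-1 <= 4 / 3 :> R.
  apply: le_trans (ler_wpM2l _ (sum_inv_sqrt_le n)) _; first by rewrite divr_ge0 ?sqrtr_ge0.
  rewrite le_eqVlt; apply/orP; left; apply/eqP; field; by rewrite gt_eqF.
have h3 : n%:R^-1 *+ n = 1 :> R by rewrite -[LHS]mulr_natr mulVf// pnatr_eq0 -lt0n.
rewrite h3; apply: (le_trans (lerD (h1 _) (lerD h2 (lexx _)))) => //; lra.
Qed.

Lemma harmonic_ln (n : nat) : (0 < n)%N ->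
  ln (n%:R : R) <= \sum_(1 <= j < n.+1) (j%:R : R)^-1 <= 1 + ln (n%:R : R).
Proof.
move=> n0; have step k : (0 < k)%N ->
    (k.+1%:R : R)^-1 <= ln (k.+1%:R : R) - ln (k%:R : R) <= (k%:R : R)^-1.
  move=> k0; have k0R : 0 < k%:R :> R by exact: natr_gt0.
  have k1R : 0 < k.+1%:R :> R by rewrite ltr0n.
  have kS : k.+1%:R = k%:R + 1 :> R by rewrite natr1.
  apply/andP; split; last first.
    rewrite -ln_div ?posrE//.
    rewrite (_ : k.+1%:R / k%:R = 1 + k%:R^-1); last by rewrite kS; field; rewrite gt_eqF.
    by apply: le_ln1Dx; rewrite (lt_trans (ltrN10 R))// invr_gt0.
  rewrite -[leRHS]opprB -ln_div ?posrE// lerNr.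
  rewrite (_ : k%:R / k.+1%:R = 1 + - k.+1%:R^-1); last first.
    by rewrite kS; field; rewrite -kS gt_eqF.
  apply: le_ln1Dx; rewrite ltrN2 invf_lt1// ltr1n.
  by [].
have ln1' : ln (1%:R : R) = 0 by rewrite ln1.
have lower : ln (n%:R : R) - ln (1%:R : R) <= \sum_(1 <= j < n) (j%:R : R)^-1.
  by apply: (sum_ge_telescope (g := fun k => ln (k%:R : R))) => // k /andP[/step/andP[]].
have upper : \sum_(1 <= j < n) (j.+1%:R : R)^-1 <= ln (n%:R : R) - ln (1%:R : R).
  by apply: (sum_le_telescope (g := fun k => ln (k%:R : R))) => // k /andP[/step/andP[]].
rewrite ln1' subr0 in lower upper; apply/andP; split.
  by apply: (le_trans lower); rewrite big_nat_recr//= lerDl invr_ge0.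
by rewrite big_nat_recl// invr1 lerD2l.
Qed.

End harmonic_sums.

(** * Linearization of the stable cost *)

(** For s >= 0, with u = sqrt s and v = sqrt a, the left-hand side is
    (u - v)^2 / (2 v), and (u - v)^2 v^2 <= (u - v)^2 (u + v)^2 = (s - a)^2.
    Negative s, whose square root is 0 by convention, are included because the
    sums S_k are nonnegative only almost surely. *)
Lemma sqrt_linearization {R : realType} (s a : R) : 0 < a ->
  `|Num.sqrt s - Num.sqrt a - (s - a) / (2 * Num.sqrt a)| <=
  (s - a) ^+ 2 / (2 * (a * Num.sqrt a)).
Proof.
move=> a0; have v0 : 0 < Num.sqrt a by rewrite sqrtr_gt0.
have aE : a = Num.sqrt a ^+ 2 by rewrite sqr_sqrtr// ltW.
move: v0 aE; set v := Num.sqrt a => v0 aE; rewrite aE.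
have v3 : 0 < 2 * (v ^+ 2 * v) by rewrite !mulr_gt0.
rewrite ler_pdivlMr// -{1}(ger0_norm (ltW v3)) -normrM.
have [s0|s0] := leP 0 s.
  have sE : s = Num.sqrt s ^+ 2 by rewrite sqr_sqrtr.
  have u0 : 0 <= Num.sqrt s by exact: sqrtr_ge0.
  move: u0 sE; set u := Num.sqrt s => u0 sE; rewrite sE.
  have -> : (u - v - (u ^+ 2 - v ^+ 2) / (2 * v)) * (2 * (v ^+ 2 * v)) =
      - ((u - v) ^+ 2 * v ^+ 2) by field; rewrite gt_eqF.
  rewrite normrN -exprMn ger0_norm ?sqr_ge0// exprMn.
  rewrite [leRHS](_ : _ = (u - v) ^+ 2 * (u + v) ^+ 2); last by ring.
  rewrite ler_wpM2l ?sqr_ge0//.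
  by rewrite lerXn2r ?nnegrE ?addr_ge0 ?(ltW v0)// lerDr.
rewrite ler0_sqrtr ?(ltW s0)//.
have -> : (0 - v - (s - v ^+ 2) / (2 * v)) * (2 * (v ^+ 2 * v)) =
    - ((v ^+ 2 + s) * v ^+ 2) by field; rewrite gt_eqF.
have v20 : 0 < v ^+ 2 by rewrite exprn_gt0.
rewrite normrN normrM (ger0_norm (ltW v20)).
rewrite [leRHS](_ : _ = (v ^+ 2 - s) * (v ^+ 2 - s)); last by ring.
apply: ler_pM => //; first exact: ltW; last by rewrite lerDl oppr_ge0 ltW.
by rewrite ler_norml; apply/andP; split; lra.
Qed.

Section decomposition.
Context {d : measure_display} {T : measurableType d} {R : realType}.
Context {P : probability T R} {n : nat} (eps : 'I_n -> {RV P >-> R}).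
Hypothesis indep_eps : mutually_independent eps.
Hypothesis law_eps : forall i A, measurable A -> distribution P (eps i) A = expo A.

Let inv_sq (l : 'I_n) : R := ((n - l)%:R ^+ 2)^-1.
Let hit_time (k : 'I_n) (x : T) : R := \sum_(l < n | (l <= k)%N) eps l x / ((n - l) ^ 2)%:R.
Let below (k : 'I_n) : {set 'I_n} := [set l : 'I_n | (l <= k)%N]%SET.
Let mean_time (k : 'I_n) : R := tail_sqr n (n - k).

Let mean_timeE k : \sum_(l in below k) inv_sq l = mean_time k.
Proof.
rewrite big_mkcond/= (eq_bigr (fun l : 'I_n =>
  (fun j => if (n - k <= j)%N then (j%:R ^+ 2)^-1 else 0) (n - l)%N)); last first.
  by move=> l _; rewrite inE leq_sub2lE ?(ltnW (ltn_ord l))// ltnW.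
rewrite (sum_rev_ord n (fun j => if (n - k <= j)%N then (j%:R ^+ 2)^-1 else 0)) /mean_time /tail_sqr.
by rewrite -big_mkcond/= [RHS](big_nat_widenl _ 1)// subn_gt0.
Qed.

Let sensitivityE (l : 'I_n) : sensitivity n (n - l) =
  inv_sq l * \sum_(k < n | (l <= k)%N) (2 * Num.sqrt (mean_time k))^-1.
Proof.
rewrite /sensitivity; congr (_ * _).
rewrite [RHS]big_mkcond/= (eq_bigr (fun k : 'I_n =>
  (fun j => if (j < (n - l).+1)%N then (2 * Num.sqrt (tail_sqr n j))^-1 else 0) (n - k)%N)); last first.
  by move=> k _; rewrite ltnS leq_sub2lE// ltnW.
rewrite (sum_rev_ord n (fun j => if (j < (n - l).+1)%N then (2 * Num.sqrt (tail_sqr n j))^-1 else 0)).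
by rewrite (big_nat_widen _ _ n.+1)/= ?ltnS ?leq_subr// big_mkcond.
Qed.

Let hit_timeB k x : hit_time k x - mean_time k = centered_sum eps inv_sq (below k) x.
Proof.
have -> : hit_time k x = \sum_(l in below k) eps l x / ((n - l) ^ 2)%:R.
  by apply: eq_bigl => l; rewrite inE.
by rewrite -mean_timeE -sumrB; apply: eq_bigr => l _; rewrite mulrBr mulr1 mulrC natrX -/(inv_sq l).
Qed.

Let mean_time_gt0 k : 0 < mean_time k.
Proof. by apply: tail_sqr_gt0; rewrite ?subn_gt0 ?leq_subr. Qed.

Let rest (k : 'I_n) (x : T) : R := Num.sqrt (hit_time k x) - Num.sqrt (mean_time k) -
  (hit_time k x - mean_time k) / (2 * Num.sqrt (mean_time k)).

Let measurable_hit_time k : measurable_fun [set: T] (hit_time k).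
Proof.
rewrite (_ : hit_time k = fun x => centered_sum eps inv_sq (below k) x + mean_time k).
  by apply: measurable_funD => //; exact: measurable_centered_sumT.
by apply/funext => x; rewrite -hit_timeB subrK.
Qed.

Let measurable_rest k : measurable_fun [set: T] (rest k).
Proof.
apply: measurable_funB; last by apply: measurable_funM => //; exact: measurable_funB.
apply: measurable_funB => //; apply: (measurableT_comp _ (measurable_hit_time k)).
by apply: continuous_measurable_fun; exact: sqrt_continuous.
Qed.

(** By [sqrt_linearization] and the fourth moment bound, the quadratic mean is
    at most sqrt(13)/2 * V / a^(3/2) with V the variance and a the mean of the
    hitting time.  Each weight is at most J = (n-k)^-2, so V <= J a. *)
Let rms_rest k : (rms P (rest k) <=
  (2 * (((n - k)%:R ^+ 2)^-1 / Num.sqrt (mean_time k)))%:E)%E.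
Proof.
have a0 := mean_time_gt0 k; set a := mean_time k in a0 *.
have sa0 : 0 < Num.sqrt a by rewrite sqrtr_gt0.
set V := \sum_(l in below k) inv_sq l ^+ 2.
set J : R := ((n - k)%:R ^+ 2)^-1.
have J0 : 0 <= J by rewrite invr_ge0 sqr_ge0.
have V0 : 0 <= V by apply: sumr_ge0 => l _; exact: sqr_ge0.
have VJ : V <= J * a.
  rewrite /a -mean_timeE mulr_sumr; apply: ler_sum => l; rewrite inE => lk.
  rewrite expr2 ler_wpM2r ?invr_ge0 ?sqr_ge0//.
  rewrite lef_pV2 ?posrE ?exprn_gt0 ?ltr0n ?subn_gt0//.
  by rewrite lerXn2r ?nnegrE// ler_nat leq_sub2l.
apply: rms_le; first by rewrite mulr_ge0// divr_ge0// ltW.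
apply: (@le_trans _ _ (\int[P]_x ((4 * a ^+ 3)^-1 * centered_sum eps inv_sq (below k) x ^+ 4)%:E)%E).
  apply: ge0_le_integral => //.
  - by move=> x _; rewrite lee_fin sqr_ge0.
  - by apply/measurable_EFinP/measurable_funX/measurable_rest.
  - apply/measurable_EFinP/measurable_funM => //.
    exact/measurable_funX/measurable_centered_sumT.
  - move=> x _; rewrite lee_fin -hit_timeB.
    have := sqrt_linearization (hit_time k x) a0; rewrite -/a -/(rest k x) => h.
    rewrite -real_normK ?num_real//.
    apply: (@le_trans _ _ (((hit_time k x - a) ^+ 2 / (2 * (a * Num.sqrt a))) ^+ 2)).
      rewrite lerXn2r ?nnegrE// divr_ge0 ?sqr_ge0// mulr_ge0// mulr_ge0// ltW//.
    rewrite le_eqVlt; apply/orP; left; apply/eqP.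
    have aE : a = Num.sqrt a ^+ 2 by rewrite sqr_sqrtr// ltW.
    by move: sa0 aE; set v := Num.sqrt a => v0 aE; rewrite aE; field; rewrite gt_eqF.
under eq_integral do rewrite EFinM.
rewrite ge0_integralZl//; last 3 first.
- exact/measurable_EFinP/measurable_funX/measurable_centered_sumT.
- by move=> x _; rewrite lee_fin exprn_even_ge0.
- by rewrite lee_fin invr_ge0 mulr_ge0// exprn_ge0// ltW.
have c0 : (0%:E <= ((4 * a ^+ 3)^-1)%:E)%E.
  by rewrite lee_fin invr_ge0 mulr_ge0// exprn_ge0// ltW.
apply: (le_trans (lee_wpmul2l c0 (centered_sum_pow4 indep_eps law_eps inv_sq (below k)))).
rewrite -EFinM lee_fin -/V.
have V2 : V ^+ 2 <= (J * a) ^+ 2 by rewrite lerXn2r ?nnegrE// mulr_ge0// ltW.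
apply: (@le_trans _ _ ((4 * a ^+ 3)^-1 * (13 * (J * a) ^+ 2))).
  by apply: ler_wpM2l; [rewrite -lee_fin|apply: ler_wpM2l].
have aE : a = Num.sqrt a ^+ 2 by rewrite sqr_sqrtr// ltW.
move: sa0 aE; set v := Num.sqrt a => v0 aE; rewrite aE -subr_ge0.
rewrite [leRHS](_ : _ = 3 / 4 * (J / v) ^+ 2); last by field; rewrite gt_eqF.
by rewrite mulr_ge0// sqr_ge0.
Qed.

Lemma cost_decomposition : exists (m : R) (E : T -> R),
  [/\ measurable_fun [set: T] E,
      forall x, \sum_(k < n) Num.sqrt (hit_time k x) =
        m + centered_sum eps (fun l => sensitivity n (n - l)) [set: 'I_n]%SET x + E x &
      (rms P E <= 36%:E)%E].
Proof.
exists (\sum_(k < n) Num.sqrt (mean_time k)), (fun x => \sum_(k < n) rest k x).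
split; first exact: measurable_sum.
  move=> x; have -> : centered_sum eps (fun l => sensitivity n (n - l)) [set: 'I_n]%SET x =
      \sum_(k < n) (hit_time k x - mean_time k) / (2 * Num.sqrt (mean_time k)).
    under [RHS]eq_bigr do rewrite hit_timeB /centered_sum mulr_suml.
    transitivity (\sum_(l < n) \sum_(k < n | (l <= k)%N)
        inv_sq l * (eps l x - 1) / (2 * Num.sqrt (mean_time k))).
      apply: eq_big => [l|l _]; first by rewrite inE.
      by rewrite sensitivityE mulrAC mulr_sumr.
    rewrite (exchange_big_dep xpredT)//=; apply: eq_bigr => k _.
    by apply: eq_bigl => l; rewrite inE.
  by rewrite -!big_split/=; apply: eq_bigr => k _; rewrite /rest; ring.
apply: (le_trans (rms_sum P _ measurable_rest)).
apply: (@le_trans _ _ (\sum_(k < n) (2 * (((n - k)%:R ^+ 2)^-1 / Num.sqrt (mean_time k)))%:E)%E).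
  by apply: lee_sum => k _; exact: rms_rest.
rewrite sumEFin lee_fin -mulr_sumr (sum_rev_ord n (fun j => (j%:R ^+ 2)^-1 / Num.sqrt (tail_sqr n j))).
rewrite (_ : 36 = 2 * 18); last by ring.
by rewrite ler_wpM2l// sum_remainder_le.
Qed.

End decomposition.

(** * Stein's equation for the normal law *)

Section gaussian_tail.
Context {R : realType}.
Implicit Types x y : R.

Let mu := @lebesgue_measure R.
Let phi : R -> R := normal_pdf 0 1.

Lemma std_normal_pdfE x : normal_pdf 0 1 x = normal_peak 1 * expR (- (x ^+ 2 / 2)) :> R.
Proof. by rewrite normal_pdfE ?oner_neq0// /normal_fun subr0 expr1n mulNr. Qed.

Lemma std_normal_pdf_gt0 x : 0 < normal_pdf 0 1 x :> R.
Proof. by rewrite std_normal_pdfE mulr_gt0 ?expR_gt0 ?normal_peak_gt0 ?oner_neq0. Qed.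

Lemma is_derive_std_normal_pdf x : is_derive x 1 (normal_pdf 0 1 : R -> R) (- (x * normal_pdf 0 1 x)).
Proof.
rewrite (_ : normal_pdf 0 1 = fun x : R => normal_peak 1 * expR (- (x ^+ 2 / 2))); last first.
  by apply/funext => y; exact: std_normal_pdfE.
apply: is_derive_eq.
by rewrite /GRing.scale/=; field.
Qed.

Lemma std_normal_pdf_cvg0 : normal_pdf 0 1 x @[x --> +oo] --> (0 : R).
Proof.
rewrite (_ : normal_pdf 0 1 = fun x : R => normal_peak 1 * expR (- (x ^+ 2 / 2))); last first.
  by apply/funext => y; exact: std_normal_pdfE.
rewrite -[X in _ --> X](mulr0 (normal_peak 1)); apply: cvgM; first exact: cvg_cst.
apply: (squeeze_cvgr _ (cvg_cst 0) (@cvgr_expR R)).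
near=> x; rewrite expR_ge0/= ler_expR lerN2.
have x2 : 2 <= x by near: x; exact: nbhs_pinfty_ge.
by rewrite expr2 -mulrA ler_peMr ?ler_pdivlMr ?mul1r//; lra.
Unshelve. all: by end_near. Qed.

(** The density phi satisfies phi' = - x phi. *)
Lemma gaussian_tail_moment x : 0 <= x ->
  (\int[mu]_(y in `[x, +oo[) (y * phi y)%:E = (phi x)%:E)%E.
Proof.
move=> x0; have dphi y := is_derive_std_normal_pdf y.
have cphi : continuous phi by apply: continuous_normal_pdf; exact: oner_neq0.
rewrite (@ge0_continuous_FTC2y R _ (fun y => - phi y) x 0) ?sub0e//=.
- by rewrite opprK.
- by move=> y xy; rewrite mulr_ge0 ?normal_pdf_ge0// (le_trans x0).
- by apply: continuous_subspaceT => y; apply: cvgM; [exact: cvg_id|exact: cphi].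
- by rewrite -oppr0; apply: cvgN; exact: std_normal_pdf_cvg0.
- by apply: cvg_at_right_filter; apply: cvgN; exact: cphi.
- by move=> y _; rewrite derive1E deriveN//= derive_val opprK.
Qed.

(** Mills' inequality: under the integral x is at most y. *)
Lemma gaussian_tail_le x : 0 <= x ->
  (x%:E * \int[mu]_(y in `[x, +oo[) (phi y)%:E <= (phi x)%:E)%E.
Proof.
move=> x0; rewrite -(gaussian_tail_moment x0).
have mphi (D : set (measurableTypeR R)) : measurable_fun D phi.
  by apply/measurable_funTS; exact: measurable_normal_pdf.
rewrite -ge0_integralZl//; last 2 first.
- exact/measurable_EFinP.
- by move=> y _; rewrite lee_fin normal_pdf_ge0.
apply: ge0_le_integral => //.
- by move=> y _; rewrite -EFinM lee_fin mulr_ge0// normal_pdf_ge0.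
- have /measurable_EFinP : measurable_fun `[x, +oo[%classic (fun y : measurableTypeR R => x * phi y).
    by apply: measurable_funM => //; exact: mphi.
  exact.
- by apply/measurable_EFinP; apply: measurable_funM => //; exact: mphi.
- by move=> y /=; rewrite in_itv/= andbT -EFinM lee_fin => xy; rewrite ler_wpM2r ?normal_pdf_ge0.
Qed.

Lemma std_normal_pdfN x : normal_pdf 0 1 (- x) = normal_pdf 0 1 x :> R.
Proof. by rewrite !std_normal_pdfE sqrrN. Qed.

Lemma gaussian_tailN x : (\int[mu]_(y in `]-oo, x]) (phi y)%:E =
  \int[mu]_(y in `[(- x)%R, +oo[) (phi y)%:E)%E.
Proof.
have := @ge0_integration_by_substitutionNy R phi (- x); rewrite opprK => ->.
- by apply: eq_integral => y _; rewrite /= /phi std_normal_pdfN.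
- by apply: continuous_subspaceT; apply: continuous_normal_pdf; exact: oner_neq0.
- by move=> y _; exact: normal_pdf_ge0.
Qed.

End gaussian_tail.

Section stein_equation.
Context {R : realType} (f : R -> R).
Hypothesis cf : continuous f.
Hypothesis f01 : forall x, 0 <= f x <= 1.

Let mu := @lebesgue_measure R.
Let phi : R -> R := normal_pdf 0 1.
Let c : R := fine (\int[normal_prob 0 1]_x (f x)%:E)%E.

Let mf : measurable_fun [set: R] f.
Proof. exact: continuous_measurable_fun. Qed.

Let mphi : measurable_fun [set: R] phi.
Proof. exact: measurable_normal_pdf. Qed.

Lemma std_normal_integral : (\int[normal_prob 0 1]_x (f x)%:E = c%:E)%E.
Proof.
rewrite fineK// ge0_fin_numE; last first.
  by apply: integral_ge0 => x _; rewrite lee_fin; case/andP: (f01 x).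
apply: (@le_lt_trans _ _ (\int[normal_prob 0 1]_x 1%:E)%E).
  apply: ge0_le_integral => //.
  - by move=> x _; rewrite lee_fin; case/andP: (f01 x).
  - exact/measurable_EFinP.
  - by move=> x _; rewrite lee_fin; case/andP: (f01 x).
by rewrite probability_integral_cst ltry.
Qed.

Let c01 : 0 <= c <= 1.
Proof.
rewrite -!lee_fin -std_normal_integral; apply/andP; split.
  by apply: integral_ge0 => x _; rewrite lee_fin; case/andP: (f01 x).
rewrite -[leRHS](probability_integral_cst (normal_prob 0 1) 1).
apply: ge0_le_integral => //.
- by move=> x _; rewrite lee_fin; case/andP: (f01 x).
- exact/measurable_EFinP.
- by move=> x _; rewrite lee_fin; case/andP: (f01 x).
Qed.

Let u x := (f x - c) * phi x.

Let u_le x : `|u x| <= phi x.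
Proof.
rewrite normrM [X in _ * X]ger0_norm ?normal_pdf_ge0// ler_piMl ?normal_pdf_ge0//.
move: (f01 x) c01 => /andP[? ?] /andP[? ?].
by rewrite ler_norml; apply/andP; split; lra.
Qed.

Let mu_ : measurable_fun [set: R] u.
Proof. by apply: measurable_funM => //; exact: measurable_funB. Qed.

Let iu (D : set R) : measurable D -> mu.-integrable D (EFin \o u).
Proof.
move=> mD; apply: (@integrableS _ _ _ mu setT) => //.
apply: (le_integrable _ _ _ (integrable_normal_pdf 0 1)) => //.
  exact/measurable_EFinP.
by move=> x _ /=; rewrite lee_fin [leRHS]ger0_norm ?normal_pdf_ge0.
Qed.

Let integral_u : (\int[mu]_x (u x)%:E = 0)%E.
Proof.
have fphi : (\int[mu]_x (f x * phi x)%:E = c%:E)%E.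
  rewrite -std_normal_integral (@ge0_integral_density _ _ _ mu (normal_prob 0 1) phi)//.
  - exact: normal_pdf_ge0.
  - exact/measurable_EFinP.
  - by move=> x; rewrite lee_fin; case/andP: (f01 x).
have ifphi : mu.-integrable [set: R] (EFin \o (fun x => f x * phi x)).
  apply: (le_integrable _ _ _ (integrable_normal_pdf 0 1)) => //.
    by apply/measurable_EFinP; exact: measurable_funM.
  move=> x _ /=; case/andP: (f01 x) => f0 f1.
  by rewrite lee_fin normrM ler_piMl// ger0_norm.
have icphi : mu.-integrable [set: R] (fun x => c%:E * (phi x)%:E)%E.
  by apply: integrableZl => //; exact: integrable_normal_pdf.
transitivity (\int[mu]_x ((f x * phi x)%:E - c%:E * (phi x)%:E))%E.
  by apply: eq_integral => x _; rewrite /u mulrBl EFinB EFinM.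
rewrite integralB// fphi integralZl//; last exact: integrable_normal_pdf.
by rewrite integral_normal_pdf mule1 subee.
Qed.

Let F x : R := \int[mu]_(t in `]-oo, x]) u t.

Let F_le (x : R) : (`|F x|%:E <= \int[mu]_(y in `]-oo, x]) (phi y)%:E)%E.
Proof.
rewrite /F /Rintegral -abse_EFin fineK; last by apply: integrable_fin_num => //; exact: iu.
apply: le_trans (le_abse_integral _ _ _) _ => //.
  exact/measurable_EFinP/measurable_funTS.
apply: ge0_le_integral => //.
- exact/measurable_EFinP/measurable_funTS/measurableT_comp.
- exact/measurable_EFinP/measurable_funTS.
- by move=> y _; rewrite /= lee_fin.
Qed.

Let F_leN (x : R) : (`|F x|%:E <= \int[mu]_(y in `[x, +oo[) (phi y)%:E)%E.
Proof.
have /= := @Rintegral_itvB R u (BInfty R true) (BInfty R false) x.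
rewrite set_itvNyy -/(F x) [\int[_]_(_ in [set: _]) _](_ : _ = 0); last first.
  by rewrite /Rintegral integral_u.
rewrite sub0r => /(_ (iu measurableT) isT isT) FE.
rewrite -normrN FE /Rintegral -abse_EFin fineK; last by apply: integrable_fin_num => //; exact: iu.
apply: le_trans (le_abse_integral _ _ _) _ => //.
  exact/measurable_EFinP/measurable_funTS.
apply: (@le_trans _ _ (\int[mu]_(y in `]x, +oo[) (phi y)%:E)%E).
  apply: ge0_le_integral => //.
  - exact/measurable_EFinP/measurable_funTS/measurableT_comp.
  - exact/measurable_EFinP/measurable_funTS.
  - by move=> y _; rewrite /= lee_fin.
apply: ge0_subset_integral => //.
- exact/measurable_EFinP/measurable_funTS.
- by move=> y _; rewrite lee_fin normal_pdf_ge0.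
- by move=> y /=; rewrite !in_itv/= !andbT; exact: ltW.
Qed.

Let mills x : `|x * F x| <= phi x.
Proof.
have xF (y : R) (I : \bar R) : 0 <= y -> (`|F x|%:E <= I)%E -> (y%:E * I <= (phi x)%:E)%E ->
    y * `|F x| <= phi x.
  move=> y0 FI yI; rewrite -lee_fin EFinM; apply: le_trans yI; exact: lee_wpmul2l.
rewrite normrM; have [x0|x0] := leP 0 x.
  by rewrite ger0_norm//; apply: (xF _ _ x0 (F_leN x)); exact: gaussian_tail_le.
rewrite ltr0_norm//; apply: (xF _ _ _ (F_le x)); first by rewrite oppr_ge0 ltW.
have := @gaussian_tail_le R (- x); rewrite std_normal_pdfN -gaussian_tailN; apply.
by rewrite oppr_ge0 ltW.
Qed.

Let F_le1 x : `|F x| <= 1.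
Proof.
rewrite -lee_fin; apply: le_trans (F_le x) _.
apply: (@le_trans _ _ (\int[mu]_y (phi y)%:E)%E); last by rewrite integral_normal_pdf.
apply: ge0_subset_integral => //; first exact/measurable_EFinP.
by move=> y _; rewrite lee_fin normal_pdf_ge0.
Qed.

Let dF (x : R) : is_derive x 1 F (u x).
Proof.
have x1 : x < x + 1 by rewrite ltrDl.
have cu : {for x, continuous u}.
  apply: cvgM; first by apply: cvgB; [exact: cf|exact: cvg_cst].
  by apply: continuous_normal_pdf; exact: oner_neq0.
have [dFx F'x] := @continuous_FTC1 R u (BInfty R true) x (x + 1) x1 (iu (measurable_itv _)) (ltNyr _) cu.
by rewrite derive1E in F'x; exact: DeriveDef dFx F'x.
Qed.

(** The solution is g = F / phi with F(x) the integral of (f - c) phi up to x.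
    As the total integral is 0, F is also minus the integral over the other
    half-line, and Mills' inequality on the appropriate side gives
    |x g(x)| <= 1, hence |g'| <= 2. *)
Lemma stein_equation : exists (g : R -> R) (B : R),
  [/\ forall x : R, is_derive x 1 g (x * g x + (f x - c)),
      forall x, `|g x| <= B & forall x, `|x * g x + (f x - c)| <= 2].
Proof.
pose g x := F x / phi x.
have phi0 x : 0 < phi x by exact: std_normal_pdf_gt0.
have xg x : `|x * g x| <= 1.
  by rewrite /g mulrA normrM normfV (ger0_norm (ltW (phi0 _))) ler_pdivrMr// mul1r.
exists g, (1 + (phi 1)^-1); split => [x|x|x].
- have phiN0 : phi x != 0 by rewrite gt_eqF.
  have dphi := is_derive_std_normal_pdf x.
  have := is_deriveM (dF x) (is_deriveV phiN0 dphi).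
  by move/is_derive_eq; apply; rewrite /g /u /GRing.scale/= -/(phi x); field.
- have [x1|x1] := leP 1 `|x|.
    apply: (@le_trans _ _ 1); last by rewrite lerDl invr_ge0 ltW.
    by apply: (le_trans _ (xg x)); rewrite [leRHS]normrM ler_peMl.
  apply: (@le_trans _ _ (phi 1)^-1); last by rewrite lerDr.
  rewrite /g normrM normfV (ger0_norm (ltW (phi0 _))) -[leRHS]mul1r ler_pM ?invr_ge0 ?(ltW (phi0 _))//.
  rewrite lef_pV2 ?posrE// /phi !std_normal_pdfE ler_wpM2l ?normal_peak_ge0// ler_expR.
  rewrite lerN2 ler_pM2r// -real_normK ?num_real//.
  by rewrite lerXn2r ?nnegrE// ltW.
- apply: (le_trans (ler_normD _ _)); rewrite [leRHS](_ : _ = 1 + 1)// lerD//.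
  move: (f01 x) c01 => /andP[? ?] /andP[? ?].
  by rewrite ler_norml; apply/andP; split; lra.
Qed.

End stein_equation.

(** * Normal approximation of linear statistics *)

Section stein_bound.
Context {d : measure_display} {T : measurableType d} {R : realType}.
Context {P : probability T R} {I : finType} (X : I -> {RV P >-> R}).
Hypothesis indX : mutually_independent X.
Hypothesis lawX : forall i A, measurable A -> distribution P (X i) A = expo A.
Variable c : I -> R.
Let L := centered_sum X c [set: I]%SET.

Let mL : measurable_fun [set: T] L.
Proof. exact: measurable_centered_sumT. Qed.

Let integrable_X i : P.-integrable [set: T] (EFin \o X i).
Proof.
have E x : X i x = centered_sum X (fun=> 1) [set i]%SET x + 1.
  by rewrite /centered_sum big_set1 mul1r subrK.
have -> : EFin \o X i = (fun x => (centered_sum X (fun=> 1%R) [set i]%SET x)%:E + 1)%E.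
  by apply/funext => x /=; rewrite E EFinD.
apply: integrableD => //; last exact: finite_measure_integrable_cst.
apply: rms_integrable; first exact: measurable_centered_sumT.
rewrite (@rms_eq _ _ _ _ _ 1)// ?ltry// centered_sum_sqr//.
by rewrite big_set1.
Qed.

(** The integrand of [expo_integration_by_parts] for the variable X i, along
    the section of g(L) in which the other variables are frozen. *)
Let bracket (g g' : R -> R) i x := (X i x - 1) * g (L x) - X i x * (c i * g' (L x)).

Let integrable_bracket g g' B i : continuous g -> continuous g' ->
  (forall x, `|g x| <= B) -> (forall x, `|g' x| <= B) ->
  P.-integrable [set: T] (EFin \o bracket g g' i).
Proof.
move=> cg cg' gB g'B.
have B0 : 0 <= B by exact: le_trans (normr_ge0 _) (gB 0).
have mgL (h : R -> R) : continuous h -> measurable_fun [set: T] (fun x => h (L x)).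
  by move=> ch; apply: measurableT_comp => //; exact: continuous_measurable_fun.
pose K := B * (1 + `|c i|).
have : P.-integrable [set: T] (EFin \o (fun x => K * (1 + `|X i x|))).
  have := finite_measure_integrable_cst P 1 measurableT => i1.
  have := integrableD measurableT i1 (integrable_abse (integrable_X i)).
  by move=> /(integrableZl measurableT K).
apply: le_integrable => //.
  apply/measurable_EFinP; apply: measurable_funB.
    by apply: measurable_funM; [exact: measurable_funB|exact: mgL].
  by apply: measurable_funM => //; apply: measurable_funM => //; exact: mgL.
move=> x _ /=; rewrite lee_fin [leRHS]ger0_norm; last first.
  by rewrite mulr_ge0 ?mulr_ge0 ?addr_ge0.
rewrite /bracket; apply: (le_trans (ler_normB _ _)); rewrite !normrM.
have -> : K * (1 + `|X i x|) = (`|X i x| + 1) * B + (1 + `|X i x|) * (`|c i| * B) by rewrite /K; ring.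
apply: lerD; apply: ler_pM => //.
- by rewrite (le_trans (ler_normB _ _))// normr1.
- by rewrite lerDr.
- by rewrite ler_wpM2l.
Qed.

Let integral_bracket g g' B i : (forall x : R, is_derive x 1 g (g' x)) -> continuous g' ->
  (forall x, `|g x| <= B) -> (forall x, `|g' x| <= B) ->
  (\int[P]_x (bracket g g' i x)%:E = 0)%E.
Proof.
move=> dg cg' gB g'B.
have B0 : 0 <= B by exact: le_trans (normr_ge0 _) (gB 0).
have cg : continuous g by apply: derivable_continuous => x; exact: ex_derive.
pose S := centered_sum X c ([set: I] :\ i)%SET.
have iN : i \notin ([set: I] :\ i)%SET by rewrite !inE eqxx.
pose F (y : generated_by X ([set: I] :\ i)%SET * R) : \bar R :=
  ((y.2 - 1) * g (S y.1 + c i * (y.2 - 1)) - y.2 * (c i * g' (S y.1 + c i * (y.2 - 1))))%:E.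
have FE x : F (x, X i x) = (bracket g g' i x)%:E.
  by rewrite /F /bracket /L (@centered_sumD1 _ _ _ _ _ X c _ i) ?inE.
have mF : measurable_fun [set: generated_by X ([set: I] :\ i)%SET * R] F.
  have ms : measurable_fun [set: generated_by X ([set: I] :\ i)%SET * R]
      (fun y => S y.1 + c i * (y.2 - 1)).
    apply: measurable_funD.
      exact: (measurableT_comp (@measurable_centered_sum _ _ _ _ _ X c ([set: I] :\ i)%SET)).
    by apply: measurable_funM => //; exact: measurable_funB.
  have mg (h : R -> R) : continuous h -> measurable_fun [set: generated_by X ([set: I] :\ i)%SET * R]
      (fun y => h (S y.1 + c i * (y.2 - 1))).
    by move=> ch; apply: measurableT_comp => //; exact: continuous_measurable_fun.
  apply/measurable_EFinP; apply: measurable_funB.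
    by apply: measurable_funM; [exact: measurable_funB|exact: mg].
  by apply: measurable_funM => //; apply: measurable_funM => //; exact: mg.
have iF : P.-integrable [set: T] (fun x => F (x, X i x)).
  under [X in _.-integrable _ X]funext do rewrite FE.
  exact: integrable_bracket cg cg' gB g'B.
transitivity (\int[P]_x F (x, X i x))%E; first by apply: eq_integral => x _; rewrite FE.
rewrite (integral_freeze indX iN mF iF); apply: integral0_eq => x _.
rewrite integral_lawX//.
apply: (@expo_integration_by_parts R (fun z => g (S x + c i * (z - 1)))
  (fun z => c i * g' (S x + c i * (z - 1))) (B * (1 + `|c i|))).
- move=> z; have dl : is_derive z 1 (fun z => S x + c i * (z - 1)) (c i).
    by apply: is_derive_eq; rewrite /GRing.scale/=; ring.
  have := @is_derive1_comp _ g (fun z => S x + c i * (z - 1)) z _ _ (dg _) dl.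
  by rewrite mulrC.
- move=> z; apply: cvgM; first exact: cvg_cst.
  apply: continuous_comp; last exact: cg'.
  apply: cvgD; first exact: cvg_cst.
  by apply: cvgM; [exact: cvg_cst|apply: cvgB; [exact: cvg_id|exact: cvg_cst]].
- move=> z; apply: (le_trans (gB _)).
  rewrite -mulrA -[leLHS]mulr1 ler_wpM2l//.
  have : 0 <= `|c i| * (1 + `|z|) by rewrite mulr_ge0// addr_ge0.
  by have := normr_ge0 z; lra.
- move=> z; rewrite normrM; apply: (@le_trans _ _ (`|c i| * B)); first by rewrite ler_wpM2l.
  by rewrite mulrC ler_wpM2l// lerDr.
Qed.

(** For g = 1 the bracket reduces to X i - 1. *)
Lemma expectation_centered_sum : ('E_P[L] = 0)%E.
Proof.
pose g (x : R) : R := 1; pose g' (x : R) : R := 0.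
have dg (x : R) : is_derive x 1 g (g' x) by exact: is_derive_cst.
have cg : continuous g by exact: cst_continuous.
have cg' : continuous g' by exact: cst_continuous.
have gB x : `|g x| <= 1 by rewrite normr1.
have g'B x : `|g' x| <= 1 by rewrite normr0.
have iB i : P.-integrable [set: T] (EFin \o bracket g g' i).
  exact: integrable_bracket cg cg' gB g'B.
rewrite unlock (eq_integral (fun x => \sum_i (c i)%:E * (bracket g g' i x)%:E)%E); last first.
  move=> x _; rewrite /L /centered_sum -sumEFin; apply: eq_big => [i|i _]; first by rewrite inE.
  by rewrite -EFinM /bracket /g /g' mulr1 !mulr0 subr0.
rewrite integral_sum//; last by move=> i; apply: integrableZl => //; exact: iB.
apply: big1 => i _; rewrite integralZl//; last exact: iB.
by rewrite (integral_bracket i dg cg' gB g'B) mule0.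
Qed.

Hypothesis c1 : \sum_i c i ^+ 2 = 1.

(** By the Stein identity of the exponential law,
    E L g(L) = \sum_i c_i^2 E X_i g'(L).  As the c_i^2 sum to 1,
    E f(L) - N f = E [g'(L) - L g(L)] = - E g'(L) W with
    W = \sum_i c_i^2 (X_i - 1), and the quadratic mean of W is the square root
    of \sum_i c_i^4.  The identity fE below is the pointwise version of this,
    Z having mean 0. *)
Lemma stein_bound (f : R -> R) : continuous f -> (forall x, 0 <= f x <= 1) ->
  (`|\int[P]_x (f (L x))%:E - \int[normal_prob 0 1]_x (f x)%:E| <=
   (2 * Num.sqrt (\sum_i c i ^+ 4))%:E)%E.
Proof.
move=> cf f01; have [g [B [dg gB g'2]]] := stein_equation cf f01.
rewrite (std_normal_integral cf f01).
set a := fine _ in dg g'2 *.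
pose g' x := x * g x + (f x - a).
have cg : continuous g by apply: derivable_continuous => x; exact: ex_derive.
have cg' : continuous g'.
  move=> x; apply: cvgD; first by apply: cvgM; [exact: cvg_id|exact: cg].
  by apply: cvgB; [exact: cf|exact: cvg_cst].
pose K := B + 2.
have B0 : 0 <= B by exact: le_trans (normr_ge0 _) (gB 0).
have gK x : `|g x| <= K by rewrite (le_trans (gB x))// lerDl.
have g'K x : `|g' x| <= K by rewrite (le_trans (g'2 x))// lerDr.
pose Z x := \sum_i c i * bracket g g' i x.
have iZ i : P.-integrable [set: T] (fun x => (c i)%:E * (bracket g g' i x)%:E)%E.
  by apply: integrableZl => //; exact: integrable_bracket cg cg' gK g'K.
have ZE x : (Z x)%:E = (\sum_i (c i)%:E * (bracket g g' i x)%:E)%E.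
  by rewrite /Z -sumEFin; apply: eq_bigr => i _; rewrite EFinM.
have iZ' : P.-integrable [set: T] (EFin \o Z).
  rewrite (_ : EFin \o Z = fun x => \sum_i (c i)%:E * (bracket g g' i x)%:E)%E; last first.
    by apply/funext => x; exact: ZE.
  exact: integrable_sum.
have Z0 : (\int[P]_x (Z x)%:E = 0)%E.
  under eq_integral do rewrite ZE.
  rewrite integral_sum// big1// => i _.
  rewrite integralZl//; last exact: integrable_bracket cg cg' gK g'K.
  by rewrite (integral_bracket i dg cg' gK g'K) mule0.
pose W := centered_sum X (fun i => c i ^+ 2) [set: I]%SET.
have mW : measurable_fun [set: T] W by exact: measurable_centered_sumT.
have rW : rms P W = (Num.sqrt (\sum_i c i ^+ 4))%:E.
  apply: rms_eq; first exact: sqrtr_ge0.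
  rewrite centered_sum_sqr// sqr_sqrtr; last first.
    by apply: sumr_ge0 => i _; rewrite exprn_even_ge0.
  congr (_%:E); apply: eq_big => [i|i _]; first by rewrite inE.
  by rewrite -exprM.
have iW : P.-integrable [set: T] (EFin \o W) by apply: rms_integrable; rewrite // rW ltry.
pose V x := - (W x * g' (L x)).
have mV : measurable_fun [set: T] V.
  apply: measurableT_comp => //; apply: measurable_funM => //.
  by apply: measurableT_comp => //; exact: continuous_measurable_fun.
have VW x : `|V x| <= 2 * `|W x| by rewrite normrN normrM mulrC ler_wpM2r// g'2.
have iV : P.-integrable [set: T] (EFin \o V).
  have : P.-integrable [set: T] (fun x => 2%:E * `|(EFin \o W) x|)%E.
    by apply: integrableZl => //; exact: integrable_abse.
  apply: le_integrable => //; first exact/measurable_EFinP.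
  by move=> x _ /=; rewrite lee_fin normrM normr_id (ger0_norm (ler0n R 2)).
have fE x : f (L x) + Z x = a + V x.
  have ZLW : Z x = L x * g (L x) - W x * g' (L x) - g' (L x).
    have [LE WE] : L x = \sum_i c i * (X i x - 1) /\ W x = \sum_i c i ^+ 2 * (X i x - 1).
      by split; apply: eq_bigl => i; rewrite inE.
    rewrite -[X in _ = _ - X]mul1r -c1 LE WE !mulr_suml -!sumrB -LE.
    by apply: eq_bigr => i _; rewrite /bracket; ring.
  by rewrite ZLW /V /g'; ring.
have if_ : P.-integrable [set: T] (EFin \o (f \o L)).
  apply: (le_integrable measurableT _ _ (finite_measure_integrable_cst P 1 measurableT)) => //.
    apply/measurable_EFinP; apply: measurableT_comp => //.
    exact: continuous_measurable_fun.
  move=> x _ /=; case/andP: (f01 (L x)) => f0 f1.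
  by rewrite lee_fin normr1 ger0_norm.
have -> : (\int[P]_x (f (L x))%:E = a%:E + \int[P]_x (V x)%:E)%E.
  rewrite -[LHS]adde0 -Z0 -integralD_EFin//.
  rewrite -[in RHS](probability_integral_cst P a) -integralD_EFin//; last first.
    exact: finite_measure_integrable_cst.
  by apply: eq_integral => x _; rewrite /= -!EFinD fE.
rewrite addeAC subee// add0e.
apply: (le_trans (le_abse_integral _ measurableT _)); first exact/measurable_EFinP.
apply: (@le_trans _ _ (\int[P]_x (2%:E * `|W x|%:E))%E).
  apply: ge0_le_integral => //.
  - by apply/measurable_EFinP; exact: measurableT_comp.
  - under eq_fun do rewrite -EFinM.
    by apply/measurable_EFinP; apply: measurable_funM => //; exact: measurableT_comp.
  - by move=> x _; rewrite -EFinM lee_fin.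
rewrite ge0_integralZl//; last by apply/measurable_EFinP; exact: measurableT_comp.
rewrite EFinM lee_wpmul2l ?lee_fin// -rW; exact: le_integral_rms.
Qed.

End stein_bound.

(** * From test functions to distribution functions *)

Section ramp.
Context {R : realType}.

(** The function that equals 1 up to t, 0 from t + delta on, and is linear in
    between, written with absolute values to make continuity and the Lipschitz
    bound immediate. *)
Definition ramp (t delta x : R) : R :=
  (1 + `|(t + delta - x) / delta| - `|(t - x) / delta|) / 2.

Variables (t delta : R).
Hypothesis delta0 : 0 < delta.

Lemma ramp01 x : 0 <= ramp t delta x <= 1.
Proof.
rewrite /ramp.
have -> : (t + delta - x) / delta = (t - x) / delta + 1 by field; rewrite gt_eqF.
set u := (t - x) / delta.
have := ler_normD u 1; have := ler_normB (u + 1) 1; rewrite addrK normr1 => h1 h2.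
by apply/andP; split; lra.
Qed.

Lemma ramp1 x : x <= t -> ramp t delta x = 1.
Proof.
move=> xt; have d0 := delta0; have [h1 h2] : 0 <= t + delta - x /\ 0 <= t - x by split; lra.
rewrite /ramp !ger0_norm ?divr_ge0// ?ltW//.
by field; rewrite gt_eqF.
Qed.

Lemma ramp0 x : t + delta < x -> ramp t delta x = 0.
Proof.
move=> xt; have d0 := delta0; have [h1 h2] : t + delta - x <= 0 /\ t - x <= 0 by split; lra.
rewrite /ramp !ler0_norm ?pmulr_lle0 ?invr_gt0//.
by field; rewrite gt_eqF.
Qed.

Lemma ramp_lipschitz x y : ramp t delta x <= ramp t delta y + `|x - y| / delta.
Proof.
have E (s : R) : `| `|(s - x) / delta| - `|(s - y) / delta| | <= `|x - y| / delta.
  apply: (le_trans (ler_dist_dist _ _)).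
  have -> : (s - x) / delta - (s - y) / delta = (y - x) / delta by field; rewrite gt_eqF.
  by rewrite normrM distrC normfV (gtr0_norm delta0).
have := E (t + delta); have := E t; rewrite !ler_norml /ramp => /andP[? ?] /andP[? ?].
by lra.
Qed.

Lemma continuous_ramp : continuous (ramp t delta).
Proof.
move=> x; apply: cvgM; last exact: cvg_cst.
apply: cvgB; first apply: cvgD; first exact: cvg_cst.
  by apply: cvg_norm; apply: cvgM; [apply: cvgB; [exact: cvg_cst|exact: cvg_id]|exact: cvg_cst].
by apply: cvg_norm; apply: cvgM; [apply: cvgB; [exact: cvg_cst|exact: cvg_id]|exact: cvg_cst].
Qed.

Section probability_of_rays.
Context {d : measure_display} {T : measurableType d} (P : probability T R) (Y : T -> R).
Hypothesis mY : measurable_fun [set: T] Y.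

Let mray s : measurable (Y @^-1` `]-oo, s]).
Proof. by rewrite -[X in measurable X]setTI; exact: mY. Qed.

Let mrampY : measurable_fun [set: T] (fun x => (ramp t delta (Y x))%:E).
Proof.
apply/measurable_EFinP; apply: measurableT_comp => //.
by apply: continuous_measurable_fun; exact: continuous_ramp.
Qed.

Lemma ray_le_ramp : (P (Y @^-1` `]-oo, t]) <= \int[P]_x (ramp t delta (Y x))%:E)%E.
Proof.
rewrite -[X in P X]setIT -integral_indic//; apply: ge0_le_integral => //.
  exact/measurable_EFinP.
move=> x _; rewrite lee_fin indicE; case: (boolP (x \in _)) => [|_].
  by rewrite inE /= in_itv/= => Yt; rewrite ramp1.
by case/andP: (ramp01 (Y x)).
Qed.

Lemma ramp_le_ray : (\int[P]_x (ramp t delta (Y x))%:E <= P (Y @^-1` `]-oo, (t + delta)%R]))%E.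
Proof.
rewrite -[X in P X]setIT -integral_indic//; apply: ge0_le_integral => //.
- by move=> x _; rewrite lee_fin; case/andP: (ramp01 (Y x)).
- exact/measurable_EFinP.
move=> x _; rewrite lee_fin indicE; case: (boolP (x \in _)) => [_|].
  by case/andP: (ramp01 (Y x)).
by rewrite notin_setE /= in_itv/= => /negP; rewrite -ltNge => /ramp0 ->.
Qed.

End probability_of_rays.
End ramp.

(** The normal density is bounded by 1. *)
Lemma normal_ray_le {R : realType} (t delta : R) : 0 < delta ->
  (normal_prob 0 1 `]-oo, (t + delta)%R] <= normal_prob 0 1 `]-oo, t] + delta%:E)%E.
Proof.
move=> delta0.
have -> : [set` `]-oo, (t + delta)]] = [set` `]-oo, t]] `|` [set` `]t, (t + delta)]] :> set R.
  by rewrite -itv_bndbnd_setU// ?bnd_simp// lerDl ltW.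
apply: (le_trans (measureU2 _ _ _)) => //; apply: leeD => //.
apply: (@le_trans _ _ (\int[lebesgue_measure]_(x in `]t, (t + delta)%R]) 1%:E)%E).
  apply: ge0_le_integral => //.
  - by move=> x _; rewrite lee_fin normal_pdf_ge0.
  - by apply/measurable_EFinP/measurable_funTS; exact: measurable_normal_pdf.
  - move=> x _; rewrite lee_fin; apply: (le_trans (normal_pdf_ub _ _ (oner_neq0 _))).
    have pi1 : 1 <= 1 ^+ 2 * pi *+ 2 :> R.
      by have := @pi_ge2 R; rewrite expr1n mul1r mulr2n; lra.
    rewrite /normal_peak invf_le1 ?sqrtr_gt0 ?(lt_le_trans ltr01)//.
    by rewrite -[leLHS]sqrtr1 ler_wsqrtr.
rewrite integral_cst// mul1e.
have := @lebesgue_measure_itv R `]t, t + delta]; rewrite /= lte_fin ltrDl delta0 => ->.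
by rewrite -EFinB addrAC subrr add0r.
Qed.

Section normal_approximation.
Context {d : measure_display} {T : measurableType d} {R : realType}.
Context (P : probability T R) (Z L : T -> R) (kappa eta : R).
Hypotheses (mZ : measurable_fun [set: T] Z) (mL : measurable_fun [set: T] L).
Hypothesis stein : forall f : R -> R, continuous f -> (forall x, 0 <= f x <= 1) ->
  (`|\int[P]_x (f (L x))%:E - \int[normal_prob 0 1]_x (f x)%:E| <= kappa%:E)%E.
Hypothesis ZL : (rms P (fun x => Z x - L x)%R <= eta%:E)%E.

Let integral_ramp_le (Y Y' : T -> R) (t delta : R) : 0 < delta ->
  measurable_fun [set: T] Y -> measurable_fun [set: T] Y' ->
  (forall x, `|Y x - Y' x| = `|Z x - L x|) ->
  (\int[P]_x (ramp t delta (Y x))%:E <=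
   \int[P]_x (ramp t delta (Y' x))%:E + (eta / delta)%:E)%E.
Proof.
move=> delta0 mY mY' YE.
have mr (V : T -> R) : measurable_fun [set: T] V ->
    measurable_fun [set: T] (fun x => (ramp t delta (V x))%:E).
  move=> mV; apply/measurable_EFinP; apply: measurableT_comp => //.
  by apply: continuous_measurable_fun; exact: continuous_ramp.
have r0 x : 0 <= ramp t delta x by case/andP: (ramp01 t delta0 x).
have mZL : measurable_fun [set: T] (fun x => `|Z x - L x|%:E).
  by apply/measurable_EFinP; apply: measurableT_comp => //; exact: measurable_funB.
have d0 : (0 <= (delta^-1)%:E)%E by rewrite lee_fin invr_ge0 ltW.
apply: (@le_trans _ _ (\int[P]_x ((ramp t delta (Y' x))%:E + (delta^-1)%:E * `|Z x - L x|%:E))%E).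
  apply: ge0_le_integral => //.
  - by move=> x _; rewrite lee_fin.
  - exact: mr.
  - by apply: emeasurable_funD; [exact: mr|exact: emeasurable_funM].
  - by move=> x _; rewrite -EFinM -EFinD lee_fin -YE mulrC ramp_lipschitz.
rewrite ge0_integralD//; last 4 first.
- by move=> x _; rewrite lee_fin.
- exact: mr.
- by move=> x _; rewrite mule_ge0.
- exact: emeasurable_funM.
rewrite leeD2l// ge0_integralZl// mulrC EFinM lee_wpmul2l//.
by apply: le_trans ZL; apply: le_integral_rms; exact: measurable_funB.
Qed.

Let rampN (t delta : R) := (\int[normal_prob 0 1]_x (ramp t delta x)%:E)%E.

Let ramp_close (t delta : R) : 0 < delta ->
  (\int[P]_x (ramp t delta (Z x))%:E <= rampN t delta + (kappa + eta / delta)%:E)%E /\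
  (rampN t delta <= \int[P]_x (ramp t delta (Z x))%:E + (kappa + eta / delta)%:E)%E.
Proof.
move=> delta0; have r01 x := ramp01 t delta0 x.
have cr : continuous (ramp t delta) by exact: continuous_ramp.
have h1 := integral_ramp_le t delta0 mZ mL (fun x => erefl).
have h2 := integral_ramp_le t delta0 mL mZ (fun x => distrC _ _).
have := stein cr r01.
have If (V : T -> R) : measurable_fun [set: T] V ->
    (\int[P]_x (ramp t delta (V x))%:E)%E \is a fin_num.
  move=> mV; rewrite ge0_fin_numE; last first.
    by apply: integral_ge0 => x _; rewrite lee_fin; case/andP: (r01 (V x)).
  apply: (le_lt_trans (ramp_le_ray t delta0 P mV)); apply: (@le_lt_trans _ _ 1%E); last exact: ltry.
  by apply: probability_le1; rewrite -[X in measurable X]setTI; exact: mV.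
move: (If Z mZ) (If L mL) h1 h2; rewrite /rampN (std_normal_integral cr r01).
case: (\int[P]_x (ramp t delta (Z x))%:E)%E => [z| |]//.
case: (\int[P]_x (ramp t delta (L x))%:E)%E => [l| |]// _ _.
rewrite -!EFinD abse_EFin !lee_fin ler_norml => h1 h2 /andP[h3 h4]; split; lra.
Qed.

(** The indicator of ]-oo, t] lies between the ramps that start to descend at
    t - delta and at t.  Passing from Z to L costs eta / delta since the ramp is
    Lipschitz, from L to the normal law kappa, and from the ramp back to the
    half-line delta. *)
Lemma normal_approximation (t delta : R) : 0 < delta ->
  (P (Z @^-1` `]-oo, t]) <= normal_prob 0 1 `]-oo, t] + (kappa + eta / delta + delta)%:E)%E /\
  (normal_prob 0 1 `]-oo, t] <= P (Z @^-1` `]-oo, t]) + (kappa + eta / delta + delta)%:E)%E.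
Proof.
move=> delta0; split.
  apply: (le_trans (ray_le_ramp t delta0 P mZ)).
  apply: (le_trans (ramp_close t delta0).1).
  rewrite [X in (_ <= _ + X)%E]EFinD addeA addeAC; apply: leeD => //.
  apply: le_trans (ramp_le_ray t delta0 (normal_prob 0 1) (@measurable_id _ _ _)) _.
  exact: normal_ray_le.
have := normal_ray_le (t - delta) delta0; rewrite subrK => h.
apply: (le_trans h); rewrite [X in (_ <= _ + X)%E]EFinD addeA leeD2r//.
have h1 := ray_le_ramp (t - delta) delta0 (normal_prob 0 1) (@measurable_id _ _ _).
apply: (le_trans h1); apply: (le_trans (ramp_close (t - delta) delta0).2).
rewrite leeD2r//; have := ramp_le_ray (t - delta) delta0 P mZ.
by rewrite subrK.
Qed.

End normal_approximation.

(** * Variance and fluctuations of the stable cost *)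

Section stable_cost_approximation.
Context {d : measure_display} {T : measurableType d} {R : realType}.
Context {P : probability T R} {n : nat} (w : edge n -> {RV P >-> R}).
Hypothesis iid_w : iid_weibull2 w.

Let C : {RV P >-> R} := stable_cost w.
Let Z : {RV P >-> R} := standardize C.

(** The statement for a fixed n: sigma is the standard deviation of the linear
    part and s that of the cost.  The constants come from
    [cost_decomposition]: 72 = 2 * 36 bounds |s - sigma| and the distance in L2
    of the centered cost to the linear part, and dividing by s and sigma
    instead of a common value costs another 72 / s. *)
Lemma stable_cost_approximation : exists (sigma s : R),
  [/\ [/\ 0 <= sigma, 0 <= s & `|s - sigma| <= 72],
      9^-1 * (\sum_(1 <= j < n.+1) j%:R^-1) <= sigma ^+ 2
        <= 9^-1 * (\sum_(1 <= j < n.+1) j%:R^-1) + 5,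
      ('V_P[C] = (s ^+ 2)%:E)%E &
      0 < sigma -> 0 < s -> forall t delta : R, 0 < delta ->
        let K := 4 / sigma + 144 / s / delta + delta in
        (cdf Z t
           <= normal_prob 0 1 `]-oo, t] + K%:E)%E /\
        (normal_prob 0 1 `]-oo, t]
           <= cdf Z t + K%:E)%E].
Proof.
have [eps [ind law CE]] := exponential_increments iid_w.
have [m [E [mE decomp rE]]] := cost_decomposition ind law.
pose beta (l : 'I_n) : R := sensitivity n (n - l).
pose L := centered_sum eps beta [set: 'I_n]%SET.
pose S := \sum_(l < n) beta l ^+ 2.
pose sigma := Num.sqrt S.
have S0 : 0 <= S by apply: sumr_ge0 => l _; exact: sqr_ge0.
have sigma0 : 0 <= sigma by exact: sqrtr_ge0.
have sigma2 : sigma ^+ 2 = S by rewrite sqr_sqrtr.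
have mL : measurable_fun [set: T] L by exact: measurable_centered_sumT.
have mC : measurable_fun [set: T] (stable_cost w) by exact: measurable_stable_cost.
have Ls : rms P L = sigma%:E.
  apply: rms_eq => //; rewrite centered_sum_sqr// sigma2; congr (_%:E).
  by apply: eq_bigl => l; rewrite inE.
have CE' : {ae P, forall x, stable_cost w x = m + L x + E x}.
  by apply: filterS CE => x ->; exact: decomp.
have [s [s0 Vs sB DB]] :=
  variance_perturbation mC mL mE CE' (expectation_centered_sum ind law beta) Ls rE.
exists sigma, s; split => //.
- by split => //; rewrite (le_trans sB)//; lra.
- by rewrite sigma2 /S (sum_rev_ord n (fun j => sensitivity n j ^+ 2)) sum_sensitivity_sqr.
move=> sigma_gt0 s_gt0 t delta delta0 K.
pose c l := beta l / sigma.
have c1 : \sum_l c l ^+ 2 = 1.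
  under eq_bigr do rewrite expr_div_n.
  by rewrite -mulr_suml -/S -sigma2 divff// expf_neq0// gt_eqF.
pose L' := centered_sum eps c [set: 'I_n]%SET.
have L'E x : L' x = sigma^-1 * L x.
  by rewrite /L' /L /centered_sum mulr_sumr; apply: eq_bigr => l _; rewrite /c; ring.
have mL' : measurable_fun [set: T] L' by exact: measurable_centered_sumT.
have mZ : measurable_fun [set: T] Z by exact: measurable_standardize.
pose D x := stable_cost w x - fine ('E_P[stable_cost w])%E - L x.
have mD : measurable_fun [set: T] D by apply: measurable_funB => //; exact: measurable_funB.
have ZE x : Z x - L' x = s^-1 * D x + (s^-1 - sigma^-1) * L x.
  have -> : Z x = (C x - fine ('E_P[C])%E) / s.
    have VC : fine ('V_P[C])%E = s ^+ 2 by rewrite -[RHS]/(fine (s ^+ 2)%:E) -Vs.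
    by rewrite /Z /= /standardize VC sqrtr_sqr ger0_norm.
  have -> : D x = C x - fine ('E_P[C])%E - L x by [].
  rewrite L'E; move: (fine _) (C x) => e y.
  by field; rewrite !gt_eqF.
have ZL : (rms P (fun x => Z x - L' x)%R <= (144 / s)%:E)%E.
  have -> : (fun x => Z x - L' x)%R = (fun x => s^-1 * D x + (s^-1 - sigma^-1) * L x).
    by apply/funext => x; exact: ZE.
  apply: (le_trans (rmsD P _ _)); [exact: measurable_funM|exact: measurable_funM|].
  have D72 : (0 <= 2 * 36 :> R) by lra.
  apply: le_trans (leeD (rms_scale_le s^-1 mD D72 DB)
    (rms_scale_le (s^-1 - sigma^-1) mL sigma0 _)) _; first by rewrite Ls.
  rewrite -EFinD lee_fin.
  have -> : s^-1 - sigma^-1 = (sigma - s) / s / sigma by field; rewrite !gt_eqF.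
  rewrite !normrM !normfV distrC (gtr0_norm s_gt0) (gtr0_norm sigma_gt0).
  rewrite divfK ?gt_eqF// mulrC -mulrDl ler_wpM2r ?invr_ge0//.
  by move: sB; lra.
have kappa : 2 * Num.sqrt (\sum_l c l ^+ 4) <= 4 / sigma.
  have c4 : \sum_l c l ^+ 4 <= (2 / sigma) ^+ 2.
    rewrite -[leRHS]mulr1 -[X in _ <= _ * X]c1 mulr_sumr; apply: ler_sum => l _.
    rewrite (exprM _ 2 2) [leLHS]expr2 ler_wpM2r ?sqr_ge0//.
    rewrite lerXn2r ?nnegrE ?divr_ge0 ?sensitivity_ge0//.
    by rewrite ler_wpM2r ?invr_ge0// sensitivity_le2 ?subn_gt0 ?leq_subr.
  have : Num.sqrt (\sum_l c l ^+ 4) <= 2 / sigma.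
    have h : 0 <= 2 / sigma by rewrite divr_ge0.
    by rewrite -[leRHS](ger0_norm h) -sqrtr_sqr ler_wsqrtr.
  lra.
have st (f : R -> R) : continuous f -> (forall x, 0 <= f x <= 1) ->
    (`|\int[P]_x (f (L' x))%:E - \int[normal_prob 0 1]_x (f x)%:E| <= (4 / sigma)%:E)%E.
  by move=> cf f01; apply: (le_trans (stein_bound ind law c1 cf f01)); rewrite lee_fin.
exact: (normal_approximation mZ mL' st ZL t delta0).
Qed.

End stable_cost_approximation.
Lemma nbhs_infty_sqrt_ln {R : realType} (A : R) :
  \forall n \near \oo, A <= Num.sqrt (ln n%:R).
Proof.
near=> n; have nA : expR (A ^+ 2) <= n%:R by near: n; exact: nbhs_infty_ger.
apply: (le_trans (ler_norm A)); rewrite -sqrtr_sqr ler_wsqrtr//.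
by rewrite -[leLHS]expRK ler_ln// posrE ?expR_gt0// (lt_le_trans (expR_gt0 _) nA).
Unshelve. all: by end_near. Qed.

(** Here r = sqrt(ln n); the error is dominated by 2 sigma (s - sigma), of
    order r. *)
Lemma variance_ratio_bound {R : realType} (r sigma s : R) : 1 <= r -> 0 <= sigma ->
  9^-1 * r ^+ 2 <= sigma ^+ 2 <= 9^-1 * (1 + r ^+ 2) + 5 -> `|s - sigma| <= 72 ->
  `|9^-1 - s ^+ 2 / r ^+ 2| <= 6000 / r.
Proof.
move=> r1 sigma0 /andP[lo up] d72.
have r0 : 0 < r by exact: lt_le_trans r1.
have sr : sigma <= r + 3.
  have : sigma ^+ 2 <= (r + 3) ^+ 2 by rewrite sqrrD -mulr_natl; nra.
  by rewrite ler_pXn2r ?nnegrE//; lra.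
have -> : 9^-1 - s ^+ 2 / r ^+ 2 = (9^-1 * r ^+ 2 - s ^+ 2) / r ^+ 2 by field; rewrite gt_eqF.
rewrite normrM normfV (ger0_norm (sqr_ge0 r)).
rewrite ler_pdivrMr ?exprn_gt0//.
have -> : 6000 / r * r ^+ 2 = 6000 * r by field; rewrite gt_eqF.
have E : s ^+ 2 - sigma ^+ 2 = (s - sigma) * (s - sigma) + 2 * sigma * (s - sigma) by ring.
have b1 : `|(s - sigma) * (s - sigma)| <= 72 * 72 by rewrite normrM ler_pM.
have b2 : `|2 * sigma * (s - sigma)| <= 2 * sigma * 72.
  by rewrite normrM (ger0_norm (mulr_ge0 _ sigma0))// ler_wpM2l// mulr_ge0.
move: b1 b2; rewrite !ler_norml => /andP[? ?] /andP[? ?].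
by apply/andP; split; lra.
Qed.

Lemma normal_error_small {R : realType} (r sigma s e : R) : 0 < e ->
  432 <= r -> 36 / e <= r -> 864 / (e / 3) / (e / 3) <= r ->
  0 <= sigma -> 9^-1 * r ^+ 2 <= sigma ^+ 2 -> `|s - sigma| <= 72 ->
  [/\ 0 < sigma, 0 < s & 4 / sigma + 144 / s / (e / 3) + e / 3 <= e].
Proof.
move=> e0 r2 r3 r4 sigma0 sigma_lo.
have r0 : 0 < r by apply: (lt_le_trans _ r2); rewrite ltr0n.
have sigmar : r / 3 <= sigma.
  move: sigma_lo; rewrite (_ : 9^-1 * r ^+ 2 = (r / 3) ^+ 2); last by field.
  by rewrite ler_pXn2r ?nnegrE// divr_ge0// ltW.
(* s >= sigma - 72 >= r / 3 - 72, which is at least r / 6 as soon as r >= 432. *)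
rewrite ler_norml => /andP[sr _]; have {}sr : r / 6 <= s by lra.
have delta0 : 0 < e / 3 by rewrite divr_gt0.
have sigma_gt0 : 0 < sigma by apply: lt_le_trans sigmar; rewrite divr_gt0.
have s_gt0 : 0 < s by apply: lt_le_trans sr; rewrite divr_gt0.
split => //.
have k1 : 4 / sigma <= e / 3.
  rewrite ler_pdivrMr//; apply: (@le_trans _ _ (e / 3 * (r / 3))); last by rewrite ler_wpM2l// ltW.
  by move: r3; rewrite ler_pdivrMr//; lra.
have k2 : 144 / s / (e / 3) <= e / 3.
  rewrite ler_pdivrMr// ler_pdivrMr//.
  apply: (@le_trans _ _ (e / 3 * (e / 3) * (r / 6))); last first.
    by rewrite ler_wpM2l// mulr_ge0// ltW.
  by move: r4; rewrite !ler_pdivrMr//; lra.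
by lra.
Qed.

Lemma dist_le {R : realType} (x y K e : R) :
  x <= y + K -> y <= x + K -> K <= e -> `|y - x| <= e.
Proof. by move=> xy yx Ke; rewrite ler_norml; apply/andP; split; lra. Qed.

Theorem theorem1p5 (R : realType) (d : nat -> measure_display)
    (T : forall n : nat, measurableType (d n))
    (P : forall n : nat, probability (T n) R)
    (w : forall n : nat, edge n -> {RV (P n) >-> R})
    (iid_w : forall n : nat, iid_weibull2 (w n)) :
  let C n : {RV (P n) >-> R} := stable_cost (w n) in
  ('V_(P n)[C n] * ((ln n%:R)^-1)%:E)%E @[n --> \oo] --> (9^-1 : R)%:E /\
  cvg_in_distribution (fun n => standardize (C n) : {RV (P n) >-> R})
    (normal_prob 0 1).
Proof.
move=> C.
have approx n := stable_cost_approximation (iid_w n).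
have lnE n : 1 <= Num.sqrt (ln (n%:R : R)) -> (0 < n)%N /\ Num.sqrt (ln n%:R) ^+ 2 = ln n%:R :> R.
  move=> r1; case: n r1 => [|n] r1; first by rewrite ln0// sqrtr0 in r1; lra.
  by rewrite sqr_sqrtr// ln_ge0// ler1n.
have range n : 1 <= Num.sqrt (ln (n%:R : R)) -> forall sigma : R,
    9^-1 * (\sum_(1 <= j < n.+1) j%:R^-1) <= sigma ^+ 2
      <= 9^-1 * (\sum_(1 <= j < n.+1) j%:R^-1) + 5 ->
    9^-1 * Num.sqrt (ln n%:R) ^+ 2 <= sigma ^+ 2 <= 9^-1 * (1 + Num.sqrt (ln n%:R) ^+ 2) + 5.
  move=> /lnE[n0 ->] sigma /andP[lo up]; have /andP[h1 h2] := @harmonic_ln R n n0.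
  by apply/andP; split; lra.
split.
  apply: cvg_EFin.
    near=> n; have [sigma [s [_ _ Vs _]]] := approx n.
    by rewrite (Vs : ('V_(P n)[C n] = (s ^+ 2)%:E)%E).
  apply/cvgrPdist_le => e e0; near=> n.
  have [sigma [s [[sigma0 s0 ss] sb Vs _]]] := approx n.
  have r1 : 1 <= Num.sqrt (ln (n%:R : R)) by near: n; exact: nbhs_infty_sqrt_ln.
  have re : 6000 / e <= Num.sqrt (ln (n%:R : R)) by near: n; exact: nbhs_infty_sqrt_ln.
  have [n0 lnr] := lnE n r1.
  rewrite /= (Vs : ('V_(P n)[C n] = (s ^+ 2)%:E)%E) /= -lnr.
  apply: (le_trans (variance_ratio_bound r1 sigma0 (range n r1 _ sb) ss)).
  by rewrite ler_pdivrMr ?(lt_le_trans ltr01)// mulrC -ler_pdivrMr.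
move=> t _.
have fN : normal_prob 0 1 [set` `]-oo, t]] \is a @fin_num R by exact: fin_num_measure.
have fZ n : cdf (standardize (C n) : {RV (P n) >-> R}) t \is a fin_num.
  by apply: fin_num_measure.
rewrite -[X in _ --> X](fineK fN); apply: cvg_EFin; first by apply: nearW => n; exact: fZ.
apply/cvgrPdist_le => e e0; near=> n.
have [sigma [s [[sigma0 s0 ss] sb Vs clt]]] := approx n.
have r1 : 1 <= Num.sqrt (ln (n%:R : R)) by near: n; exact: nbhs_infty_sqrt_ln.
have r2 : 432 <= Num.sqrt (ln (n%:R : R)) by near: n; exact: nbhs_infty_sqrt_ln.
have r3 : 36 / e <= Num.sqrt (ln (n%:R : R)) by near: n; exact: nbhs_infty_sqrt_ln.
have r4 : 864 / (e / 3) / (e / 3) <= Num.sqrt (ln (n%:R : R)) by near: n; exact: nbhs_infty_sqrt_ln.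
have /andP[sigma_lo _] := range n r1 _ sb.
have [sigma_gt0 s_gt0 Ke] := normal_error_small e0 r2 r3 r4 sigma0 sigma_lo ss.
have [h1 h2] := clt sigma_gt0 s_gt0 t _ (divr_gt0 e0 (ltr0n R 3)).
move: h1 h2; rewrite -(fineK fN) -(fineK (fZ n)) -!EFinD !lee_fin => h1 h2.
exact: dist_le h1 h2 Ke.
Unshelve. all: by end_near. Qed.
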